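(* Let $\mu\in[0,1)\cup i\mathbb{R}^+$ be fixed. The monogenic polynomials $X_{n,m}^+[\mu]$ ($n\ge0$, $0\le m\le n+1$) and $X_{n,m}^-[\mu]$ ($n\ge0$, $1\le m\le n+1$) are pairwise orthogonal with respect to $\langle\cdot,\cdot\rangle_{[\mu]}$. Their norms are given by $$\begin{aligned}\|X_{n,m}^\pm\|_{[\mu]}^2=\frac{\pi\,\mu^{2n+3}}{(n+2)(n+m+2)(2n+1)!!\,(2n+3)!!}\Big[&(n+2)(n+m)(n+m+1)(n-m+3)!\,(n+m+2)!\,I[n,m-1]\\&+2\delta_{0,m}(n+m+2)(n+1)!\,(n+2)!\,I[n,1]\\&+(n+2)(n-m+1)!\,(n+m+2)!\,\big(I[n,m+1]\\&\quad+2(n-m+2)(n+m+1)(1+\delta_{0,m})I[n,m]\big)\Big],\end{aligned}$$ where $I[n,m]=\int_1^{1/\mu}P_n^m(t)P_{n+2}^m(t)\,dt$ and $\delta$ is the Kronecker symbol.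
   Context: Domains. For $\mu\in[0,1)\cup i\mathbb{R}^+$ (so $1-\mu^2>0$) let $\Omega_\mu=\{x=(x_0,x_1,x_2)\in\mathbb{R}^3:\ x_0^2+\frac{x_1^2+x_2^2}{1-\mu^2}<1\}$ (prolate spheroid for $\mu\in(0,1)$, unit ball for $\mu=0$, oblate spheroid for $\mu\in i\mathbb{R}^+$). Let $\phi$ be the angle with $x_1=\rho\cos\phi$, $x_2=\rho\sin\phi$, $\rho=\sqrt{x_1^2+x_2^2}$, and $\Phi_m^+(\phi)=\cos(m\phi)$, $\Phi_m^-(\phi)=\sin(m\phi)$. Legendre functions. $P_n^m$ ($m\ge0$) is the associated Legendre function: $P_n^m(t)=(-1)^m(1-t^2)^{m/2}\frac{d^mP_n}{dt^m}(t)$ for $t\in[-1,1]$ and $P_n^m(z)=\big((z^2-1)^{1/2}\big)^m\frac{d^mP_n}{dz^m}(z)$ for $z\in\mathbb{C}\setminus[-1,1]$, where $(z^2-1)^{1/2}$ is the branch asymptotic to $z$ at infinity. Thus $P_n^m=0$ for $m>n$. For $z\notin[-1,1]$ and $n\ge1$, $P_n^{-1}(z)=\frac{(n-1)!}{(n+1)!}P_n^1(z)$ (when $n=m=0$ the term containing $I[n,m-1]$ has coefficient $n+m=0$ and is zero). In the definition of $I[n,m]$ the integrand is that for arguments off $[-1,1]$; it is a polynomial in $t$, so for $\mu\in i\mathbb{R}^+$ the integral is a path-independent complex line integral. The products $\mu^{2n+3}I[n,m]$ are polynomials in $\mu$, and for $\mu=0$ the right-hand side of the norm formula is understood as its limit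 as $\mu\to0$. Spheroidal harmonics. For $\mu\ne0$ put $\omega=\sqrt{(x_0+\mu)^2+\rho^2}+\sqrt{(x_0-\mu)^2+\rho^2}$ (principal square roots; $\omega\geq 0$) and $\widehat U_{n,m}[\mu](x)=\frac{(n-m)!}{(2n-1)!!}\,\mu^n P_n^m\!\left(\frac{2x_0}{\omega}\right)P_n^m\!\left(\frac{\omega}{2\mu}\right)$ for $0\le m\le n$ (with $(-1)!!=1$); for $\mu=0$ put $\widehat U_{n,m}[0](x)=|x|^nP_n^m(x_0/|x|)$. Let $U_{n,m}^\pm[\mu]=\widehat U_{n,m}[\mu]\,\Phi_m^\pm(\phi)$; these extend by continuity to harmonic polynomials on $\mathbb{R}^3$. (For $\mu\in(0,1)$, writing $x_0=\mu\cos u\cosh v$, $\rho=\mu\sin u\sinh v$, one has $2x_0/\omega=\cos u$, $\omega/(2\mu)=\cosh v$; the case $\mu\in i\mathbb{R}^+$ is the analytic continuation in $\mu$.) Monogenics. $\mathbb{R}^3$ is identified with $\{x_0+x_1e_1+x_2e_2\}$ inside the quaternions. With $\partial=\frac{\partial}{\partial x_0}-e_1\frac{\partial}{\partial x_1}-e_2\frac{\partial}{\partial x_2}$, the basic monogenic spheroidal polynomials are $X_{n,m}^\pm[\mu]=\partial U_{n+1,m}^\pm[\mu]$. For $f=f_0+f_1e_1+f_2e_2$ and $g=g_0+g_1e_1+g_2e_2$, $\langle f,g\rangle_{[\mu]}=\int_{\Omega_\mu}(f_0g_0+f_1g_1+f_2g_2)\,dx$, with norm $\|\cdot\|_{[\mu]}$.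 *)

(* Defs.v *)
From HB Require Import structures.
From mathcomp Require Import all_boot all_order all_algebra.
From mathcomp Require Import all_classical all_reals all_analysis.
From mathcomp Require Import complex.

Set Implicit Arguments.
Unset Strict Implicit.
Unset Printing Implicit Defensive.

Import Order.TTheory GRing.Theory Num.Theory.
Import numFieldNormedType.Exports.

Local Open Scope classical_set_scope.
Local Open Scope ring_scope.
Local Open Scope complex_scope.

Fixpoint dfact (k : nat) : nat :=
  match k with
  | k'.+2 => (k'.+2 * dfact k')%N
  | _ => 1%N
  end.

Section Legendre.
Variable R : realType.

(* Rodrigues' formula *)
Definition legendre (n : nat) : {poly R[i]} :=
  ((2 ^ n * n`!)%:R)^-1 *: (('X^2 - 1) ^+ n)^`(n).

Definition legendreP_on (n m : nat) (z : R[i]) : R[i] :=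
  (-1) ^+ m * sqrtc (1 - z ^+ 2) ^+ m * ((legendre n)^`(m)).[z].

(* [sqrtc] is the principal root. Since 1 - z^-2 lies in ]-oo, 0] only for
   nonzero z in [-1, 1], [z * sqrtc (1 - z ^- 2)] is holomorphic off [-1, 1];
   its square is z^2 - 1 and it is asymptotic to z at infinity. *)
Definition legendreP_off (n m : nat) (z : R[i]) : R[i] :=
  (z * sqrtc (1 - z ^- 2)) ^+ m * ((legendre n)^`(m)).[z].

(* In the order of R[i], [-1 <= z <= 1] says that z is real and in [-1, 1]. *)
Definition legendreP (n m : nat) (z : R[i]) : R[i] :=
  if -1 <= z <= 1 then legendreP_on n m z else legendreP_off n m z.

(* Negative orders follow P_n^{-k} = (n-k)!/(n+k)! P_n^k; only k = 1 is used.
   When k > n the truncated subtraction is harmless, as P_n^k = 0. *)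
Definition legendrePz_off (n : nat) (m : int) (z : R[i]) : R[i] :=
  match m with
  | Posz k => legendreP_off n k z
  | Negz k => (n - k.+1)`!%:R / (n + k.+1)`!%:R * legendreP_off n k.+1 z
  end.

(* integral along the straight segment from a to b *)
Definition line_integral (f : R[i] -> R[i]) (a b : R[i]) : R[i] :=
  let g (s : R) := f (a + s%:C * (b - a)) * (b - a) in
  (\int[lebesgue_measure]_(s in `[0, 1]) complex.Re (g s)) +i*
  (\int[lebesgue_measure]_(s in `[0, 1]) complex.Im (g s)).

Definition legendreI (mu : R[i]) (n : nat) (m : int) : R[i] :=
  line_integral (fun t => legendrePz_off n m t * legendrePz_off n.+2 m t)
    1 mu^-1.

Definition norm_formula (n m : nat) (mu : R[i]) : R[i] :=
  let I := legendreI mu n in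
  let delta0m : R[i] := (m == 0%N)%:R in
  (pi : R)%:C * mu ^+ (2 * n + 3) /
    (n.+2%:R * (n + m + 2)%:R
     * (dfact (2 * n + 1))%:R * (dfact (2 * n + 3))%:R) *
  (n.+2%:R * (n + m)%:R * (n + m + 1)%:R * (n + 3 - m)`!%:R * (n + m + 2)`!%:R
     * I (m%:Z - 1)
   + 2 * delta0m * (n + m + 2)%:R * (n + 1)`!%:R * (n + 2)`!%:R * I 1
   + n.+2%:R * (n + 1 - m)`!%:R * (n + m + 2)`!%:R
     * (I (m%:Z + 1)
        + 2 * (n + 2 - m)%:R * (n + m + 1)%:R * (1 + delta0m) * I m%:Z)).

End Legendre.

Section Spheroidal.
Variable R : realType.

(* Points (x0, x1, x2), and also the quaternions x0 + x1 e1 + x2 e2. *)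
Notation R3 := (R * R * R)%type.
Implicit Types (x y : R3) (mu : R[i]).

Definition co0 x : R := x.1.1.
Definition co1 x : R := x.1.2.
Definition co2 x : R := x.2.

(* The canonical norm of the product type is the max norm. *)
Definition euclid x : R := Num.sqrt (co0 x ^+ 2 + co1 x ^+ 2 + co2 x ^+ 2).

Definition rho x : R := Num.sqrt (co1 x ^+ 2 + co2 x ^+ 2).

(* some phi with x1 = rho cos phi and x2 = rho sin phi *)
Definition angle x : R :=
  xget 0 [set phi | co1 x = rho x * cos phi /\ co2 x = rho x * sin phi].

(* [0, 1) together with i R^+; the strict orders of R[i] also force the
   relevant numbers to be real *)
Definition admissible mu : Prop :=
  0 <= mu < 1 \/ (exists2 nu : R, 0 < nu & mu = 0 +i* nu).

Definition Omega mu : set R3 :=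
  [set x | (co0 x ^+ 2)%:C + (co1 x ^+ 2 + co2 x ^+ 2)%:C / (1 - mu ^+ 2) < 1].

Definition omega mu x : R[i] :=
  sqrtc (((co0 x)%:C + mu) ^+ 2 + (rho x ^+ 2)%:C)
  + sqrtc (((co0 x)%:C - mu) ^+ 2 + (rho x ^+ 2)%:C).

Definition Uhat (n m : nat) mu x : R[i] :=
  if mu == 0 then
    (euclid x ^+ n)%:C * legendreP n m (co0 x / euclid x)%:C
  else
    (n - m)`!%:R / (dfact (2 * n).-1)%:R * mu ^+ n
    * legendreP n m (2 * (co0 x)%:C / omega mu x)
    * legendreP n m (omega mu x / (2 * mu)).

(* [true] stands for the superscript +, [false] for - *)
Definition Phi (s : bool) (m : nat) (phi : R) : R :=
  if s then cos (m%:R * phi) else sin (m%:R * phi).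

(* A dense open set on which the formulas defining the harmonics make sense
   and are continuous for every admissible mu: the excluded points contain
   the axis (no angle) and, for mu = i nu, the focal disk x0 = 0, rho <= nu
   (omega vanishes, branch cut of the square roots). *)
Definition generic : set R3 := [set x | co0 x != 0 /\ rho x != 0].

(* Extension by continuity from [generic]. For admissible mu, [Uhat] is
   real-valued there, so that [Re] loses nothing. *)
Definition U (s : bool) (n m : nat) mu x : R :=
  lim (complex.Re (Uhat n m mu y) * Phi s m (angle y)
        @[y --> within generic (nbhs x)]).

(* d/dx0 - e1 d/dx1 - e2 d/dx2 *)
Definition del (f : R3 -> R) x : R3 :=
  ('D_((1, 0, 0) : R3) f x, - 'D_((0, 1, 0) : R3) f x,
   - 'D_((0, 0, 1) : R3) f x).

Definition X (s : bool) (n m : nat) mu : R3 -> R3 := del (U s n.+1 m mu).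

Definition inner mu (f g : R3 -> R3) : R :=
  \int[((lebesgue_measure \x lebesgue_measure) \x lebesgue_measure)%E]_(x in
      Omega mu)
    (co0 (f x) * co0 (g x) + co1 (f x) * co1 (g x) + co2 (f x) * co2 (g x)).

Definition norm mu (f : R3 -> R3) : R := Num.sqrt (inner mu f f).

Definition basis_index (s : bool) (n m : nat) : bool :=
  ((s || (0 < m)) && (m <= n.+1))%N.

End Spheroidal.

(* Main.v *)
Require Import Defs.
From HB Require Import structures.
From mathcomp Require Import all_boot all_order all_algebra.
From mathcomp Require Import all_classical all_reals all_analysis.
From mathcomp Require Import complex.
From mathcomp Require Import measurable_realfun ring lra zify.
Import Order.TTheory GRing.Theory Num.Theory.
Import numFieldNormedType.Exports.
Set Implicit Arguments.
Unset Strict Implicit.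
Unset Printing Implicit Defensive.
Local Open Scope classical_set_scope.
Local Open Scope ring_scope.
Local Open Scope complex_scope.

(* Put [kap = mu^2], which is real. In the coordinates [x0 = s y], [rho^2 = (1 - s^2) (y^2 - kap)]
   the harmonic [U_(n,m)] separates into Legendre functions of [s] and of [y / mu]; since it is
   determined by its values on the axis, it equals a polynomial [rho^m Phi_m Q(x0, rho^2)] whose
   coefficients are polynomial in [kap], which covers all admissible [mu] at once. As [del U] is the
   gradient up to signs, inner products are Dirichlet integrals. Integrating over the disks
   [x0 = const] gives orthogonality for different angular factors, by the rotation symmetry. For
   equal ones Green's formula leaves an integral over the boundary [y = 1] of [U] times its conormal
   derivative, that is, [\int_(-1)^1 P_(n+1)^m P_(n'+1)^m] times a product of values at
   [1 / mu], which vanishes for [n <> n'] and is explicit for [n = n'].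
   For the stated form of the norm, [P_n^m] and [P_(n+2)^m] solve Sturm-Liouville equations whose
   eigenvalues differ by [4 n + 6], so [I[n, m]] is a Wronskian at [1 / mu], and the contiguous
   relations turn the bracket into [P_(n+1)^m] times its conormal derivative at [1 / mu]. *)

(** * Legendre polynomials *)

Section LegendrePolynomials.
Variable F : numFieldType.
Implicit Types (n m k : nat) (p q : {poly F}).

(** Everything integrated is a polynomial, cut off at the boundary of the domain. A field multiplied
    by a function vanishing on the circle [rho^2 = h] has a divergence of integral zero, by the
    fundamental theorem along chords. This replaces polar coordinates and boundary integrals; the
    area of a disk is the only integral that needs a trigonometric substitution. The Legendre
    algebra is stated over an arbitrary [numFieldType] because it serves twice: over [R] for the
    inner products, where only the real number [kap] occurs, and over [R[i]] for [norm_formula],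
    where [1 / mu] may be imaginary. The two meet in [energy], which commutes with the embedding of
    [R] in [R[i]]. The norm identity is proved for every nonzero complex [nu], so that the limit at
    [mu = 0] is the value of a polynomial at [0]. The square roots and the angle in the definition
    of [U] never reach the integrals: they are removed on the dense set [generic], where the
    branches are under control. *)

Definition leg n : {poly F} := ((2 ^ n * n`!)%:R)^-1 *: (('X^2 - 1) ^+ n)^`(n).

Definition legD n m : {poly F} := (leg n)^`(m).

Lemma deriv_natr k : (k%:R : {poly F})^`() = 0.
Proof. by rewrite -polyC_natr derivC. Qed.

Lemma derivnS_mulX k p :
  ('X * p)^`(k.+1) = 'X * p^`(k.+1) + k.+1%:R * p^`(k).
Proof.
elim: k => [|k IH]; first by rewrite derivn1 derivn0 derivM derivX; ring.
rewrite derivnS IH derivD !derivM derivX deriv_natr -!derivnS; ring.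
Qed.

Lemma derivn_mulX k p :
  ('X * p)^`(k) = 'X * p^`(k) + k%:R * p^`(k.-1).
Proof. by case: k => [|k]; [rewrite !derivn0; ring | exact: derivnS_mulX]. Qed.

Lemma deriv_Xsq1 : ('X^2 - 1 : {poly F})^`() = 2%:R * 'X.
Proof. by rewrite derivB derivXn -[1]/(1%:R) deriv_natr; ring. Qed.

Lemma rodrigues_deriv n :
  (('X^2 - 1 : {poly F}) ^+ n.+1)^`() = (2 * n.+1)%:R * ('X * ('X^2 - 1) ^+ n).
Proof. by rewrite deriv_exp deriv_Xsq1 /= -mulr_natr; ring. Qed.

(** With [v = (X^2 - 1)^n] this is [(X^2 - 1) v' = 2 n X v] differentiated [k + 1] times; from
    [k = n] on it becomes the equation of the derivatives of [P_n]. *)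
Lemma rodrigues_ode n k :
  ('X^2 - 1) * (('X^2 - 1 : {poly F}) ^+ n)^`(k.+2)
  + 2%:R * (k.+1%:R - n%:R) * 'X * (('X^2 - 1) ^+ n)^`(k.+1)
  + k.+1%:R * (k%:R - (2 * n)%:R) * (('X^2 - 1) ^+ n)^`(k) = 0.
Proof.
elim: k => [|k IH].
  have v1 : ('X^2 - 1) * (('X^2 - 1) ^+ n)^`() = 2%:R * n%:R * 'X * ('X^2 - 1) ^+ n :> {poly F}.
    case: n => [|n]; first by rewrite expr0 -[1]/(1%:R) deriv_natr; ring.
    by rewrite rodrigues_deriv [_ ^+ n.+1]exprS; ring.
  have := congr1 (@deriv F) v1.
  rewrite !derivM deriv_Xsq1 !deriv_natr derivX derivnS derivn1 derivn0 => e.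
  move/eqP: e; rewrite -subr_eq0 => /eqP e; rewrite -[RHS]e; ring.
have := congr1 (@deriv F) IH.
rewrite !derivD !derivM deriv_Xsq1 !derivB !deriv_natr !derivX -!derivnS deriv0 => e.
by rewrite -[RHS]e; ring.
Qed.

Lemma legD_S n m : legD n m.+1 = (legD n m)^`().
Proof. by rewrite /legD derivnS. Qed.

Lemma derivn_derivn j k p : p^`(j)^`(k) = p^`(k + j).
Proof. by elim: k => [|k IH]; rewrite ?derivn0 // derivnS IH addSn -derivnS. Qed.

Lemma legDE n m : legD n m = ((2 ^ n * n`!)%:R)^-1 *: (('X^2 - 1) ^+ n)^`(n + m).
Proof. by rewrite /legD /leg derivnZ derivn_derivn addnC. Qed.

Lemma legD_ode n m :
  ('X^2 - 1) * legD n m.+2 + (2 * m.+1)%:R * 'X * legD n m.+1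
  = (n%:R - m%:R) * (n + m).+1%:R * legD n m.
Proof.
rewrite !legDE !addnS -!mul_polyC; set c := _%:P.
have := congr1 (fun x => c * x) (rodrigues_ode n (n + m)); rewrite /= mulr0 => e.
apply/eqP; rewrite -subr_eq0 -e; apply/eqP; ring.
Qed.

Lemma leg_natmulS n :
  n.+1%:R * leg n.+1 = ('X^2 - 1) * (leg n)^`() + n.+1%:R * 'X * leg n.
Proof.
rewrite /leg derivZ -derivnS; set v := ('X^2 - 1) ^+ n.
have e1 : (('X^2 - 1 : {poly F}) ^+ n.+1)^`(n.+1)
   = (2 * n.+1)%:R * ('X * v^`(n) + n%:R * v^`(n.-1)).
  rewrite derivSn rodrigues_deriv mulr_natl derivnMn derivn_mulX.
  exact: esym (mulr_natl _ _).
have e2 : (('X^2 - 1 : {poly F}) ^+ n.+1)^`(n.+1)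
   = ('X^2 - 1) * v^`(n.+1) + (2 * n.+1)%:R * 'X * v^`(n) + (n.+1 * n)%:R * v^`(n.-1).
  rewrite [_ ^+ n.+1]exprS -/v (_ : _ * v = 'X * ('X * v) - v); last by ring.
  rewrite derivnB !derivnS_mulX derivn_mulX; ring.
(* Twice [e2] minus [e1]: this combination eliminates the derivative of [v] of order [n.-1]. *)
have e3 : (('X^2 - 1 : {poly F}) ^+ n.+1)^`(n.+1)
   = 2%:R * (('X^2 - 1) * v^`(n.+1) + n.+1%:R * 'X * v^`(n)).
  transitivity (2%:R * (('X^2 - 1 : {poly F}) ^+ n.+1)^`(n.+1)
     - (('X^2 - 1 : {poly F}) ^+ n.+1)^`(n.+1)); first by ring.
  by rewrite {1}e2 e1; ring.
rewrite e3 -!mul_polyC.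
have -> : ((2 ^ n.+1 * n.+1`!)%:R^-1 : F)%:P = ((2 ^ n * n`!)%:R^-1)%:P * ((2 * n.+1)%:R^-1)%:P.
  rewrite -polyCM -invfM -natrM; congr (_%:R^-1)%:P; rewrite expnS factS; lia.
set c := (_^-1)%:P; set d := (_^-1)%:P.
have hd : d * (2 * n.+1)%:R = 1 by rewrite -polyC_natr -polyCM mulVf // pnatr_eq0.
transitivity (d * (2 * n.+1)%:R * (('X^2 - 1) * (c * v^`(n.+1)) + n.+1%:R * 'X * (c * v^`(n)))); first by ring.
by rewrite hd mul1r.
Qed.

Lemma leg_derivS n : (leg n.+1)^`() = n.+1%:R * leg n + 'X * (leg n)^`().
Proof.
rewrite /leg !derivZ -!derivnS derivSn rodrigues_deriv mulr_natl derivnMn derivnS_mulX.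
rewrite -!mul_polyC.
have -> : ((2 ^ n.+1 * n.+1`!)%:R^-1 : F)%:P = ((2 ^ n * n`!)%:R^-1)%:P * ((2 * n.+1)%:R^-1)%:P.
  rewrite -polyCM -invfM -natrM; congr (_%:R^-1)%:P; rewrite expnS factS; lia.
set c := (_^-1)%:P; set d := (_^-1)%:P.
have hd : d * (2 * n.+1)%:R = 1 by rewrite -polyC_natr -polyCM mulVf // pnatr_eq0.
rewrite -mulr_natl; set v := ('X^2 - 1) ^+ n.
transitivity (d * (2 * n.+1)%:R * (n.+1%:R * (c * v^`(n)) + 'X * (c * v^`(n.+1)))); first by ring.
by rewrite hd mul1r mulr1.
Qed.

(** The relations [a] and [c] raise the degree by one and follow from the case [m = 0] by
    differentiation; [b] and [d] lower it and follow from them by elimination. Together they bring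
    degrees [n] and [n + 2] to the common degree [n + 1]. *)
Lemma legD_contig_a n m :
  legD n.+1 m.+1 = (n + m).+1%:R * legD n m + 'X * legD n m.+1.
Proof.
elim: m => [|m IH].
  by rewrite /legD !derivn1 !derivn0 leg_derivS addn0.
rewrite legD_S IH derivD !derivM deriv_natr derivX -!legD_S; ring.
Qed.

Lemma legD_contig_c n m :
  (n.+1%:R - m%:R) * legD n.+1 m = ('X^2 - 1) * legD n m.+1 + (n + m).+1%:R * 'X * legD n m.
Proof.
elim: m => [|m IH].
  rewrite subr0 /legD !derivn1 !derivn0 leg_natmulS addn0; ring.
have := congr1 (@deriv F) IH.
rewrite derivD !derivM deriv_Xsq1 derivB !deriv_natr derivX -!legD_S => e.
have -> : (n.+1%:R - m.+1%:R) * legD n.+1 m.+1 = (n.+1%:R - m%:R) * legD n.+1 m.+1 - legD n.+1 m.+1 by ring.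
rewrite [X in _ - X]legD_contig_a.
(* The zero product reproduces the left-hand side of [e], where the derivative of the constant
   factor stands as [0 - 0]. *)
have -> : (n.+1%:R - m%:R) * legD n.+1 m.+1 =
  (0 - 0) * legD n.+1 m + (n.+1%:R - m%:R) * legD n.+1 m.+1 by ring.
rewrite e; ring.
Qed.

Lemma legD_contig_d n m :
  (n + m).+1%:R * legD n m = (n.+1%:R - m%:R) * 'X * legD n.+1 m - ('X^2 - 1) * legD n.+1 m.+1.
Proof. by rewrite [_ * 'X]mulrC -mulrA legD_contig_c legD_contig_a; ring. Qed.

Lemma legD_contig_b n m :
  legD n m.+1 = 'X * legD n.+1 m.+1 - (n.+1%:R - m%:R) * legD n.+1 m.
Proof. by rewrite legD_contig_c legD_contig_a; ring. Qed.

Lemma legD_const n : legD n n = ((2 * n)`!%:R / (2 ^ n * n`!)%:R)%:P.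
Proof.
rewrite legDE addnn -mul2n; set v := _ ^+ n.
have [mv sv] : v \is monic /\ size v = (2 * n).+1.
  have m1 : ('X^2 - 1 : {poly F}) \is monic by apply: monicXnsubC.
  split; first exact: monic_exp.
  have := size_exp ('X^2 - 1 : {poly F}) n; rewrite size_XnsubC // => <-.
  by rewrite prednK // size_poly_gt0 monic_neq0 // monic_exp.
have -> : v^`(2 * n) = ((2 * n)`!%:R)%:P.
  apply/polyP => i; rewrite coef_derivn coefC; case: eqP => [->|/eqP i0].
    have := monicP mv; rewrite lead_coefE sv /= addn0 => ->.
    by rewrite ffactnn.
  by rewrite nth_default ?mul0rn // sv -addn1 leq_add2l lt0n.
by rewrite -mul_polyC -polyCM mulrC.
Qed.

Lemma legD_gt n m : (n < m)%N -> legD n m = 0.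
Proof.
move=> nm; rewrite -(subnK nm) /legD -derivn_derivn -/(legD n n.+1) legD_S legD_const derivC.
by rewrite -polyC0 derivnC polyC0 if_same.
Qed.

Lemma rodrigues_even n i : odd i -> (('X^2 - 1 : {poly F}) ^+ n)`_i = 0.
Proof.
elim: n i => [|n IH] i oi; first by rewrite expr0 coef1; case: i oi.
rewrite exprS mulrBl mul1r coefB coefXnM (IH _ oi) subr0; case: ltnP => // i2.
by rewrite IH // oddB // oi.
Qed.

Lemma legD_parity n m i : odd (i + m + n) -> (legD n m)`_i = 0.
Proof.
move=> o; rewrite legDE coefZ coef_derivn rodrigues_even ?mul0rn ?mulr0 //.
by rewrite addnC [(n + m)%N]addnC addnA.
Qed.

Lemma size_legD n m : (m <= n)%N -> size (legD n m) = (n - m).+1.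
Proof.
move=> mn; apply/eqP; rewrite eqn_leq; apply/andP; split.
  apply/leq_sizeP => j nj.
  have : ((legD n m)^`((n - m).+1))`_(j - (n - m).+1) = 0.
    by rewrite /legD derivn_derivn -/(legD n _) legD_gt ?coef0 // addSn subnK.
  rewrite coef_derivn subnKC // => /eqP; rewrite mulrn_eq0 => /orP[|/eqP //].
  by rewrite eqn0Ngt ffact_gt0 nj.
rewrite ltnNge; apply/negP => h.
have : legD n n = 0.
  by rewrite -{2}(subnK mn) /legD -derivn_derivn derivn_poly0.
rewrite legD_const => /eqP; rewrite polyC_eq0 mulf_eq0 invr_eq0 !pnatr_eq0.
by rewrite muln_eq0 expn_eq0 /= -!leqn0 leqNgt fact_gt0 leqNgt fact_gt0.
Qed.

Definition prim p : {poly F} := \poly_(i < (size p).+1) (p`_i.-1 / i%:R).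

(** A formal integral, so that it also makes sense between complex end points. [Rintegral_horner]
    and [line_integral_poly] identify it with Lebesgue and line integrals. *)
Definition pint (a b : F) p : F := (prim p).[b] - (prim p).[a].

Lemma coef_prim p i : (prim p)`_i = if i == 0%N then 0 else p`_i.-1 / i%:R.
Proof.
rewrite coef_poly; case: i => [|i]; first by rewrite invr0 mulr0.
by rewrite ltnS /=; case: ltnP => // h; rewrite nth_default // mul0r.
Qed.

Lemma deriv_prim p : (prim p)^`() = p.
Proof.
apply/polyP => i; rewrite coef_deriv coef_prim /= -[_ *+ i.+1]mulr_natr.
by rewrite divfK ?pnatr_eq0.
Qed.

Lemma prim_deriv p : prim p^`() = p - (p`_0)%:P.
Proof.
apply/polyP => -[|i]; rewrite coefB coef_prim coefC /= ?subrr // subr0.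
by rewrite coef_deriv -[_ *+ i.+1]mulr_natr mulfK // pnatr_eq0.
Qed.

Lemma pint_deriv a b p : pint a b p^`() = p.[b] - p.[a].
Proof. by rewrite /pint prim_deriv !hornerE; ring. Qed.

Lemma pintD a b p q : pint a b (p + q) = pint a b p + pint a b q.
Proof.
rewrite -[p]deriv_prim -[q]deriv_prim -derivD !pint_deriv !hornerD; ring.
Qed.

Lemma pintCM a b c p : pint a b (c%:P * p) = c * pint a b p.
Proof.
by rewrite -[p]deriv_prim -deriv_mulC !pint_deriv !hornerE; ring.
Qed.

Lemma pintB a b p q : pint a b (p - q) = pint a b p - pint a b q.
Proof.
rewrite -[p]deriv_prim -[q]deriv_prim -derivB !pint_deriv hornerD hornerN; rewrite !hornerE; ring.
Qed.

Lemma pintnM a b k p : pint a b (k%:R * p) = k%:R * pint a b p.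
Proof. by rewrite -polyC_natr pintCM. Qed.

(** The integral of [P_n^m P_n'^m] over [[-1, 1]]: the two square roots multiply to the weight and
    the two signs cancel. *)
Definition legJ n n' m : F := pint (-1) 1 ((1 - 'X^2) ^+ m * legD n m * legD n' m).

Lemma deriv_1mXsq m : ((1 - 'X^2 : {poly F}) ^+ m.+1)^`() = - (2 * m.+1)%:R * 'X * (1 - 'X^2) ^+ m.
Proof.
by rewrite deriv_exp derivB -[1]/(1%:R) deriv_natr derivXn /= -mulr_natr -[_ *+ 2]mulr_natr; ring.
Qed.

(** The factor [(X^2 - 1)^(m + 1)] puts the equation in Sturm-Liouville form. Integrated over
    [[-1, 1]] the identity gives orthogonality; integrated from [1] to [1 / mu] it evaluates
    [I[n, m]]. *)
Lemma legendre_wronskian (a b : {poly F}) (la lb : F) m :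
  ('X^2 - 1) * a^`()^`() + (2 * m.+1)%:R * 'X * a^`() = la%:P * a ->
  ('X^2 - 1) * b^`()^`() + (2 * m.+1)%:R * 'X * b^`() = lb%:P * b ->
  (('X^2 - 1) ^+ m.+1 * (a * b^`() - a^`() * b))^`() = (lb - la)%:P * (('X^2 - 1) ^+ m * (a * b)).
Proof.
move=> ea eb; rewrite derivM deriv_exp deriv_Xsq1 derivB !derivM /= -mulr_natr polyCB.
set e := 'X^2 - 1 in ea eb *; set em := e ^+ m; rewrite [e ^+ m.+1]exprS -/em.
transitivity (em * (a * (e * b^`()^`() + (2 * m.+1)%:R * 'X * b^`())
   - b * (e * a^`()^`() + (2 * m.+1)%:R * 'X * a^`()))); first ring.
by rewrite ea eb; ring.
Qed.

Lemma legD_odeC n m :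
  ('X^2 - 1) * (legD n m)^`()^`() + (2 * m.+1)%:R * 'X * (legD n m)^`()
  = ((n%:R - m%:R) * (n + m).+1%:R)%:P * legD n m.
Proof. by rewrite polyCM polyCB !polyC_natr -!legD_S legD_ode. Qed.

Lemma legJ_ortho n n' m : n != n' -> legJ n n' m = 0.
Proof.
move=> nn'.
have := pint_deriv (-1) 1 (('X^2 - 1) ^+ m.+1 * (legD n m * (legD n' m)^`() - (legD n m)^`() * legD n' m)).
rewrite (legendre_wronskian (legD_odeC n m) (legD_odeC n' m)) pintCM.
have e0 x : x ^+ 2 = 1 -> (('X^2 - 1 : {poly F}) ^+ m.+1).[x] = 0.
  by move=> e; rewrite horner_exp !hornerE e subrr expr0n.
rewrite !hornerM !e0 ?sqrrN ?expr1n // !mul0r subrr => /eqP.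
rewrite mulf_eq0 => /orP[|/eqP h].
  rewrite (_ : _ - _ = (n'%:R - n%:R) * (n + n' + 1)%:R); last by ring.
  by rewrite mulf_eq0 subr_eq0 eqr_nat addn1 pnatr_eq0 orbF eq_sym (negPf nn').
have oneE : (1 - 'X^2 : {poly F}) ^+ m = ((-1) ^+ m)%:P * ('X^2 - 1) ^+ m.
  by rewrite rmorphXn /= polyCN -exprMn; congr (_ ^+ _); rewrite mulNr mul1r opprB.
by rewrite /legJ oneE -!mulrA pintCM h mulr0.
Qed.

(** Integration by parts moves one derivative onto the weighted factor, which Legendre's equation
    turns back into a multiple of [legD n m]; the weight kills the boundary terms. *)
Lemma legJ_S n m : legJ n n m.+1 = (n%:R - m%:R) * (n + m).+1%:R * legJ n n m.
Proof.
have := pint_deriv (-1) 1 ((1 - 'X^2) ^+ m.+1 * legD n m.+1 * legD n m).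
have e0 x : x ^+ 2 = 1 -> ((1 - 'X^2 : {poly F}) ^+ m.+1).[x] = 0.
  by move=> e; rewrite horner_exp !hornerE e subrr expr0n.
rewrite !hornerM !e0 ?sqrrN ?expr1n // !mul0r subrr.
rewrite !derivM deriv_1mXsq -!legD_S => h.
apply: subr0_eq; rewrite -[RHS]h /legJ -pintCM -pintB; congr pint.
have := legD_ode n m; rewrite !polyCM polyCB !polyC_natr.
set c := (n%:R - m%:R) * _ => e.
rewrite -[c * (_ * _ * _)](_ : (1 - 'X^2) ^+ m * legD n m * (c * legD n m) = _); last by ring.
by rewrite -e [(1 - 'X^2) ^+ m.+1]exprS; ring.
Qed.

Lemma pint_1mXsq n :
  pint (-1) 1 ((1 - 'X^2) ^+ n) = 2 * (2 ^ n * n`!)%:R ^+ 2 / (2 * n).+1`!%:R.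
Proof.
elim: n => [|n IH].
  have := pint_deriv (-1) 1 'X; rewrite derivX expr0 => ->; rewrite !hornerX.
  by rewrite (_ : (2 ^ 0 * 0`!)%N = 1%N) // (_ : (2 * 0).+1`! = 1%N) //; field.
have := pint_deriv (-1) 1 ('X * (1 - 'X^2) ^+ n.+1).
rewrite !hornerM !horner_exp !hornerE sqrrN expr1n subrr expr0n /= !mulr0 subrr.
rewrite derivM derivX deriv_1mXsq (_ : 1 * _ ^+ n.+1 + _ =
  (2 * n + 3)%:R * (1 - 'X^2) ^+ n.+1 + (- (2 * n.+1)%:R)%:P * (1 - 'X^2) ^+ n); last first.
  by rewrite polyCN polyC_natr [(1 - 'X^2) ^+ n.+1]exprS; ring.
rewrite pintD pintnM pintCM IH => /eqP; rewrite addr_eq0 mulNr opprK => /eqP h.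
have n3 : (2 * n + 3)%:R != 0 :> F by rewrite pnatr_eq0 addn3.
apply: (mulfI n3); rewrite h.
rewrite (_ : (2 * n.+1).+1 = (2 * n).+3); last by lia.
rewrite !factS expnS !natrM.
rewrite (_ : (2 * n).+3 = 2 * n + 3)%N; last by lia.
have f0 : (2 * n)`!%:R != 0 :> F by rewrite pnatr_eq0 -lt0n fact_gt0.
have f1 : (2 * n).+1%:R != 0 :> F by rewrite pnatr_eq0.
have f2 : (2 * n).+2%:R != 0 :> F by rewrite pnatr_eq0.
have -> : (2 * n).+2%:R = 2 * n.+1%:R :> F by ring.
have f4 : n.+1%:R != 0 :> F by rewrite pnatr_eq0.
set a := (2 ^ n)%:R; set b := n`!%:R.
field.
by rewrite f0 -natrM !nat1r -natrD !pnatr_eq0 addn3.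
Qed.

(** Descending induction on [m] by [legJ_S], with [k = n - m]. It starts at [m = n], where
    [legD n n] is constant and only the integral of the weight remains. *)
Lemma legJ_norm n m : (m <= n)%N ->
  legJ n n m = 2 * (n + m)`!%:R / ((2 * n).+1%:R * (n - m)`!%:R).
Proof.
move=> mn; rewrite -{1 2}(subKn mn); have : (n - m <= n)%N by exact: leq_subr.
move: (n - m)%N => k; elim: k => [|k IH] kn.
  rewrite subn0 /legJ -mulrA legD_const -polyCM mulrC pintCM pint_1mXsq.
  rewrite factS natrM addnn -mul2n fact0.
  have f0 : (2 * n)`!%:R != 0 :> F by rewrite pnatr_eq0 -lt0n fact_gt0.
  have f1 : (2 * n).+1%:R != 0 :> F by rewrite pnatr_eq0.
  have f2 : (2 ^ n * n`!)%:R != 0 :> F by rewrite pnatr_eq0 -lt0n muln_gt0 expn_gt0 fact_gt0.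
  rewrite natrM; set a := (2 ^ n)%:R; set b := n`!%:R.
  by field; rewrite f0 -natrM nat1r f1 /a /b !pnatr_eq0 -!lt0n expn_gt0 fact_gt0.
have := legJ_S n (n - k.+1); rewrite -subSn // subSS IH; last by exact: ltnW.
rewrite (_ : n%:R - (n - k.+1)%:R = k.+1%:R); last by rewrite natrB // subKr.
rewrite (_ : (n + (n - k))%N = (n + (n - k.+1)).+1); last by lia.
rewrite !factS !natrM => h.
have f0 : k.+1%:R * (n + (n - k.+1)).+1%:R != 0 :> F by rewrite -natrM pnatr_eq0.
apply: (mulfI f0); rewrite -h.
have f1 : (2 * n).+1%:R != 0 :> F by rewrite pnatr_eq0.
have f2 : k`!%:R != 0 :> F by rewrite pnatr_eq0 -lt0n fact_gt0.
have f3 : k.+1%:R != 0 :> F by rewrite pnatr_eq0.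
by field; rewrite f2 -natrM !nat1r !pnatr_eq0.
Qed.

Definition legW n k := legD n k * legD n.+2 k.+1 - legD n k.+1 * legD n.+2 k.

(* Eliminating the second derivatives by Legendre's equation, the terms in ['X * legD _ k.+1] cancel. *)
Lemma legW_S n k : ('X^2 - 1) * legW n k.+1 =
  (n.+2%:R - k%:R) * (n.+2 + k).+1%:R * legD n k.+1 * legD n.+2 k
  - (n%:R - k%:R) * (n + k).+1%:R * legD n k * legD n.+2 k.+1.
Proof.
rewrite -[_ * _ * legD n k]legD_ode -(mulrAC _ (legD n.+2 k)) -legD_ode /legW; ring.
Qed.

(** The bracket of the norm formula for [m = 0], up to a common factor, with [I[n, 1]] and [I[n, 0]]
    replaced by their Wronskians; [I[n, -1]] is a multiple of [I[n, 1]]. *)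
Lemma legW0_sum n :
  ('X^2 - 1) * legW n 1 + (n.+1 * n.+2)%:R * legW n 0 = (4 * n + 6)%:R * legD n.+1 0 * legD n.+1 1.
Proof.
have a0 := legD_contig_d n 0; have b0 := legD_contig_c n.+1 0.
have a1 := legD_contig_b n 0; have b1 := legD_contig_a n.+1 0.
rewrite legW_S /legW.
transitivity (2%:R * (legD n 1 * ((n.+2%:R - 0%:R) * legD n.+2 0) + ((n + 0).+1%:R * legD n 0) * legD n.+2 1)).
  by ring.
rewrite b0 a0 a1 b1; ring.
Qed.

(** The bracket for [m = j + 1]: its integrals [I[n, j]], [I[n, j + 2]] and [I[n, j + 1]] become
    Wronskians, and a common factor [(X^2 - 1)^(j + 1)] is taken out. The contiguous relations leave
    only degree [n + 1], where Legendre's equation removes one more derivative. *)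
Lemma legWS_sum n j (N := n.+1) :
  (N + j)%:R * (N + j).+1%:R * (N%:R - j%:R) * (N.+1%:R - j%:R) * legW n j
  + ('X^2 - 1) ^+ 2 * legW n j.+2
  + 2%:R * (N%:R - j%:R) * (N + j).+1%:R * (('X^2 - 1) * legW n j.+1)
  = (8 * n + 12)%:R * legD N j.+1 * (('X^2 - 1) * legD N j.+2 + j.+1%:R * 'X * legD N j.+1).
Proof.
rewrite {}/N.
have a0 := legD_contig_d n j; have b0 := legD_contig_c n.+1 j.
have a1 := legD_contig_b n j; have b1 := legD_contig_a n.+1 j.
have a2 := legD_contig_b n j.+1; have b2 := legD_contig_a n.+1 j.+1.
have r2 := legD_ode n.+1 j.
have r2' : ('X^2 - 1) * legD n.+1 j.+2 = (n.+1%:R - j%:R) * (n.+1 + j).+1%:R * legD n.+1 j - (2 * j.+1)%:R * 'X * legD n.+1 j.+1.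
  by rewrite -r2; ring.
have ea2 : ('X^2 - 1) * legD n j.+2 = 'X * (('X^2 - 1) * legD n.+1 j.+2) - ('X^2 - 1) * (n.+1%:R - j.+1%:R) * legD n.+1 j.+1.
  by rewrite a2; ring.
have eb2 : ('X^2 - 1) * legD n.+2 j.+2 = 'X * (('X^2 - 1) * legD n.+1 j.+2) + ('X^2 - 1) * (n.+1 + j.+1).+1%:R * legD n.+1 j.+1.
  by rewrite b2; ring.
rewrite r2' in ea2 eb2.
rewrite (_ : ('X^2 - 1) ^+ 2 * _ = ('X^2 - 1) * (('X^2 - 1) * legW n j.+2)); last by ring.
rewrite !legW_S /legW.
transitivity (
  (n.+1 + j).+1%:R * (n.+1%:R - j%:R) * ( ((n + j).+1%:R * legD n j) * (n.+2%:R - j%:R) * legD n.+2 j.+1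
    - (n + j).+1%:R * legD n j.+1 * ((n.+2%:R - j%:R) * legD n.+2 j))
  + ((n.+2%:R - j.+1%:R) * (n.+2 + j.+1).+1%:R * (('X^2 - 1) * legD n j.+2) * legD n.+2 j.+1
     - (n%:R - j.+1%:R) * (n + j.+1).+1%:R * legD n j.+1 * (('X^2 - 1) * legD n.+2 j.+2))
  + 2%:R * (n.+1%:R - j%:R) * (n.+1 + j).+1%:R *
     ((n.+2 + j).+1%:R * legD n j.+1 * ((n.+2%:R - j%:R) * legD n.+2 j)
     - (n%:R - j%:R) * ((n + j).+1%:R * legD n j) * legD n.+2 j.+1)).
  by ring.
rewrite ea2 eb2 a0 b0 a1 b1 r2'.
ring.
Qed.

(** [4 n + 6] is the eigenvalue difference [(n + 2) (n + 3) - n (n + 1)], the same for every [k].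
    The lower limit contributes nothing because the weight vanishes at [1]. *)
Lemma legI_wronskian n k (T : F) :
  (4 * n + 6)%:R * pint 1 T (('X^2 - 1) ^+ k * (legD n k * legD n.+2 k))
  = (T ^+ 2 - 1) ^+ k.+1 * (legW n k).[T].
Proof.
have e x : (('X^2 - 1 : {poly F}) ^+ k.+1).[x] = (x ^+ 2 - 1) ^+ k.+1.
  by rewrite horner_exp hornerD hornerN hornerXn hornerC.
have := pint_deriv 1 T (('X^2 - 1) ^+ k.+1 * legW n k).
rewrite !hornerM !e expr1n subrr [0 ^+ _]expr0n mul0r subr0 => <-.
rewrite /legW !legD_S (legendre_wronskian (legD_odeC n k) (legD_odeC n.+2 k)) pintCM.
congr (_ * _); ring.
Qed.
End LegendrePolynomials.

(** * Harmonic extension from the axis *)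

Section Bivariate.
Variable F : numFieldType.
Local Notation A := {poly {poly F}}.
Implicit Types (f g p : {poly F}) (a b G : A).

Definition lift f a : A := (map_poly (@polyC {poly F} \o @polyC F) f).[a].

(** The derivations of [A] over [F]. The rules below are proved once and applied to both partial
    derivatives, [deriv] in the outer variable and [deriv_in] in the inner one. *)
Definition is_deriv (d : A -> A) :=
  [/\ {morph d : a b / a + b}, forall a b, d (a * b) = d a * b + a * d b
    & forall c : F, d c%:P%:P = 0].

Lemma lift0 a : lift 0 a = 0.
Proof. by rewrite /lift rmorph0 horner0. Qed.

Lemma lift_cons f c a : lift (f * 'X + c%:P) a = lift f a * a + c%:P%:P.
Proof. by rewrite /lift rmorphD rmorphM /= map_polyX map_polyC hornerMXaddC. Qed.

Lemma liftD f g a : lift (f + g) a = lift f a + lift g a.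
Proof. by rewrite /lift rmorphD hornerD. Qed.

Lemma liftM f g a : lift (f * g) a = lift f a * lift g a.
Proof. by rewrite /lift rmorphM hornerM. Qed.

Lemma liftX a : lift 'X a = a.
Proof. by rewrite /lift map_polyX hornerX. Qed.

Lemma liftC c a : lift c%:P a = c%:P%:P.
Proof. by rewrite /lift map_polyC hornerC. Qed.

Lemma lift_natr k a : lift k%:R a = k%:R.
Proof. by rewrite -polyC_natr liftC !polyC_natr. Qed.

Lemma lift_XsqB c a : lift ('X^2 - c%:P) a = a ^+ 2 - c%:P%:P.
Proof. by rewrite liftD expr2 liftM liftX -polyCN liftC !polyCN. Qed.

Lemma lift_eval f a (x y : F) : (lift f a).[x%:P].[y] = f.[a.[x%:P].[y]].
Proof.
elim/poly_ind: f => [|f c IH]; first by rewrite lift0 !horner0.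
by rewrite lift_cons !hornerE IH.
Qed.

Lemma deriv_lift d f a : is_deriv d -> d (lift f a) = lift f^`() a * d a.
Proof.
case=> dD dM dC; elim/poly_ind: f => [|f c IH].
  by rewrite deriv0 !lift0 mul0r; have := dC 0; rewrite !polyC0.
rewrite lift_cons dD dM dC addr0 IH derivD derivM derivX derivC addr0 mulr1.
by rewrite liftD liftM liftX; ring.
Qed.

Lemma is_deriv_outer : is_deriv (@deriv {poly F}).
Proof. by split=> [a b|a b|c]; rewrite ?derivD ?derivM ?derivC. Qed.

Definition deriv_in a : A := map_poly (@deriv F) a.

Lemma coef_deriv_in a i : (deriv_in a)`_i = (a`_i)^`().
Proof. by rewrite coef_map_id0 ?deriv0. Qed.

Lemma is_deriv_inner : is_deriv deriv_in.
Proof.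
split=> [a b|a b|c].
- by apply/polyP => i; rewrite coefD !coef_deriv_in coefD derivD.
- apply/polyP => i; rewrite coefD coef_deriv_in !coefM raddf_sum -big_split /=.
  by apply: eq_bigr => j _; rewrite derivM !coef_deriv_in.
- by apply/polyP => i; rewrite coef_deriv_in coefC coef0; case: eqP; rewrite ?derivC ?deriv0.
Qed.

(* The outer variable of [A] is [s - 1], so that the axis [s = 1] is the origin of power series. *)
Let s : A := 1 + 'X.
Let y : A := 'X%:P.
Let ds := @deriv {poly F}.
Let dy := deriv_in.

(* The Laplacian of [rho^m Phi_m G] in the separated coordinates, times
   [(y^2 - kap s^2) / (rho^m Phi_m)]. *)
Definition sep_op (m : nat) (kap : F) (G : A) : A :=
  (1 - s ^+ 2) * ds (ds G) - (2 * m.+1)%:R * s * ds G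
  + (y ^+ 2 - kap%:P%:P) * dy (dy G) + (2 * m.+1)%:R * y * dy G.

Let dss : ds s = 1. Proof. by rewrite /ds /s derivD derivX -[1]/(1%:P) derivC add0r. Qed.
Let dsy : ds y = 0. Proof. by rewrite /ds /y derivC. Qed.
Let dys : dy s = 0.
Proof.
apply/polyP => i; rewrite coef_deriv_in coefD coef1 coefX coef0.
by case: i => [|[|i]]; rewrite /= ?addr0 ?add0r -?[1]/(1%:P) ?derivC ?deriv0.
Qed.
Let dyy : dy y = 1.
Proof. by apply/polyP => i; rewrite coef_deriv_in coefC coef1; case: eqP; rewrite ?derivX ?deriv0. Qed.

Let deriv_nat (d : A -> A) k : is_deriv d -> d (k%:R) = 0.
Proof. by case=> _ _ dC; rewrite -polyC_natr -polyC_natr dC. Qed.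

(** [rho^2] in the separated coordinates. *)
Let w (kap : F) : A := (1 - s ^+ 2) * (y ^+ 2 - kap%:P%:P).

Lemma is_deriv0 d : is_deriv d -> d 0 = 0.
Proof. by move=> h; rewrite -[0]/(0%:R) deriv_nat. Qed.

Lemma is_derivN d a : is_deriv d -> d (- a) = - d a.
Proof.
move=> h; case: (h) => dD _ _; apply/eqP; rewrite -addr_eq0 -dD addNr; exact/eqP/is_deriv0.
Qed.

Lemma is_derivX d a k : is_deriv d -> d (a ^+ k) = k%:R * a ^+ k.-1 * d a.
Proof.
move=> h; case: (h) => dD dM _; elim: k => [|k IH].
  by rewrite expr0 -[1]/(1%:R) deriv_nat // mul0r mul0r.
case: k IH => [|k] IH; first by rewrite expr1 expr0; ring.
by rewrite exprS dM IH [in RHS]/= [in LHS]/= !exprS; ring.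
Qed.

(** In cylindrical coordinates [rho^(2k) g(x0)] is sent to [rho^(2k) g''(x0) + 4 k (k + m)
    rho^(2k-2) g(x0)]; the factor in front is the one built into [sep_op]. *)
Lemma sep_op_term m kap g k :
  sep_op m kap (lift g (s * y) * w kap ^+ k) =
  (y ^+ 2 - kap%:P%:P * s ^+ 2) *
  (lift g^`()^`() (s * y) * w kap ^+ k
   + (4 * k * (k + m))%:R * w kap ^+ k.-1 * lift g (s * y)).
Proof.
have hs : is_deriv ds by exact: is_deriv_outer.
have hy : is_deriv dy by exact: is_deriv_inner.
case: (hs) => sD sM sC; case: (hy) => yD yM yC.
have sX a j := @is_derivX ds a j hs. have yX a j := @is_derivX dy a j hy.
have sN a := @is_derivN ds a hs. have yN a := @is_derivN dy a hy.
have sn j := @deriv_nat ds j hs. have yn j := @deriv_nat dy j hy.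
have s1 : ds 1 = 0 := sn 1%N. have y1 : dy 1 = 0 := yn 1%N.
have s0 : ds 0 = 0 := sn 0%N. have y0 : dy 0 = 0 := yn 0%N.
have sl f : ds (lift f (s * y)) = lift f^`() (s * y) * y.
  by rewrite deriv_lift // sM dss dsy; ring.
have yl f : dy (lift f (s * y)) = lift f^`() (s * y) * s.
  by rewrite deriv_lift // yM dys dyy; ring.
have sw : ds (w kap) = - 2%:R * s * (y ^+ 2 - kap%:P%:P).
  by rewrite /w sM !sD !sN !sX s1 sC dss dsy; ring.
have yw : dy (w kap) = 2%:R * y * (1 - s ^+ 2).
  by rewrite /w yM !yD !yN !yX y1 yC dys dyy; ring.
rewrite /sep_op; set W := w kap in sw yw *; have hW : W = (1 - s ^+ 2) * (y ^+ 2 - kap%:P%:P) by [].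
clearbody W.
rewrite !(dss, dsy, sn, sw, sl, s1, sC, sM, sX, sN, sD) !(dyy, dys, yn, yw, yl, y1, yC, yM, yX, yN, yD).
case: k => [|[|k]] /=; rewrite ?expr0 ?expr1.
- ring.
- rewrite hW; ring.
- rewrite [W ^+ k.+2]exprS [W ^+ k.+1]exprS; set z := W ^+ k; rewrite hW; ring.
Qed.

(* The solution of [(d_0^2 + d_rho^2 + (2m+1)/rho d_rho) f = 0] with [f = g] on the axis is
   [\sum_k axc m k * g^(2k)(x0) rho^(2k)]. *)
Definition axc m k : F := (-1) ^+ k * m`!%:R / (4 ^ k * k`! * (m + k)`!)%:R.

Lemma axc0 m : axc m 0 = 1.
Proof.
rewrite /axc expr0 mul1r expn0 fact0 !mul1n addn0.
by rewrite divff // pnatr_eq0 -lt0n fact_gt0.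
Qed.

Lemma axcS m k : axc m k.+1 * (4 * k.+1 * (k.+1 + m))%:R = - axc m k.
Proof.
rewrite /axc exprS expnS addnS !factS [(k.+1 + m)%N]addSn [(k + m)%N]addnC !natrM.
have f0 i : i`!%:R != 0 :> F by rewrite pnatr_eq0 -lt0n fact_gt0.
have f1 i : i.+1%:R != 0 :> F by rewrite pnatr_eq0.
have f2 : (4 ^ k)%:R != 0 :> F by rewrite pnatr_eq0 -lt0n expn_gt0.
move: (f0 k) (f0 (m + k)%N) (f1 k) (f1 (m + k)%N) (f1 3%N) f2.
move: (k`!%:R : F) ((m + k)`!%:R : F) (k.+1%:R : F) ((m + k).+1%:R : F) (m`!%:R : F) ((4 ^ k)%:R : F) ((-1) ^+ k : F).
move=> a b c d e f h a0 b0 c0 d0 g0 f0'; field.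
by rewrite ?a0 ?b0 ?c0 ?d0 ?f0'.
Qed.

Let sep_opD m kap a b : sep_op m kap (a + b) = sep_op m kap a + sep_op m kap b.
Proof.
case: is_deriv_outer => sD _ _; case: is_deriv_inner => yD _ _.
by rewrite /sep_op /ds /dy !sD !yD; ring.
Qed.

Let sep_opC m kap c a : sep_op m kap (c%:P%:P * a) = c%:P%:P * sep_op m kap a.
Proof.
case: is_deriv_outer => sD sM sC; case: is_deriv_inner => yD yM yC.
rewrite /sep_op /ds /dy !(sM, sC, mul0r, add0r) !(yM, yC, mul0r, add0r).
ring.
Qed.

Definition axial_lift m kap g : A :=
  \sum_(k < size g) (axc m k)%:P%:P * (lift g^`(2 * k) (s * y) * w kap ^+ k).

Lemma sep_op_axial m kap g : sep_op m kap (axial_lift m kap g) = 0.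
Proof.
pose t k : A := (axc m k * (4 * k * (k + m))%:R)%:P%:P * w kap ^+ k.-1 * lift g^`(2 * k) (s * y).
(* The sum telescopes by [axcS]: a partial sum leaves only the second derivative from its last term,
   which vanishes once the order of differentiation reaches the size of [g]. *)
have key n : sep_op m kap (\sum_(k < n) (axc m k)%:P%:P * (lift g^`(2 * k) (s * y) * w kap ^+ k))
   = (y ^+ 2 - kap%:P%:P * s ^+ 2) * - t n.
  elim: n => [|n IH].
    rewrite big_ord0 /t muln0 mul0n mulr0 !polyC0.
    have := sep_opC m kap 0 0; rewrite !polyC0 !mul0r => ->; ring.
  rewrite big_ord_recr /= sep_opD IH sep_opC sep_op_term /t axcS.
  have -> : g^`(2 * n.+1) = g^`(2 * n)^`()^`() by rewrite -!derivnS; congr derivn; lia.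
  rewrite [n.+1.-1]/=.
  move: (lift _ _) (lift _ _) (w kap ^+ n) (w kap ^+ n.-1) (axc m n) => a b c d e.
  rewrite !polyCN !polyCM !polyC_natr.
  by ring.
rewrite /axial_lift key /t derivn_poly0 ?lift0; first by ring.
by rewrite mul2n -addnn leq_addr.
Qed.

(** Separation of variables: the [s] half of [sep_op] acts with eigenvalue [- lam], the [y] half
    with [lam]. *)
Lemma sep_op_prod m kap lam p g :
  ('X^2 - 1) * p^`()^`() + (2 * m.+1)%:R * 'X * p^`() = lam%:P * p ->
  ('X^2 - kap%:P) * g^`()^`() + (2 * m.+1)%:R * 'X * g^`() = lam%:P * g ->
  sep_op m kap (lift p s * lift g y) = 0.
Proof.
move=> hp hg.
have hs : is_deriv ds by exact: is_deriv_outer.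
have hy : is_deriv dy by exact: is_deriv_inner.
case: (hs) => sD sM sC; case: (hy) => yD yM yC.
have y1 : dy 1 = 0 := deriv_nat 1 hy.
have s1 : ds 1 = 0 := deriv_nat 1 hs.
have lp : (s ^+ 2 - 1) * lift p^`()^`() s + (2 * m.+1)%:R * s * lift p^`() s = lam%:P%:P * lift p s.
  have := congr1 (lift^~ s) hp.
  by rewrite /= -['X^2 - 1]/('X^2 - 1%:P) liftD !liftM lift_XsqB lift_natr liftX liftC !polyC1.
have lg : (y ^+ 2 - kap%:P%:P) * lift g^`()^`() y + (2 * m.+1)%:R * y * lift g^`() y = lam%:P%:P * lift g y.
  have := congr1 (lift^~ y) hg.
  by rewrite /= liftD !liftM lift_XsqB lift_natr liftX liftC.
rewrite /sep_op !(sM, fun f a => deriv_lift f a hs, dss, dsy, s1, mulr1, mulr0, addr0, mul0r).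
rewrite !(yM, fun f a => deriv_lift f a hy, dys, dyy, y1, mulr1, mulr0, addr0, mul0r, add0r).
transitivity (- lift g y * (lam%:P%:P * lift p s) + lift p s * (lam%:P%:P * lift g y)); last by ring.
rewrite -lp -lg; ring.
Qed.

(* Comparing coefficients of [(s - 1)^j]: [sep_op] raises the order by one
   with the factor [2(j+1)(j+m+1)]. *)
Lemma sep_op_uniq m kap (G : A) : sep_op m kap G = 0 -> G`_0 = 0 -> G = 0.
Proof.
move=> LG G0; apply/polyP => j; rewrite coef0.
elim: j => [//|j IH].
have := congr1 (fun P : A => P`_j) LG.
rewrite coef0 /sep_op.
rewrite (_ : (1 - s ^+ 2) * ds (ds G) = - (2%:R * ('X * ds (ds G))) - 'X * ('X * ds (ds G))); last first.
  by rewrite /s; ring.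
rewrite (_ : (2 * m.+1)%:R * s * ds G = (2 * m.+1)%:R * ds G + (2 * m.+1)%:R * ('X * ds G)); last first.
  by rewrite /s; ring.
have dyc i : (dy (dy G))`_i = (G`_i)^`()^`() by rewrite !coef_deriv_in.
have dyc1 i : (dy G)`_i = (G`_i)^`() by rewrite !coef_deriv_in.
rewrite (_ : y ^+ 2 - kap%:P%:P = ('X^2 - kap%:P)%:P); last by rewrite polyCB polyC_exp.
rewrite (_ : (2 * m.+1)%:R * y = ((2 * m.+1)%:R * 'X)%:P); last by rewrite polyCM polyC_natr.
rewrite !mulr_natl !(coefD, coefN, coefCM, coefMn) dyc dyc1 IH !deriv0 !mulr0 !addr0.
rewrite !coefXM /ds !coef_deriv.
have hj : (2 * j.+1 * (j + m.+1))%:R != 0 :> {poly F}.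
  by rewrite -polyC_natr polyC_eq0 pnatr_eq0 !muln_eq0 addnS.
move=> e; apply: (mulfI hj); rewrite mulr0; apply: oppr_inj; rewrite [RHS]oppr0; apply: etrans e.
case: j IH {hj} => [|[|j]] IH; rewrite /= ?IH ?mul0rn ?addr0 ?subr0; ring.
Qed.

(** Both sides are annihilated by [sep_op]. On the axis [s = 1] they agree: [w] vanishes there, so
    the series reduces to its first term [g], and the product reduces to [p(1) g]. *)
Theorem axial_expansion m kap lam p g (x z : F) :
  ('X^2 - 1) * p^`()^`() + (2 * m.+1)%:R * 'X * p^`() = lam%:P * p ->
  ('X^2 - kap%:P) * g^`()^`() + (2 * m.+1)%:R * 'X * g^`() = lam%:P * g ->
  (\sum_(k < size g) axc m k * (g^`(2 * k).[x * z] * ((1 - x ^+ 2) * (z ^+ 2 - kap)) ^+ k))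
    * p.[1] = p.[x] * g.[z].
Proof.
move=> hp hg.
pose G := p.[1]%:P%:P * axial_lift m kap g - lift p s * lift g y.
have ev (f : {poly F}) (a : A) : (lift f a)`_0 = (lift f a).[0] by rewrite horner_coef0.
have G0 : G = 0.
  apply: (@sep_op_uniq m kap).
    have := sep_op_prod hp hg => h.
    have -> : G = p.[1]%:P%:P * axial_lift m kap g + (-1)%:P%:P * (lift p s * lift g y).
      by rewrite /G !polyCN polyC1; ring.
    by rewrite sep_opD !sep_opC h sep_op_axial !mulr0 addr0.
  have e1 (f : {poly F}) (a : A) : (lift f a).[0] = f \Po a.[0].
    elim/poly_ind: f => [|f c IH]; first by rewrite lift0 horner0 comp_poly0.
    by rewrite lift_cons !hornerE IH comp_polyD comp_polyM comp_polyX comp_polyC.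
  have s0 : s.[0] = 1 by rewrite /s hornerD hornerX -polyC1 hornerC addr0.
  have y0 : y.[0] = 'X by rewrite /y hornerC.
  have w0 : (w kap).[0] = 0 by rewrite /w hornerM hornerD hornerN horner_exp s0 hornerC expr1n subrr mul0r.
  rewrite -horner_coef0 /G hornerD hornerN !hornerM !e1 s0 y0 comp_polyXr hornerC.
  have -> : (axial_lift m kap g).[0] = g.
    rewrite /axial_lift horner_sum; case eg: (size g) => [|n].
      by rewrite big_ord0; apply/esym/eqP; rewrite -size_poly_eq0 eg.
    rewrite big_ord_recl big1 ?addr0 => [|i _].
      by rewrite axc0 muln0 derivn0 !polyC1 mul1r expr0 mulr1 e1 hornerM s0 y0 mul1r comp_polyXr.
    by rewrite !hornerM horner_exp w0 expr0n /= !mulr0.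
  by rewrite -polyC1 comp_polyCr subrr.
(* To put [s = x], the outer variable [s - 1] takes the value [x - 1]. *)
have one0 : (1 : A).[(x - 1)%:P] = 1 by rewrite -polyC1 hornerC.
have one1 : (1 : {poly F}).[z] = 1 by rewrite -polyC1 hornerC.
have one : (1 : A).[(x - 1)%:P].[z] = 1 by rewrite one0.
have sx : s.[(x - 1)%:P].[z] = x by rewrite /s hornerD hornerX one0 hornerD one1 hornerC addrC subrK.
have yz : y.[(x - 1)%:P].[z] = z by rewrite /y hornerC hornerX.
have : G.[(x - 1)%:P].[z] = 0 by rewrite G0 !horner0.
rewrite /G /axial_lift !(hornerD, hornerN, hornerM) !lift_eval sx yz !hornerC => /eqP.
rewrite subr_eq0 mulrC => /eqP <-; congr (_ * _).
rewrite !horner_sum; apply: eq_bigr => i _.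
rewrite !hornerM !horner_exp lift_eval !hornerC; congr (_ * (_.[_] * _)).
  by rewrite !hornerM sx yz.
have gen (a b : A) : ((1 - a ^+ 2) * (b ^+ 2 - kap%:P%:P)).[(x - 1)%:P].[z] =
    (1 - a.[(x - 1)%:P].[z] ^+ 2) * (b.[(x - 1)%:P].[z] ^+ 2 - kap).
  by rewrite !(hornerM, hornerD, hornerN, horner_exp) one !hornerC.
by rewrite [w kap]/w gen sx yz.
Qed.
End Bivariate.

(** * Homogenized Legendre polynomials *)

Section Homogenization.
Variable F : numFieldType.
Implicit Types (d n m : nat) (kap nu : F) (p : {poly F}).

(* [homog d nu^2 p] is [nu^d p(X / nu)] when [p] has the parity of [d]. *)
Definition homog d kap p : {poly F} := \poly_(i < d.+1) (p`_i * kap ^+ ((d - i)./2)).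

Definition has_parity d p := forall i, odd (i + d) -> p`_i = 0.

(** Comparing coefficients, instead of substituting [X / nu] in the equation, treats [kap = 0] and a
    negative real [kap] along with the squares. *)
Lemma homog_ode d kap (c : F) (lam : F) p : has_parity d p -> (size p <= d.+1)%N ->
  ('X^2 - 1) * p^`()^`() + c%:P * ('X * p^`()) = lam%:P * p ->
  ('X^2 - kap%:P) * (homog d kap p)^`()^`() + c%:P * ('X * (homog d kap p)^`()) = lam%:P * homog d kap p.
Proof.
move=> par sp e; set g := homog d kap p; apply/polyP => j.
have gE i : g`_i = p`_i * kap ^+ ((d - i)./2).
  rewrite coef_poly; case: ltnP => // h; rewrite nth_default ?mul0r //; exact: leq_trans sp h.
have gk : kap * g`_j.+2 = p`_j.+2 * kap ^+ ((d - j)./2).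
  rewrite gE; have [jd|dj] := ltnP j.+1 d.
    rewrite mulrCA -exprS; congr (_ * _ ^+ _); rewrite (_ : (d - j = (d - j.+2).+2)%N) //; lia.
  rewrite [p`_j.+2]nth_default ?mul0r ?mulr0 //; apply: leq_trans sp _; by rewrite ltnS.
have coe (a b : F) (q : {poly F}) : (('X^2 - a%:P) * q^`()^`() + b%:P * ('X * q^`()))`_j
   = (j * j.-1)%:R * q`_j - (j.+2 * j.+1)%:R * (a * q`_j.+2) + b * (j%:R * q`_j).
  rewrite mulrBl expr2 -mulrA !(coefD, coefN, coefCM, coefXM) !coef_deriv.
  case: j {gk} => [|[|j]] /=; rewrite ?mul0r ?mulr0 ?subr0; ring.
have {e} := congr1 (fun q : {poly F} => q`_j) e; rewrite [X in X -> _]/= -['X^2 - 1]/('X^2 - 1%:P) !coe !coefCM => e.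
rewrite gk gE [RHS]mulrA -e; ring.
Qed.

Lemma homogE d nu p : nu != 0 -> has_parity d p -> (size p <= d.+1)%N ->
  homog d (nu ^+ 2) p = (nu ^+ d)%:P * (p \Po (nu^-1 *: 'X)).
Proof.
move=> nu0 par sp; apply/polyP => i; rewrite coefCM.
have -> : (p \Po (nu^-1 *: 'X))`_i = p`_i * nu ^- i.
  rewrite comp_polyE coef_sum.
  under eq_bigr => k _ do rewrite exprZn !coefZ coefXn.
  have [h|h] := ltnP i (size p); last first.
    by rewrite nth_default // mul0r big1 // => k _; rewrite -[i == k]/(i == k) gtn_eqF ?mulr0 // (leq_trans _ h).
  rewrite (bigD1 (Ordinal h)) //= eqxx mulr1 big1 ?addr0 ?exprVn // => k /eqP kh.
  by rewrite (negPf (_ : i != k)) ?mulr0 //; apply/eqP => ik; apply: kh; apply: val_inj.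
rewrite coef_poly; case: ltnP => h; last first.
  by rewrite nth_default ?mul0r ?mulr0 // (leq_trans sp h).
have [odd_id|even_id] := boolP (odd (i + d)); first by rewrite par // !mul0r mulr0.
have {}even_id : ~~ odd (d - i) by rewrite oddB // -oddD addnC.
rewrite -exprM mulnC muln2 -[in RHS](subnK (h : (i <= d)%N)) exprD.
have := odd_double_half (d - i); rewrite (negPf even_id) add0n => ->.
by rewrite mulrCA -mulrA mulfV ?mulr1 // expf_neq0.
Qed.

Lemma homog0 d p : has_parity d p -> homog d 0 p = (p`_d)%:P * 'X^d.
Proof.
move=> par; apply/polyP => i; rewrite coef_poly coefCM coefXn.
case: (ltngtP i d) => [h|h|->]; rewrite ?mulr0 //.
- rewrite ltnS ltnW //; have [odd_id|even_id] := boolP (odd (i + d)); first by rewrite par // mul0r.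
  (* The halved exponent is also [0] at [i = d - 1]; parity makes that coefficient vanish. *)
  rewrite expr0n; case: eqP => [e0|_]; rewrite ?mulr0 //.
  have : odd (d - i) by rewrite -[(d - i)%N]odd_double_half e0 addn0; lia.
  by rewrite oddB ?(ltnW h) // -oddD addnC (negPf even_id).
- by rewrite ltnS leqNgt h.
- by rewrite ltnSn subnn expr0.
Qed.

(** For [kap = mu^2] nonzero this is [mu^(n - m)] times the [m]-th derivative of [P_n] at [X / mu];
    at [kap = 0] it is the leading monomial. *)
Definition legH n m kap := homog (n - m) kap (legD F n m).

Lemma legD_has_parity n m : (m <= n)%N -> has_parity (n - m) (legD F n m).
Proof.
move=> mn i o; apply: legD_parity; have h : odd (m + n) = odd (n - m) by rewrite oddB // oddD addbC.
by rewrite -addnA oddD h -oddD.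
Qed.

Lemma legH_ode n m kap : (m <= n)%N ->
  ('X^2 - kap%:P) * (legH n m kap)^`()^`() + (2 * m.+1)%:R * 'X * (legH n m kap)^`()
  = ((n%:R - m%:R) * (n + m).+1%:R)%:P * legH n m kap.
Proof.
move=> mn; rewrite -mulrA -polyC_natr; apply: homog_ode; first exact: legD_has_parity.
  by rewrite size_legD.
by rewrite mulrA polyC_natr legD_odeC.
Qed.

(* The harmonic extension of the axis values [legH n m kap], divided by [rho^m]. *)
Definition axial n m kap (x t : F) : F :=
  (\sum_(k < size (legH n m kap)) axc F m k * ((legH n m kap)^`(2 * k).[x] * t ^+ k)) * (legD F n m).[1].

Lemma axialE n m kap (x z : F) : (m <= n)%N ->
  axial n m kap (x * z) ((1 - x ^+ 2) * (z ^+ 2 - kap)) = (legD F n m).[x] * (legH n m kap).[z].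
Proof.
move=> mn; by rewrite /axial -(axial_expansion _ _ (legD_odeC F n m) (legH_ode kap mn)).
Qed.

Lemma coef_legD n m : (m <= n)%N -> (legD F n m)`_(n - m) * (n - m)`!%:R = (2 * n)`!%:R / (2 ^ n * n`!)%:R.
Proof.
move=> mn; have := congr1 (fun p : {poly F} => p`_0) (legD_const F n).
rewrite coefC /= => <-; have -> : legD F n n = (legD F n m)^`(n - m).
  by rewrite /legD derivn_derivn subnK.
by rewrite [RHS]coef_derivn addn0 ffactnn mulr_natr.
Qed.
End Homogenization.

(** * Polynomial functions and their partial derivatives *)

Section PolynomialFunctions.
Variable R : realType.

Section Def.
Variables (E : Type) (I : eqType) (c : I -> E -> R).

(* [PF f df]: [f] is a polynomial in the coordinates [c], with partial derivatives [df]. *)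
Inductive PF : (E -> R) -> (I -> E -> R) -> Prop :=
| PF_cst (k : R) : PF (fun=> k) (fun _ _ => 0)
| PF_coord i : PF (c i) (fun j _ => (i == j)%:R)
| PFD f df g dg : PF f df -> PF g dg -> PF (fun e => f e + g e) (fun i e => df i e + dg i e)
| PFM f df g dg : PF f df -> PF g dg ->
    PF (fun e => f e * g e) (fun i e => df i e * g e + f e * dg i e).

Lemma PF_ext f df f' df' : PF f df -> f =1 f' -> (forall i, df i =1 df' i) -> PF f' df'.
Proof.
move=> h /funext <- e; rewrite (_ : df' = df) //.
by apply/funext => i; apply/funext => x; rewrite e.
Qed.

Lemma PF_partial f df i : PF f df -> exists ddf, PF (df i) ddf.
Proof.
elim=> [k|j|{}f {}df g dg hf [ddf h1] hg [ddg h2]|{}f {}df g dg hf [ddf h1] hg [ddg h2]].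
- by eexists; exact: (PF_cst 0).
- by eexists; exact: (PF_cst _).
- by eexists; exact: (PFD h1 h2).
- by eexists; exact: (PFD (PFM h1 hg) (PFM hf h2)).
Qed.

(** The symmetry is what cancels the mixed derivatives in [dint_rotation]. *)
Lemma PF_partials f df : PF f df -> exists ddf : I -> I -> E -> R,
  (forall i, PF (df i) (ddf i)) /\ forall i j, ddf i j = ddf j i.
Proof.
elim=> [k|j|{}f {}df g dg hf [ddf [h1 s1]] hg [ddg [h2 s2]]|{}f {}df g dg hf [ddf [h1 s1]] hg [ddg [h2 s2]]].
- by exists (fun _ _ _ => 0); split => // i; exact: (PF_cst 0).
- by exists (fun _ _ _ => 0); split => // i; exact: (PF_cst _).
- exists (fun i j e => ddf i j e + ddg i j e); split => [i|i j]; first exact: (PFD (h1 i) (h2 i)).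
  by rewrite s1 s2.
- exists (fun i j e => (ddf i j e * g e + df i e * dg j e) + (df j e * dg i e + f e * ddg i j e)).
  split => [i|i j]; first exact: (PFD (PFM (h1 i) hg) (PFM hf (h2 i))).
  by apply/funext => e; rewrite s1 s2; ring.
Qed.

Lemma PF_horner f df (p : {poly R}) : PF f df ->
  PF (fun e => p.[f e]) (fun i e => p^`().[f e] * df i e).
Proof.
move=> hf; elim/poly_ind: p => [|p k IH].
  by apply: (PF_ext (PF_cst 0)) => [e|i e]; rewrite ?deriv0 horner0 ?mul0r.
apply: (PF_ext (PFD (PFM IH hf) (PF_cst k))) => [e|i e] /=; first by rewrite hornerMXaddC.
by rewrite derivMXaddC hornerD hornerM hornerX; ring.
Qed.

(** In the applications the inner variable is [x0] and the outer one is [t = rho^2]. *)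
Definition ev2 (P : {poly {poly R}}) (x t : R) : R := P.[t%:P].[x].

Lemma PF_ev2 f df g dg (P : {poly {poly R}}) : PF f df -> PF g dg ->
  PF (fun e => ev2 P (f e) (g e))
     (fun i e => ev2 (deriv_in P) (f e) (g e) * df i e + ev2 P^`() (f e) (g e) * dg i e).
Proof.
case: (is_deriv_inner R) => yD yM yC.
rewrite /ev2 => hf hg; elim/poly_ind: P => [|P k IH].
  by apply: (PF_ext (PF_cst 0)) => [e|i e];
    rewrite /deriv_in ?deriv0 ?map_poly0 ?horner0 ?mul0r ?addr0 // raddf0 !horner0 !mul0r addr0.
apply: (PF_ext (PFD (PFM IH hg) (PF_horner k hf))) => [e|i e] /=.
  by rewrite hornerMXaddC !hornerE.
have -> : deriv_in (P * 'X + k%:P) = deriv_in P * 'X + k^`()%:P.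
  apply/polyP => j; rewrite coef_deriv_in !coefD !coefMX coef_deriv_in !coefC.
  by case: j => [|j]; rewrite ?derivD ?deriv0 /= ?coef_deriv_in ?deriv0.
by rewrite derivMXaddC !hornerMXaddC !(hornerD, hornerM, hornerX, hornerC); ring.
Qed.

(** Restriction to a line parallel to a coordinate axis. Directional derivatives and integrals along
    chords are reduced through it to univariate polynomials. *)
Lemma PF_line (l : R -> E) i f df :
  (forall j u, c j (l u) = c j (l 0) + (j == i)%:R * u) -> PF f df ->
  exists p : {poly R}, forall u, f (l u) = p.[u] /\ df i (l u) = p^`().[u].
Proof.
move=> hl; elim=> [k|j|{}f {}df g dg _ [p hp] _ [q hq]|{}f {}df g dg _ [p hp] _ [q hq]].
- by exists k%:P => u; rewrite derivC horner0 hornerC.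
- exists ((c j (l 0))%:P + (j == i)%:R%:P * 'X) => u.
  by rewrite derivD derivM derivX !derivC mul0r !add0r mulr1 !hornerE.
- by exists (p + q) => u; rewrite derivD !hornerD; have [-> ->] := hp u; have [-> ->] := hq u.
- by exists (p * q) => u; rewrite derivM hornerD !hornerM; have [-> ->] := hp u; have [-> ->] := hq u.
Qed.

Lemma PF_bounded (D : set E) f df :
  (forall j, exists M, forall e, D e -> `|c j e| <= M) -> PF f df ->
  exists M, forall e, D e -> `|f e| <= M.
Proof.
move=> hc; elim=> [k|j|{}f {}df g dg _ [M hM] _ [N hN]|{}f {}df g dg _ [M hM] _ [N hN]].
- by exists `|k|.
- exact: hc.
- by exists (M + N) => e De; apply: le_trans (ler_normD _ _) _; apply: lerD; auto.
- by exists (M * N) => e De; rewrite normrM; apply: ler_pM; auto.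
Qed.
End Def.

Lemma PF_subst (E E' : Type) (I I' : eqType) (c : I -> E -> R) (c' : I' -> E' -> R) (l : E' -> E) f df :
  (forall j, exists d, PF c' (fun e => c j (l e)) d) -> PF c f df ->
  exists d, PF c' (fun e => f (l e)) d.
Proof.
move=> hc; elim=> [k|j|{}f {}df g dg _ [d1 h1] _ [d2 h2]|{}f {}df g dg _ [d1 h1] _ [d2 h2]].
- by eexists; exact: (PF_cst c' k).
- exact: hc.
- by eexists; exact: (PFD h1 h2).
- by eexists; exact: (PFM h1 h2).
Qed.

Lemma PF_continuous (E : topologicalType) (I : eqType) (c : I -> E -> R) f df :
  (forall j, continuous (c j)) -> PF c f df -> continuous f.
Proof.
move=> hc; elim=> [k|j|{}f {}df g dg _ cf _ cg|{}f {}df g dg _ cf _ cg] x.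
- exact: cvg_cst.
- exact: hc.
- by apply: cvgD; [exact: cf|exact: cg].
- by apply: cvgM; [exact: cf|exact: cg].
Qed.

Lemma PF_measurable d (E : measurableType d) (I : eqType) (c : I -> E -> R) f df :
  (forall j, measurable_fun setT (c j)) -> PF c f df -> measurable_fun setT f.
Proof.
move=> hc; elim=> [k|j|{}f {}df g dg _ cf _ cg|{}f {}df g dg _ cf _ cg].
- exact: measurable_cst.
- exact: hc.
- exact: measurable_funD.
- exact: measurable_funM.
Qed.

Lemma PF_derive (E : normedModType R) (I : eqType) (c : I -> E -> R) f df i (x v : E) :
  (forall j u, c j (u *: v + x) = c j x + (j == i)%:R * u) -> PF c f df -> 'D_v f x = df i x.
Proof.
move=> hv hf; have [|p hp] := @PF_line _ _ c (fun u => u *: v + x) i f df _ hf.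
  by move=> j u; rewrite hv scale0r add0r.
have [h0 d0] := hp 0; rewrite scale0r add0r in h0 d0.
rewrite d0 derivE derive1E /derive; apply: (congr1 (fun k : R -> R => lim (k @ 0^'))); apply/funext => h /=.
by rewrite h0 (hp h).1 addr0 [h *: 1]mulr1.
Qed.

(** The real and imaginary parts of [(x + i y)^m], that is, [rho^m cos(m phi)] and
    [rho^m sin(m phi)] as polynomials. *)
Fixpoint zpow (m : nat) (x y : R) : R * R :=
  if m is k.+1 then let z := zpow k x y in (x * z.1 - y * z.2, x * z.2 + y * z.1) else (1, 0).

Lemma PF_zpow (E : Type) (I : eqType) (c : I -> E -> R) f df g dg m :
  PF c f df -> PF c g dg ->
  PF c (fun e => (zpow m (f e) (g e)).1)
   (fun i e => m%:R * ((zpow m.-1 (f e) (g e)).1 * df i e - (zpow m.-1 (f e) (g e)).2 * dg i e)) /\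
  PF c (fun e => (zpow m (f e) (g e)).2)
   (fun i e => m%:R * ((zpow m.-1 (f e) (g e)).2 * df i e + (zpow m.-1 (f e) (g e)).1 * dg i e)).
Proof.
move=> hf hg; elim: m => [|m [IH1 IH2]].
  split; first by apply: (PF_ext (PF_cst c 1)) => // i e; rewrite mul0r.
  by apply: (PF_ext (PF_cst c 0)) => // i e; rewrite mul0r.
split.
  apply: (PF_ext (PFD (PFM hf IH1) (PFM (PF_cst c (-1)) (PFM hg IH2)))) => [e|i e] /=; first ring.
  by case: m {IH1 IH2} => [|m] /=; ring.
apply: (PF_ext (PFD (PFM hf IH2) (PFM hg IH1))) => [e|i e] /=; first ring.
by case: m {IH1 IH2} => [|m] /=; ring.
Qed.
End PolynomialFunctions.

(** * The spheroidal harmonics as polynomials *)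

Section Identification.
Variable R : realType.
Notation R3 := (R * R * R)%type.
Notation C := R[i].
Implicit Types (x : R3) (mu : C) (kap : R).

Definition Qb n m kap : {poly {poly R}} :=
  \poly_(k < size (legH n m kap)) ((axc R m k * (legD R n m).[1]) *: (legH n m kap)^`(2 * k)).

Lemma ev2_Qb n m kap (x t : R) : ev2 (Qb n m kap) x t = axial n m kap x t.
Proof.
rewrite /ev2 /Qb poly_def !horner_sum /axial big_distrl /=; apply: eq_bigr => k _.
by rewrite !(hornerZ, hornerM, hornerXn, horner_exp, hornerC) ; ring.
Qed.

Lemma polar_exists (a b : R) : exists phi : R,
  a = Num.sqrt (a ^+ 2 + b ^+ 2) * cos phi /\ b = Num.sqrt (a ^+ 2 + b ^+ 2) * sin phi.
Proof.
set r := Num.sqrt _.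
have r2 : r ^+ 2 = a ^+ 2 + b ^+ 2 by rewrite sqr_sqrtr // addr_ge0 // sqr_ge0.
have [r0|r0] := eqVneq r 0.
  exists 0; move/eqP: r2; rewrite r0 expr0n /= eq_sym paddr_eq0 ?sqr_ge0 // !sqrf_eq0.
  by move=> /andP[/eqP -> /eqP ->]; rewrite !mul0r.
have rp : 0 < r by rewrite lt_def r0 sqrtr_ge0.
have ar : -1 <= a / r <= 1.
  rewrite -ler_norml normrM normfV (gtr0_norm rp) ler_pdivrMr // mul1r.
  by rewrite -sqrtr_sqr ler_wsqrtr // lerDl sqr_ge0.
have ca : cos (acos (a / r)) = a / r by rewrite acosK // in_itv.
have sa : r * sin (acos (a / r)) = `|b|.
  rewrite sin_acos // -[X in X * _](ger0_norm (ltW rp)) -sqrtr_sqr -sqrtrM ?sqr_ge0 //.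
  rewrite mulrBr mulr1 -exprMn mulrC divfK // r2 addrC addKr.
  by rewrite sqrtr_sqr.
have [b0|b0] := ger0P b.
  by exists (acos (a / r)); rewrite ca sa ger0_norm // mulrC divfK.
exists (- acos (a / r)); rewrite cosN sinN ca mulrN sa ltr0_norm // opprK.
by rewrite mulrC divfK.
Qed.

Lemma angleP x : co1 x = rho x * cos (angle x) /\ co2 x = rho x * sin (angle x).
Proof.
rewrite /angle; apply: (@xgetPex _ 0 [set phi | co1 x = rho x * cos phi /\ co2 x = rho x * sin phi]).
exact: polar_exists.
Qed.

Definition Hs (s : bool) m (a b : R) : R := if s then (zpow m a b).1 else (zpow m a b).2.

Lemma zpow_polar m (r phi : R) :
  zpow m (r * cos phi) (r * sin phi) = (r ^+ m * cos (m%:R * phi), r ^+ m * sin (m%:R * phi)).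
Proof.
elim: m => [|m IH] /=; first by rewrite mul0r cos0 sin0 expr0 mulr1 mulr0.
rewrite IH /= -natr1 mulrDl mul1r cosD sinD exprS; congr (_, _); ring.
Qed.

Lemma Hs_angle s m x : rho x ^+ m * Phi s m (angle x) = Hs s m (co1 x) (co2 x).
Proof.
have [e1 e2] := angleP x.
by rewrite [in RHS]e1 [in RHS]e2 /Hs zpow_polar /Phi; case: s.
Qed.

Lemma rho_sqr x : rho x ^+ 2 = co1 x ^+ 2 + co2 x ^+ 2.
Proof. by rewrite sqr_sqrtr // addr_ge0 // sqr_ge0. Qed.

Lemma legendre_map n m : (legendre R n)^`(m) = map_poly (real_complex R) (legD R n m).
Proof.
rewrite /legD /leg -derivn_map map_polyZ -derivn_map rmorphXn rmorphB /= map_polyXn rmorph1.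
by rewrite fmorphV rmorph_nat.
Qed.

Lemma Re_real (a : R) : complex.Re a%:C = a. Proof. by []. Qed.

(* The substitution [x0 = s y, rho^2 = (1 - s^2) (y^2 - mu^2)] that separates the variables. *)
Lemma separated_coords mu x : admissible mu -> mu != 0 -> generic x ->
  exists s y : R, [/\ omega mu x = (2 * y)%:C, 0 < y, co0 x = s * y,
    rho x ^+ 2 = (1 - s ^+ 2) * (y ^+ 2 - complex.Re (mu ^+ 2))
    & complex.Re (mu ^+ 2) < y ^+ 2].
Proof.
move=> adm mu0 [x0 r0].
have rp : 0 < rho x by rewrite lt_def r0 sqrtr_ge0.
have rp2 : 0 < rho x ^+ 2 by rewrite exprn_gt0.
case: adm => [/andP[m0 m1]|[nu nu0 ->]].
- have [m em] : exists m : R, mu = m%:C.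
    by exists (complex.Re mu); case: mu m0 {m1 mu0} => a b; rewrite lecE /= => /andP[/eqP -> _].
  have mp : 0 < m by rewrite -ltcR -em lt_def mu0.
  rewrite {}em in m0 m1 mu0 *.
  have -> : complex.Re (m%:C ^+ 2) = m ^+ 2 by rewrite -rmorphXn.
  have sq a : sqrtc (((co0 x)%:C + a%:C) ^+ 2 + (rho x ^+ 2)%:C) = (Num.sqrt ((co0 x + a) ^+ 2 + rho x ^+ 2))%:C.
    by rewrite -rmorphD -rmorphXn -rmorphD sqrtc_sqrtr // ler0c addr_ge0 ?sqr_ge0.
  rewrite /omega -[- m%:C]rmorphN !sq -rmorphD /=.
  set a := Num.sqrt _; set b := Num.sqrt _.
  have a2 : a ^+ 2 = (co0 x + m) ^+ 2 + rho x ^+ 2 by rewrite sqr_sqrtr // addr_ge0 ?sqr_ge0.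
  have b2 : b ^+ 2 = (co0 x - m) ^+ 2 + rho x ^+ 2 by rewrite sqr_sqrtr // addr_ge0 ?sqr_ge0.
  have a0 : 0 <= a by exact: sqrtr_ge0.
  have b0 : 0 <= b by exact: sqrtr_ge0.
  have ga : co0 x + m < a.
    rewrite ltNge; apply/negP => h; have : a ^+ 2 <= (co0 x + m) ^+ 2 by rewrite ler_sqr ?nnegrE // (le_trans a0).
    by rewrite a2 gerDl leNgt rp2.
  have gb : m - co0 x < b.
    rewrite ltNge; apply/negP => h; have : b ^+ 2 <= (m - co0 x) ^+ 2 by rewrite ler_sqr ?nnegrE // (le_trans b0).
    by rewrite b2 -[m - _]opprB sqrrN gerDl leNgt rp2.
  have yp : m < (a + b) / 2 by lra.
  have y0 : (a + b) / 2 != 0 by rewrite gt_eqF // (lt_trans mp).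
  exists (co0 x / ((a + b) / 2)), ((a + b) / 2); split.
  + by rewrite mulrC divfK.
  + exact: lt_trans yp.
  + by rewrite divfK.
  (* [a] and [b] are the distances to the foci. Their half sum is [y]; their half difference [d]
     equals [s m], because [y d = x0 m]. *)
  + set y := (a + b) / 2 in yp y0 *; pose d := (a - b) / 2.
    have yd : y * d = co0 x * m by rewrite /y /d; nra.
    have yd2 : y ^+ 2 + d ^+ 2 = co0 x ^+ 2 + m ^+ 2 + rho x ^+ 2 by rewrite /y /d; nra.
    have ed : d ^+ 2 = (co0 x / y) ^+ 2 * m ^+ 2.
      by rewrite -exprMn; congr (_ ^+ 2); apply: (mulfI y0); rewrite yd mulrA [y * _]mulrC divfK.
    have e : (co0 x / y) ^+ 2 * y ^+ 2 = co0 x ^+ 2 by rewrite -exprMn divfK.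
    by rewrite mulrBr !mulrBl e -ed; lra.
  + by rewrite ltr_pXn2r // nnegrE ltW // (lt_trans mp).
- have e2 : complex.Re ((0 +i* nu) ^+ 2 : C) = - nu ^+ 2 by rewrite expr2 /= mul0r sub0r expr2.
  rewrite e2 /omega.
  set zp : C := (_ + _) ^+ 2 + _; set zm : C := (_ - _) ^+ 2 + _.
  have zpE : zp = (co0 x ^+ 2 - nu ^+ 2 + rho x ^+ 2) +i* (2 * co0 x * nu).
    by rewrite /zp !expr2; simpc; congr (_ +i* _); ring.
  have zmE : zm = (co0 x ^+ 2 - nu ^+ 2 + rho x ^+ 2) +i* (- (2 * co0 x * nu)).
    by rewrite /zm !expr2; simpc; congr (_ +i* _); ring.
  (* The radicands are conjugate and, since [x0] and [nu] are nonzero, off the branch cut. Hence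
     their principal roots are conjugate too, and [omega] is twice the common real part [y]. *)
  have b0 : 2 * co0 x * nu != 0 by rewrite !mulf_neq0 // gt_eqF.
  pose y := complex.Re (sqrtc zp); pose d := complex.Im (sqrtc zp).
  have sp : sqrtc zp = y +i* d by rewrite /y /d; case: (sqrtc zp).
  have sm : sqrtc zm = y +i* - d.
    by rewrite /y /d zpE zmE /sqrtc /= oppr_eq0 (negPf b0) sqrrN sgrN mulNr.
  have [e1 e3] : y ^+ 2 - d ^+ 2 = co0 x ^+ 2 - nu ^+ 2 + rho x ^+ 2 /\ 2 * (y * d) = 2 * co0 x * nu.
    have := sqr_sqrtc zp; rewrite {1}sp zpE expr2; simpc => -[<- <-].
    by split; ring.
  have yd : y * d = co0 x * nu by lra.
  have y0 : 0 <= y by rewrite /y; case: (zp) => a b; exact: sqrtr_ge0.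
  have yp : 0 < y.
    rewrite lt_def y0 andbT; apply/eqP => y00; move: yd; rewrite y00 mul0r => /esym/eqP.
    by rewrite mulf_eq0 (negPf x0) /= gt_eqF.
  have yn0 : y != 0 by rewrite gt_eqF.
  exists (co0 x / y), y; split => //.
  + by rewrite sp sm; simpc; congr (_ +i* _); ring.
  + by rewrite divfK.
  + have ed : d ^+ 2 = (co0 x / y) ^+ 2 * nu ^+ 2.
      by rewrite -exprMn; congr (_ ^+ 2); apply: (mulfI yn0); rewrite yd mulrA [y * _]mulrC divfK.
    have e : (co0 x / y) ^+ 2 * y ^+ 2 = co0 x ^+ 2 by rewrite -exprMn divfK.
    by rewrite opprK mulrDr !mulrBl e -ed; lra.
  + by apply: (@lt_trans _ _ 0); rewrite ?exprn_gt0 // oppr_lt0 exprn_gt0.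
Qed.

Lemma admissible_sqr mu : admissible mu ->
  mu ^+ 2 = (complex.Re (mu ^+ 2))%:C /\ complex.Re (mu ^+ 2) < 1.
Proof.
case=> [/andP[m0 m1]|[nu nu0 ->]].
  have [m em] : exists m : R, mu = m%:C.
    by exists (complex.Re mu); case: mu m0 {m1} => a b; rewrite lecE /= => /andP[/eqP -> _].
  rewrite {}em in m0 m1 *; rewrite -rmorphXn /=; split => //.
  have p0 : 0 <= m by rewrite -ler0c.
  by rewrite exprn_ilt1 // -ltcR.
rewrite expr2; simpc; split => //.
by apply: (@lt_trans _ _ 0); rewrite ?oppr_lt0 ?mulr_gt0.
Qed.

(** At [n = 0] the truncated predecessor gives [dfact 0 = 1], in agreement with [(-1)!! = 1]. *)
Definition Kc n m : R := (n - m)`!%:R / (dfact (2 * n).-1)%:R.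

Lemma dfact_even n : (dfact (2 * n).-1 * (2 ^ n * n`!) = (2 * n)`!)%N.
Proof.
elim: n => [//|n IH].
have -> : dfact (2 * n.+1).-1 = ((2 * n).+1 * dfact (2 * n).-1)%N.
  by rewrite mulnS addSn /=; case: (n) => [//|k]; rewrite mulnS.
rewrite (_ : 2 * n.+1 = (2 * n).+2)%N; last by lia.
by rewrite !factS expnS -IH; lia.
Qed.

Lemma dfact_gt0 k : (0 < dfact k)%N.
Proof.
suff : (0 < dfact k)%N /\ (0 < dfact k.+1)%N by case.
by elim: k => [//|k [h1 h2]]; split => //=; rewrite muln_gt0.
Qed.

(** This normalization makes the formula for nonzero [mu] specialize at [kap = 0] to the separate
    definition of [Uhat] at [mu = 0]. *)
Lemma Kc_lead n m : (m <= n)%N -> Kc n m * (legD R n m)`_(n - m) = 1.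
Proof.
move=> mn; have := coef_legD R mn; rewrite -dfact_even natrM.
have h0 : (2 ^ n * n`!)%:R != 0 :> R by rewrite pnatr_eq0 -lt0n muln_gt0 expn_gt0 fact_gt0.
have h1 : (dfact (2 * n).-1)%:R != 0 :> R by rewrite pnatr_eq0 -lt0n dfact_gt0.
by rewrite mulfK // /Kc mulrAC => e; rewrite [X in X / _]mulrC e divff.
Qed.

Lemma in_unit (s : R) : 0 < 1 - s ^+ 2 -> -1 <= s%:C <= 1.
Proof.
move=> h; have o1 : (1 : C) = 1%:C by [].
rewrite o1 -rmorphN /= !lecR -ler_norml.
rewrite -(@ler_pXn2r _ 2) ?nnegrE // real_normK ?num_real // expr1n.
by rewrite -subr_ge0 ltW.
Qed.

Lemma legendreP_onE n m (s : R) : 0 < 1 - s ^+ 2 ->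
  legendreP n m s%:C = ((-1) ^+ m * Num.sqrt (1 - s ^+ 2) ^+ m * (legD R n m).[s])%:C.
Proof.
move=> h; rewrite /legendreP in_unit // /legendreP_on legendre_map horner_map.
have -> : 1 - s%:C ^+ 2 = (1 - s ^+ 2)%:C by rewrite rmorphB rmorph1 rmorphXn.
rewrite sqrtc_sqrtr ?ler0c ?ltW // Re_real.
by rewrite !rmorphM !rmorphXn rmorphN rmorph1.
Qed.

Lemma legendreP_offE n m mu (y kap : R) : (m <= n)%N -> mu != 0 -> mu ^+ 2 = kap%:C ->
  0 < y -> kap < y ^+ 2 ->
  mu ^+ n * legendreP n m (y%:C / mu)
  = ((y * Num.sqrt (1 - kap / y ^+ 2)) ^+ m * (legH n m kap).[y])%:C.
Proof.
move=> mn mu0 mu2 y0 yk.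
have yC0 : y%:C != 0 :> C by rewrite -[0]/(0%:C) (inj_eq (@complexI R)) gt_eqF.
have z2 : (y%:C / mu) ^+ 2 = (y ^+ 2)%:C / kap%:C by rewrite expr_div_n mu2 -rmorphXn.
have k0 : kap != 0 by apply: contra mu0 => /eqP k0; rewrite -sqrf_eq0 mu2 k0.
(* A point of [[-1, 1]] is real with square in [[0, 1]], whereas [(y / mu)^2 = y^2 / kap] exceeds
   [1] for [kap > 0] and is negative for [kap < 0]. *)
have -> : legendreP n m (y%:C / mu) = legendreP_off n m (y%:C / mu).
  rewrite /legendreP; case: ifPn => // /andP[h1 h2]; exfalso.
  have zr : y%:C / mu \is Num.real.
    by rewrite -(ler_real h1) realN real1.
  have : 0 <= (y%:C / mu) ^+ 2 by rewrite real_exprn_even_ge0.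
  have : (y%:C / mu) ^+ 2 <= 1.
    by rewrite -subr_ge0 -[X in X - _](expr1n _ 2) subr_sqr mulr_ge0 ?subr_ge0 // addrC -[1]opprK subr_ge0.
  rewrite z2 -fmorphV -rmorphM -[1]/(1%:C) -[0]/(0%:C) !lecR => a b.
  have [kp|kn] := ltP 0 kap.
    by move: a; rewrite ler_pdivrMr // mul1r leNgt yk.
  have {}kn : kap < 0 by rewrite lt_def eq_sym k0.
  move: b; rewrite pmulr_rge0 ?exprn_gt0 // invr_ge0.
  by rewrite leNgt kn.
rewrite /legendreP_off legendre_map.
have -> : (y%:C / mu) ^- 2 = (kap / y ^+ 2)%:C by rewrite z2 invf_div [RHS]rmorphM fmorphV.
have -> : 1 - (kap / y ^+ 2)%:C = (1 - kap / y ^+ 2)%:C by rewrite rmorphB rmorph1.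
rewrite sqrtc_sqrtr; last first.
  by rewrite ler0c subr_ge0 ler_pdivrMr ?exprn_gt0 // mul1r ltW.
rewrite [complex.Re _]/=; set q := Num.sqrt _.
rewrite [RHS]rmorphM [X in _ = X * _]rmorphXn [X in _ = X ^+ _ * _]rmorphM /=.
have -> : (legH n m kap).[y]%:C = mu ^+ (n - m) * (map_poly (real_complex R) (legD R n m)).[y%:C / mu].
  rewrite -horner_map /=.
  have -> : map_poly (real_complex R) (legH n m kap) = homog (n - m) (mu ^+ 2) (map_poly (real_complex R) (legD R n m)).
    apply/polyP => i; rewrite coef_map /legH /homog [in LHS]coef_poly [in RHS]coef_poly mu2.
    by case: ltnP => _; rewrite ?rmorph0 // coef_map /= rmorphM rmorphXn.
  rewrite homogE //; first by rewrite hornerM hornerC horner_comp !hornerE [mu^-1 * _]mulrC.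
    by move=> i o; rewrite coef_map (legD_has_parity _ mn) ?rmorph0.
  by rewrite size_map_poly size_legD.
rewrite -{1}(subnK mn) exprD; set c := (_.[_]).
have ya : y%:C = (y%:C / mu) * mu by rewrite divfK.
rewrite [in RHS]ya; move: (y%:C / mu) => a; rewrite !exprMn; ring.
Qed.

Definition Upol (s : bool) n m kap x : R :=
  Kc n m * (-1) ^+ m * (Hs s m (co1 x) (co2 x) * ev2 (Qb n m kap) (co0 x) (co1 x ^+ 2 + co2 x ^+ 2)).

Lemma Uhat_generic n m mu x : (m <= n)%N -> admissible mu -> generic x ->
  Uhat n m mu x = (Kc n m * (-1) ^+ m *
    (rho x ^+ m * axial n m (complex.Re (mu ^+ 2)) (co0 x) (rho x ^+ 2)))%:C.
Proof.
move=> mn adm gx; have [mu2 _] := admissible_sqr adm.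
case: (gx) => x0 r0; have rp : 0 < rho x by rewrite lt_def r0 sqrtr_ge0.
have [mu0|mu0] := eqVneq mu 0.
  rewrite /Uhat mu0 eqxx expr0n /=; set r := euclid x.
  have r2 : r ^+ 2 = co0 x ^+ 2 + rho x ^+ 2.
    by rewrite rho_sqr addrA sqr_sqrtr // !addr_ge0 // sqr_ge0.
  have c0 : 0 < co0 x ^+ 2 by rewrite lt_def sqrf_eq0 x0 sqr_ge0.
  have rpos : 0 < r by rewrite sqrtr_gt0 -addrA -rho_sqr (addr_gt0 c0) // exprn_gt0.
  have rn0 : r != 0 by rewrite gt_eqF.
  (* At [kap = 0] the separated coordinates are the spherical ones: [s] is the cosine of the polar
     angle and [y] is [r]. *)
  set s := co0 x / r; have sr : s * r = co0 x by rewrite divfK.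
  clearbody s.
  have es : rho x ^+ 2 = (1 - s ^+ 2) * (r ^+ 2 - 0).
    by rewrite subr0 mulrBl mul1r -exprMn sr r2 addrAC subrr add0r.
  have s1 : 0 < 1 - s ^+ 2.
    by rewrite -(pmulr_lgt0 _ (_ : 0 < r ^+ 2)) ?exprn_gt0 // -[r ^+ 2]subr0 -es exprn_gt0.
  rewrite legendreP_onE // -rmorphM; congr (_%:C).
  rewrite -sr es axialE // /legH homog0; last exact: legD_has_parity.
  have -> : rho x = r * Num.sqrt (1 - s ^+ 2).
    apply/eqP; rewrite -(@eqrXn2 _ 2) ?(ltW rp) ?mulr_ge0 ?sqrtr_ge0 ?(ltW rpos) //.
    by rewrite exprMn es subr0 [X in _ == _ * X]sqr_sqrtr ?(ltW s1) // mulrC.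
  rewrite hornerM hornerC hornerXn -{1}(subnK mn) exprD !exprMn.
  have K1 := Kc_lead mn.
  transitivity (Kc n m * (legD R n m)`_(n - m) * (r ^+ (n - m) * r ^+ m * ((-1) ^+ m * Num.sqrt (1 - s ^+ 2) ^+ m * (legD R n m).[s]))).
    by rewrite K1 mul1r.
  by ring.
have [s [y [eo y0 xs er ky]]] := separated_coords adm mu0 gx.
have s1 : 0 < 1 - s ^+ 2.
  have : 0 < (1 - s ^+ 2) * (y ^+ 2 - complex.Re (mu ^+ 2)) by rewrite -er exprn_gt0.
  by rewrite pmulr_lgt0 // subr_gt0.
rewrite /Uhat (negPf mu0) eo.
have yC0 : y%:C != 0 :> C by rewrite -[0]/(0%:C) (inj_eq (@complexI R)) gt_eqF.
have -> : 2 * (co0 x)%:C / (2 * y)%:C = s%:C :> C.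
  rewrite xs !rmorphM rmorph_nat -mulf_div divff ?pnatr_eq0 // mul1r mulfK //.
have -> : (2 * y)%:C / (2 * mu) = y%:C / mu :> C.
  by rewrite rmorphM rmorph_nat -mulf_div divff ?pnatr_eq0 // mul1r.
set kap := complex.Re _ in mu2 ky er *.
transitivity ((n - m)`!%:R / (dfact (2 * n).-1)%:R * legendreP n m s%:C * (mu ^+ n * legendreP n m (y%:C / mu))); first ring.
rewrite (legendreP_offE mn mu0 mu2 y0 ky) legendreP_onE //.
have -> : (n - m)`!%:R / (dfact (2 * n).-1)%:R = (Kc n m)%:C :> C by rewrite rmorphM fmorphV !rmorph_nat.
rewrite -!rmorphM; congr (_%:C).
rewrite xs er axialE //.
have yn0 : y != 0 by rewrite gt_eqF.
have q0 : 0 <= 1 - kap / y ^+ 2 by rewrite subr_ge0 ler_pdivrMr ?exprn_gt0 // mul1r ltW.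
have -> : rho x = Num.sqrt (1 - s ^+ 2) * (y * Num.sqrt (1 - kap / y ^+ 2)).
  apply/eqP; rewrite -(@eqrXn2 _ 2) ?(ltW rp) ?mulr_ge0 ?sqrtr_ge0 ?(ltW y0) //.
  rewrite er exprMn [X in _ == X * _]sqr_sqrtr ?(ltW s1) // exprMn sqr_sqrtr //.
  by rewrite [_ * (1 - _ / _)]mulrBr mulr1 [_ * (_ / _)]mulrC divfK // expf_neq0.
rewrite !exprMn; ring.
Qed.

End Identification.

Section HarmonicPolynomials.
Variable R : realType.
Notation R3 := (R * R * R)%type.
Notation C := R[i].
Implicit Types (x : R3) (mu : C) (kap : R).

Lemma generic_dense x : closure (@generic R) x.
Proof.
move=> B nB.
pose l (e : R) : R3 := (co0 x + e, co1 x + e, co2 x).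
have /nbhs_ballP [d /= d0 hd] := nB.
(* A positive shift [e < bad a] leaves [a + e] nonzero. For [a = 0] any positive shift does, and the
   value [d] is only a positive placeholder. *)
pose bad (a : R) : R := if a == 0 then d else `|a|.
have badp a : 0 < bad a by rewrite /bad; case: eqP => // /eqP; rewrite normr_gt0.
pose e := Num.min d (Num.min (bad (co0 x)) (bad (co1 x))) / 2.
have e0 : 0 < e by rewrite divr_gt0 // !lt_min d0 !badp.
have half (a b : R) : 0 < a -> a <= b -> a / 2 < b by lra.
have m0 : 0 < Num.min d (Num.min (bad (co0 x)) (bad (co1 x))) by rewrite !lt_min d0 !badp.
have ed : e < d by apply: half => //; rewrite ge_min lexx.
have good a : e < bad a -> a + e != 0.
  rewrite /bad; case: eqP => [-> _|_]; first by rewrite add0r gt_eqF.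
  move=> h; apply/eqP => /eqP; rewrite addr_eq0 => /eqP ea; move: h.
  by rewrite ea normrN gtr0_norm // ltxx.
exists (l e); split; last first.
  apply: hd; split; [split|] => /=; rewrite /ball /=; last by rewrite subrr normr0.
    by rewrite opprD addrA subrr add0r normrN gtr0_norm.
  by rewrite opprD addrA subrr add0r normrN gtr0_norm.
split; first by apply: good; apply: half => //; rewrite !ge_min lexx orbT.
rewrite sqrtr_eq0 -ltNge /=; apply: ltr_pwDl; last exact: sqr_ge0.
rewrite lt_def sqr_ge0 andbT sqrf_eq0.
by apply: good; apply: half => //; rewrite !ge_min lexx !orbT.
Qed.

Definition coR3 (i : option bool) : R3 -> R :=
  match i with None => @co0 R | Some false => @co1 R | Some true => @co2 R end.

Lemma continuous_coR3 i : continuous (coR3 i).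
Proof.
move=> x; case: i => [[]|] /=; rewrite /co0 /co1 /co2.
- exact: cvg_snd.
- by apply: cvg_comp; [exact: cvg_fst|exact: cvg_snd].
- by apply: cvg_comp; [exact: cvg_fst|exact: cvg_fst].
Qed.

Definition dHs (s : bool) m (a b : R) : R * R :=
  if s then (m%:R * (zpow m.-1 a b).1, - (m%:R * (zpow m.-1 a b).2))
  else (m%:R * (zpow m.-1 a b).2, m%:R * (zpow m.-1 a b).1).

Lemma PF_Hs (E : Type) (I : eqType) (c : I -> E -> R) f df g dg s m :
  PF c f df -> PF c g dg ->
  PF c (fun e => Hs s m (f e) (g e))
   (fun i e => (dHs s m (f e) (g e)).1 * df i e + (dHs s m (f e) (g e)).2 * dg i e).
Proof.
move=> hf hg; have [h1 h2] := PF_zpow m hf hg.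
by case: s; [apply: (PF_ext h1)|apply: (PF_ext h2)] => //= i e; rewrite /dHs /=; ring.
Qed.

Definition dUpol s n m kap x (i : option bool) : R :=
  let Q P := ev2 P (co0 x) (co1 x ^+ 2 + co2 x ^+ 2) in
  let H := Hs s m (co1 x) (co2 x) in
  let dH := dHs s m (co1 x) (co2 x) in
  Kc R n m * (-1) ^+ m *
  match i with
  | None => H * Q (deriv_in (Qb n m kap))
  | Some false => dH.1 * Q (Qb n m kap) + H * (2 * co1 x * Q (Qb n m kap)^`()%R)
  | Some true => dH.2 * Q (Qb n m kap) + H * (2 * co2 x * Q (Qb n m kap)^`()%R)
  end.

Lemma PF_Upol s n m kap : PF coR3 (Upol s n m kap) (fun i x => dUpol s n m kap x i).
Proof.
have h0 := PF_coord coR3 None; have h1 := PF_coord coR3 (Some false); have h2 := PF_coord coR3 (Some true).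
have hs := PFD (PFM h1 h1) (PFM h2 h2).
have h := PFM (PF_cst coR3 (Kc R n m * (-1) ^+ m)) (PFM (PF_Hs s m h1 h2) (PF_ev2 (Qb n m kap) h0 hs)).
apply: (PF_ext h) => [e|i e]; first by rewrite /Upol /= -!expr2.
by rewrite /dUpol; case: i => [[]|] /=; rewrite -!expr2; ring.
Qed.

(** Density of [generic] makes the filter proper, so that [lim] is the value of the continuous
    polynomial that agrees with the definition there. *)
Lemma U_Upol s n m mu x : (m <= n)%N -> admissible mu ->
  U s n m mu x = Upol s n m (complex.Re (mu ^+ 2)) x.
Proof.
move=> mn adm; rewrite /U.
have pf : ProperFilter (within (@generic R) (nbhs x)) by apply: within_nbhs_proper; exact: generic_dense.
apply/cvg_lim => //.
apply: (@cvg_trans _ (Upol s n m (complex.Re (mu ^+ 2)) @ within (@generic R) (nbhs x))).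
  apply: near_eq_cvg; near=> y.
  have gy : generic y by near: y; exact: withinT.
  rewrite Uhat_generic // Re_real /Upol ev2_Qb -rho_sqr -Hs_angle; ring.
have hd := PF_Upol s n m (complex.Re (mu ^+ 2)).
apply: cvg_within_filter; exact: (PF_continuous continuous_coR3 hd).
Unshelve. all: by end_near.
Qed.

Lemma X_dUpol s n m mu x : (m <= n.+1)%N -> admissible mu ->
  X s n m mu x = let d := dUpol s n.+1 m (complex.Re (mu ^+ 2)) x in (d None, - d (Some false), - d (Some true)).
Proof.
move=> mn adm; rewrite /X /del.
have -> : U s n.+1 m mu = Upol s n.+1 m (complex.Re (mu ^+ 2)).
  by apply/funext => y; rewrite U_Upol.
have hd := PF_Upol s n.+1 m (complex.Re (mu ^+ 2)).
rewrite /=; congr (_, - _, - _);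
  apply: (PF_derive _ hd) => -[[]|] u; rewrite /= /co0 /co1 /co2 /= /GRing.scale /=; ring.
Qed.
End HarmonicPolynomials.

(** * Integrals over disks and ellipsoids *)

Section Integrals.
Variable R : realType.
Notation leb := (@lebesgue_measure R).
Notation T1 := (measurableTypeR R).

Lemma integrable_bounded_support d (T : measurableType d) (mu : {measure set T -> \bar R})
  (A : set T) (M : R) (f : T -> R) : measurable A -> (mu A < +oo)%E -> measurable_fun setT f ->
  (forall x, A x -> `|f x| <= M) -> (forall x, ~ A x -> f x = 0) ->
  mu.-integrable setT (EFin \o f).
Proof.
move=> mA fA mf bf f0.
have -> : EFin \o f = (EFin \o f) \_ A.
  apply/funext => x; rewrite /patch; case: ifPn => // /negP h /=.
  by rewrite f0 // => Ax; apply: h; rewrite inE.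
apply/(integrable_mkcond _ mA); apply: measurable_bounded_integrable => //.
  exact: measurable_funS mf.
exists M; split; first exact: num_real.
by move=> x Mx y Ay; apply: le_trans (ltW Mx); exact: bf.
Qed.

(** Integrability of every section, not just of almost every one, makes the real-valued inner
    integral agree everywhere with the extended one. *)
Lemma Rintegral_fubini d1 d2 (X : measurableType d1) (Y : measurableType d2)
  (m1 : {sigma_finite_measure set X -> \bar R}) (m2 : {sigma_finite_measure set Y -> \bar R})
  (f : X * Y -> R) : (m1 \x m2)%E.-integrable setT (EFin \o f) ->
  (forall x, m2.-integrable setT (EFin \o (fun y => f (x, y)))) ->
  m1.-integrable setT (EFin \o (fun x => \int[m2]_y f (x, y))) /\
  \int[(m1 \x m2)%E]_z f z = \int[m1]_x (\int[m2]_y f (x, y)).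
Proof.
move=> fi fx.
have e : EFin \o (fun x => \int[m2]_y f (x, y)) = fubini_F m2 (EFin \o f).
  by apply/funext => x /=; rewrite /Rintegral fineK //; exact: integrable_fin_num (fx x).
split; first by rewrite e; exact: integrable_fubini_F.
rewrite /Rintegral -integral12_prod_meas1 //; congr fine; apply: eq_integral => x _.
by have := congr1 (fun k => k x) e => /= <-.
Qed.

Lemma Rintegral_fubini2 d1 d2 (X : measurableType d1) (Y : measurableType d2)
  (m1 : {sigma_finite_measure set X -> \bar R}) (m2 : {sigma_finite_measure set Y -> \bar R})
  (f : X * Y -> R) : (m1 \x m2)%E.-integrable setT (EFin \o f) ->
  (forall y, m1.-integrable setT (EFin \o (fun x => f (x, y)))) ->
  \int[(m1 \x m2)%E]_z f z = \int[m2]_y (\int[m1]_x f (x, y)).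
Proof.
move=> fi fx.
rewrite /Rintegral -integral21_prod_meas1 //; congr fine; apply: eq_integral => y _.
by rewrite fineK //; exact: integrable_fin_num (fx y).
Qed.

Lemma Rintegral_horner (a b : R) (p : {poly R}) : a <= b ->
  \int[leb]_(x in `]a, b[) p.[x] = pint a b p.
Proof.
move=> ab; move: (ab); rewrite le_eqVlt => /predU1P[<-|lab].
  by rewrite set_itvoo0 Rintegral_set0 /pint subrr.
have mp (i : interval R) : measurable_fun [set` i] (horner p).
  by apply: measurable_funTS; apply: continuous_measurable_fun; exact: continuous_horner.
have mE (i : interval R) : measurable_fun [set` i] (EFin \o horner p) by apply/measurable_EFinP; exact: mp.
rewrite /Rintegral.
rewrite -(@integral_itv_bndoo _ a b _ true false); last exact: mE.
have := @continuous_FTC2 R (horner p) (horner (prim p)) a b lab => ->; first by [].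
- by apply: continuous_subspaceT; exact: continuous_horner.
- split; first by move=> x _; exact: derivable_horner.
  + by apply: cvg_at_right_filter; exact: continuous_horner.
  + by apply: cvg_at_left_filter; exact: continuous_horner.
- by move=> x _; rewrite -derivE deriv_prim.
Qed.

(* Integrals over [b > 0] are written as integrals of [cut b f] over the whole space, where
   Fubini's theorem is available. *)
Definition cut (T : Type) (b : T -> R) (f : T -> R) (x : T) : R := if 0 < b x then f x else 0.

Lemma cut_measurable d (T : measurableType d) (b f : T -> R) :
  measurable_fun setT b -> measurable_fun setT f -> measurable_fun setT (cut b f).
Proof.
move=> mb mf; apply: measurable_fun_if => //.
- exact: measurable_fun_ltr.
- exact: measurable_funS mf.
Qed.

Definition box1 (M : R) : set R := `[- M, M].

Lemma box1P M x : box1 M x <-> `|x| <= M.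
Proof. by rewrite /box1 /= in_itv /= ler_norml. Qed.

Lemma measurable_box1 M : measurable (box1 M : set T1).
Proof. exact: measurable_itv. Qed.

Lemma box1_fin M : (leb (box1 M) < +oo)%E.
Proof. by rewrite /box1 lebesgue_measure_itv /=; case: ifP => // _; rewrite -EFinB ltry. Qed.

Definition box2 M : set (R * R) := box1 M `*` box1 M.

Lemma measurable_box2 M : measurable (box2 M : set (T1 * T1)).
Proof. by apply: measurableX; exact: measurable_box1. Qed.

Lemma box2_fin M : ((leb \x leb)%E (box2 M) < +oo)%E.
Proof.
rewrite product_measure1E; [|exact: measurable_box1|exact: measurable_box1].
by rewrite lte_mul_pinfty ?box1_fin // ge0_fin_numE // box1_fin.
Qed.

Definition box3 M : set (R * R * R) := box2 M `*` box1 M.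

Lemma measurable_box3 M : measurable (box3 M : set (T1 * T1 * T1)).
Proof. by apply: measurableX; [exact: measurable_box2|exact: measurable_box1]. Qed.

Lemma box3_fin M : (((leb \x leb) \x leb)%E (box3 M) < +oo)%E.
Proof.
rewrite product_measure1E; [|exact: measurable_box2|exact: measurable_box1].
by rewrite lte_mul_pinfty ?box1_fin // ge0_fin_numE // box2_fin.
Qed.
End Integrals.

(** * Integration by parts over a disk *)

Section Disk.
Variable R : realType.
Notation leb := (@lebesgue_measure R).
Notation T1 := (measurableTypeR R).

Definition coR2 (i : bool) : R * R -> R := if i then snd else fst.

(** [h] is the squared radius; the function is positive inside the disk and vanishes on the circle.
    For [h <= 0] the disk is empty. *)
Definition disk (h : R) (z : R * R) : R := h - (z.1 ^+ 2 + z.2 ^+ 2).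

Definition dint (h : R) (g : R * R -> R) : R := \int[(leb \x leb)%E]_z cut (disk h) g z.

Lemma measurable_coR2 i : measurable_fun setT (coR2 i : T1 * T1 -> R).
Proof. by case: i; [exact: measurable_snd|exact: measurable_fst]. Qed.

Lemma PF_sqnorm : PF coR2 (fun z => z.1 ^+ 2 + z.2 ^+ 2) (fun i z => 2 * coR2 i z).
Proof.
have h1 := PF_coord coR2 false; have h2 := PF_coord coR2 true.
apply: (PF_ext (PFD (PFM h1 h1) (PFM h2 h2))) => [e|i e] /=; first by rewrite !expr2.
by case: i => /=; ring.
Qed.

Lemma PF_disk h : PF coR2 (disk h) (fun i z => - 2 * coR2 i z).
Proof.
apply: (PF_ext (PFD (PF_cst coR2 h) (PFM (PF_cst coR2 (-1)) PF_sqnorm))) => [e|i e] /=.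
  by rewrite /disk; ring.
by ring.
Qed.

Lemma horner_measurable (p : {poly R}) : measurable_fun setT (horner p : T1 -> R).
Proof. by apply: continuous_measurable_fun; exact: continuous_horner. Qed.

Lemma disk_gt0_bound h x y : 0 < disk h (x, y) -> `|x| <= `|h| + 1 /\ `|y| <= `|h| + 1.
Proof.
rewrite /disk /= => d0.
have hh := ler_norm h; have n0 := normr_ge0 h.
have k (a : R) : a ^+ 2 < h -> `|a| <= `|h| + 1.
  move=> ah; rewrite -(@ler_pXn2r _ 2) ?nnegrE ?addr_ge0 // real_normK ?num_real //.
  by nra.
by split; apply: k; [have := sqr_ge0 y|have := sqr_ge0 x]; lra.
Qed.

Lemma PF2_line1 g dg x : PF coR2 g dg ->
  exists p : {poly R}, forall y, g (x, y) = p.[y] /\ dg true (x, y) = p^`().[y].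
Proof.
move=> hg; apply: (@PF_line R _ _ coR2 (fun y => (x, y)) true g dg _ hg).
by case=> u /=; ring.
Qed.

Lemma PF2_line2 g dg y : PF coR2 g dg ->
  exists p : {poly R}, forall x, g (x, y) = p.[x] /\ dg false (x, y) = p^`().[x].
Proof.
move=> hg; apply: (@PF_line R _ _ coR2 (fun x => (x, y)) false g dg _ hg).
by case=> u /=; ring.
Qed.

Lemma cut_disk_bound h g dg : PF coR2 g dg ->
  exists M, (forall z, `|cut (disk h) g z| <= M) /\
    forall z, 0 < disk h z -> box2 (`|h| + 1) z.
Proof.
move=> hg.
have bz z : 0 < disk h z -> box2 (`|h| + 1) z.
  by case: z => x y /disk_gt0_bound [bx by']; split; apply/box1P.
have [|M hM] := @PF_bounded R _ _ coR2 (box2 (`|h| + 1)) g dg _ hg.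
  by move=> j; exists (`|h| + 1) => -[x y] [/box1P bx /box1P by']; case: j.
exists (Num.max M 0); split => // z.
rewrite /cut; case: ifP => [d0|_]; last by rewrite normr0 le_max lexx orbT.
by rewrite le_max hM //; exact: bz.
Qed.

Lemma cut_disk_integrable h g dg : PF coR2 g dg ->
  [/\ (leb \x leb)%E.-integrable setT (EFin \o cut (disk h) g),
    forall x, leb.-integrable setT (EFin \o (fun y => cut (disk h) g (x, y))) &
    forall y, leb.-integrable setT (EFin \o (fun x => cut (disk h) g (x, y)))].
Proof.
move=> hg; have [M [bM bs]] := cut_disk_bound h hg.
have off z : ~ box2 (`|h| + 1) z -> cut (disk h) g z = 0.
  by move=> nb; rewrite /cut; case: ifP => // d0; case: nb; exact: bs.
split.
- apply: (integrable_bounded_support (@measurable_box2 R (`|h| + 1)) (@box2_fin R _) (M := M)); [|by []|by []].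
  apply: cut_measurable; first exact: (PF_measurable measurable_coR2 (PF_disk h)).
  exact: (PF_measurable measurable_coR2 hg).
- move=> x; apply: (integrable_bounded_support (@measurable_box1 R (`|h| + 1)) (@box1_fin R _) (M := M)); [|by []|].
    have [p hp] := PF2_line1 x hg; have [q hq] := PF2_line1 x (PF_disk h).
    rewrite (_ : (fun y => _) = cut (horner q) (horner p)); last first.
      by apply/funext => y; rewrite /cut (hq y).1 (hp y).1.
    by apply: cut_measurable; exact: horner_measurable.
  by move=> y ny; apply: off => -[].
- move=> y; apply: (integrable_bounded_support (@measurable_box1 R (`|h| + 1)) (@box1_fin R _) (M := M)); [|by []|].
    have [p hp] := PF2_line2 y hg; have [q hq] := PF2_line2 y (PF_disk h).
    rewrite (_ : (fun x => _) = cut (horner q) (horner p)); last first.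
      by apply/funext => x; rewrite /cut (hq x).1 (hp x).1.
    by apply: cut_measurable; exact: horner_measurable.
  by move=> x nx; apply: off => -[].
Qed.

Lemma dint_lin h (a b : R) f df g dg : PF coR2 f df -> PF coR2 g dg ->
  dint h (fun z => a * f z + b * g z) = a * dint h f + b * dint h g.
Proof.
move=> hf hg; have [fi _ _] := cut_disk_integrable h hf; have [gi _ _] := cut_disk_integrable h hg.
have sc c k dk : PF coR2 k dk -> (leb \x leb)%E.-integrable setT (EFin \o (fun z => c * cut (disk h) k z)).
  move=> hk; have [ki _ _] := cut_disk_integrable h hk.
  have := integrableZl measurableT c ki.
  by apply: eq_integrable => // z _; rewrite /= EFinM.
rewrite /dint -!RintegralZl // -RintegralD //; [|exact: sc hf|exact: sc hg].
apply: eq_Rintegral => z _; rewrite /cut; case: ifP => _ //; by rewrite !mulr0 addr0.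
Qed.

Lemma cut_interval (q p : {poly R}) (c : R) : (forall y, q.[y] = c - y ^+ 2) ->
  \int[leb]_y cut (horner q) (horner p) y =
  if 0 < c then pint (- Num.sqrt c) (Num.sqrt c) p else 0.
Proof.
move=> hq; case: ifPn => [c0|c0]; last first.
  rewrite (_ : cut _ _ = fun=> 0) ?Rintegral_cst ?mul0r //.
  apply/funext => y; rewrite /cut hq ifF //; apply/negbTE; rewrite -leNgt.
  by have := sqr_ge0 y; rewrite -leNgt in c0; lra.
rewrite -Rintegral_horner; last by rewrite ge0_cp ?sqrtr_ge0.
rewrite [in RHS]Rintegral_mkcond; apply: eq_Rintegral => y _.
rewrite /cut /patch hq mem_setE in_itv /= -ltr_norml.
rewrite -(@ltr_pXn2r _ 2 _ `|y|) ?nnegrE ?sqrtr_ge0 //.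
by rewrite real_normK ?num_real // sqr_sqrtr ?(ltW c0) // subr_gt0.
Qed.

(** The integrand is the [y]-derivative of [disk h * g], and [disk h] vanishes at both ends of every
    chord. *)
Lemma dint_deriv_y h g dg : PF coR2 g dg ->
  dint h (fun z => disk h z * dg true z - 2 * z.2 * g z) = 0.
Proof.
move=> hg; have hb := PFM (PF_disk h) hg.
have [db hdb] : exists db, PF coR2 (fun z => disk h z * dg true z - 2 * z.2 * g z) db.
  have [d1 h1] := PF_partial true hg.
  have h2 := PF_coord coR2 true.
  by eexists; apply: (PF_ext (PFD (PFM (PF_disk h) h1) (PFM (PF_cst coR2 (-2)) (PFM h2 hg)))) => [z|i z] /=; [ring|exact: erefl].
have [i1 i2 _] := cut_disk_integrable h hdb.
rewrite /dint (Rintegral_fubini i1 i2).2.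
rewrite (_ : (fun x => _) = fun=> 0) ?Rintegral_cst ?mul0r //; apply/funext => x.
have [p hp] := PF2_line1 x hb; have [q hq] := PF2_line1 x (PF_disk h).
rewrite (_ : (fun y => cut _ _ _) = cut (horner q) (horner p^`())); last first.
  apply/funext => y; rewrite /cut -(hp y).2 (hq y).1 /=; case: ifP => // _; ring.
rewrite (@cut_interval _ _ (h - x ^+ 2)); last by move=> y; rewrite -(hq y).1 /disk /=; ring.
case: ifPn => // c0; rewrite pint_deriv -!(hp _).1 /disk /= sqrrN sqr_sqrtr ?(ltW c0) //; ring.
Qed.

Lemma dint_deriv_x h g dg : PF coR2 g dg ->
  dint h (fun z => disk h z * dg false z - 2 * z.1 * g z) = 0.
Proof.
move=> hg; have hb := PFM (PF_disk h) hg.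
have [db hdb] : exists db, PF coR2 (fun z => disk h z * dg false z - 2 * z.1 * g z) db.
  have [d1 h1] := PF_partial false hg.
  have h2 := PF_coord coR2 false.
  by eexists; apply: (PF_ext (PFD (PFM (PF_disk h) h1) (PFM (PF_cst coR2 (-2)) (PFM h2 hg)))) => [z|i z] /=; [ring|exact: erefl].
have [i1 _ i2] := cut_disk_integrable h hdb.
rewrite /dint (Rintegral_fubini2 i1 i2).
rewrite (_ : (fun x => _) = fun=> 0) ?Rintegral_cst ?mul0r //; apply/funext => y.
have [p hp] := PF2_line2 y hb; have [q hq] := PF2_line2 y (PF_disk h).
rewrite (_ : (fun x => cut _ _ _) = cut (horner q) (horner p^`())); last first.
  by apply/funext => x; rewrite /cut -(hp x).2 (hq x).1 /=; case: ifP => // _; ring.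
rewrite (@cut_interval _ _ (h - y ^+ 2)); last by move=> x; rewrite -(hq x).1 /disk /=; ring.
case: ifPn => // c0; rewrite pint_deriv -!(hp _).1 /disk /= sqrrN sqr_sqrtr ?(ltW c0) //; ring.
Qed.

End Disk.

Section DiskIdentities.
Variable R : realType.
Notation leb := (@lebesgue_measure R).
Notation T1 := (measurableTypeR R).
Local Notation coR2 := (@coR2 R).

(* [x1 d2 g - x2 d1 g] is the divergence of [(h - rho^2)/2 (-d2 g, d1 g)]. *)
Lemma dint_rotation h g dg : PF coR2 g dg ->
  dint h (fun z => z.1 * dg true z - z.2 * dg false z) = 0.
Proof.
move=> hg; have [dd [hd sd]] := PF_partials hg.
have e1 := dint_deriv_x h (hd true); have e2 := dint_deriv_y h (hd false).
have b1 : exists d, PF coR2 (fun z => disk h z * dd true false z - 2 * z.1 * dg true z) d.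
  have [d1 h1] := PF_partial false (hd true); have h2 := PF_coord coR2 false.
  by eexists; apply: (PF_ext (PFD (PFM (PF_disk h) h1) (PFM (PF_cst coR2 (-2)) (PFM h2 (hd true))))) => [z|i z] /=; [ring|exact: erefl].
have b2 : exists d, PF coR2 (fun z => disk h z * dd false true z - 2 * z.2 * dg false z) d.
  have [d1 h1] := PF_partial true (hd false); have h2 := PF_coord coR2 true.
  by eexists; apply: (PF_ext (PFD (PFM (PF_disk h) h1) (PFM (PF_cst coR2 (-2)) (PFM h2 (hd false))))) => [z|i z] /=; [ring|exact: erefl].
case: b1 => d1 h1; case: b2 => d2 h2.
have := dint_lin h (- 2^-1) 2^-1 h1 h2; rewrite e1 e2 !mulr0 addr0 => <-.
by congr dint; apply/funext => z; rewrite sd; field.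
Qed.

(** Write [P = t (t - h) G]. Then [P'] at [t = rho^2] is [- 1 / 2] times the divergence of
    [(h - rho^2) G(rho^2) (x1, x2)]. *)
Lemma dint_radial_deriv h (P : {poly R}) : root P 0 -> root P h -> h != 0 ->
  dint h (fun z => P^`().[z.1 ^+ 2 + z.2 ^+ 2]) = 0.
Proof.
move=> /factor_theorem [P1 ->]; rewrite rootM => /orP[|]; last by rewrite root_XsubC => ->.
move=> /factor_theorem [G ->] h0.
have hG := PF_horner G (PF_sqnorm R).
have g1 := PFM (PF_coord coR2 false) hG; have g2 := PFM (PF_coord coR2 true) hG.
have e1 := dint_deriv_x h g1; have e2 := dint_deriv_y h g2.
have b1 : exists d, PF coR2 (fun z => disk h z * (G.[z.1 ^+ 2 + z.2 ^+ 2] + z.1 * (G^`().[z.1 ^+ 2 + z.2 ^+ 2] * (2 * z.1))) - 2 * z.1 * (z.1 * G.[z.1 ^+ 2 + z.2 ^+ 2])) d.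
  have [d1 h1] := PF_partial false g1; have h2 := PF_coord coR2 false.
  by eexists; apply: (PF_ext (PFD (PFM (PF_disk h) h1) (PFM (PF_cst coR2 (-2)) (PFM h2 g1)))) => [z|i z] /=; [ring|exact: erefl].
have b2 : exists d, PF coR2 (fun z => disk h z * (G.[z.1 ^+ 2 + z.2 ^+ 2] + z.2 * (G^`().[z.1 ^+ 2 + z.2 ^+ 2] * (2 * z.2))) - 2 * z.2 * (z.2 * G.[z.1 ^+ 2 + z.2 ^+ 2])) d.
  have [d1 h1] := PF_partial true g2; have h2 := PF_coord coR2 true.
  by eexists; apply: (PF_ext (PFD (PFM (PF_disk h) h1) (PFM (PF_cst coR2 (-2)) (PFM h2 g2)))) => [z|i z] /=; [ring|exact: erefl].
case: b1 => d1 h1; case: b2 => d2 h2.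
have := dint_lin h (- 2^-1) (- 2^-1) h1 h2.
rewrite (_ : dint h (fun z => _ * (G.[_] + z.1 * _) - _) = 0); last first.
  by rewrite -[RHS]e1; congr dint; apply/funext => z /=; ring.
rewrite (_ : dint h (fun z => _ * (G.[_] + z.2 * _) - _) = 0); last first.
  by rewrite -[RHS]e2; congr dint; apply/funext => z /=; ring.
rewrite !mulr0 addr0 => e; rewrite -[RHS]e; congr dint; apply/funext => z.
rewrite !derivM !derivXsubC !(hornerD, hornerN, hornerM, hornerX, hornerC) /disk.
set t := z.1 ^+ 2 + _; move: G.[t] G^`().[t] => a b; rewrite /t; field; by [].
Qed.

Lemma circle_area (h : R) : 0 < h -> dint h (fun=> 1) = pi * h.
Proof.
move=> h0; have [i1 i2 _] := cut_disk_integrable h (PF_cst coR2 1).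
rewrite /dint (Rintegral_fubini i1 i2).2.
set r := Num.sqrt h; have r0 : 0 < r by rewrite sqrtr_gt0.
have r2 : r ^+ 2 = h by rewrite sqr_sqrtr ?ltW.
rewrite (_ : (fun x => _) = (fun x => 2 * Num.sqrt (h - x ^+ 2)) \_ `[- r, r]%classic); last first.
  apply/funext => x.
  have [q hq] := PF2_line1 x (PF_disk h).
  rewrite (_ : (fun y => cut _ _ _) = cut (horner q) (horner 1%:P)); last first.
    by apply/funext => y; rewrite /cut (hq y).1 hornerC.
  rewrite (@cut_interval _ _ _ (h - x ^+ 2)); last by move=> y; rewrite -(hq y).1 /disk /=; ring.
  rewrite /patch mem_setE in_itv /= -ler_norml -(@ler_pXn2r _ 2 _ `|x|) ?nnegrE ?(ltW r0) //.
  rewrite real_normK ?num_real // r2 -subr_ge0.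
  have -> : 1%:P = ('X : {poly R})^`() by rewrite derivX.
  rewrite pint_deriv !hornerX; case: ltgtP => // e; first by ring.
  by rewrite -e sqrtr0 mulr0.
rewrite -Rintegral_mkcond /Rintegral.
(* The chord at [x] has length [2 sqrt(h - x^2)]; the substitution [x = r sin t] turns the integrand
   into [2 r^2 cos^2 t]. *)
pose F (t : R) := r * sin t.
have pi0 : 0 < (pi : R) / 2 by rewrite divr_gt0 // pi_gt0.
have npi : - (pi / 2) < (pi : R) / 2 by lra.
have F1 t : is_derive t (1 : R) F (r * cos t).
  by have := is_deriveZ r (is_derive_sin t).
have dF : F^`()%classic = (fun t => r * cos t).
  by apply/funext => t; rewrite derive1E derive_val.
have cF : continuous F by move=> t; apply: cvgM; [exact: cvg_cst|exact: continuous_sin].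
have cF' : continuous F^`()%classic by rewrite dF => t; apply: cvgM; [exact: cvg_cst|exact: continuous_cos].
have FE1 : F (pi / 2) = r by rewrite /F sin_pihalf mulr1.
have FE2 : F (- (pi / 2)) = - r by rewrite /F sinN sin_pihalf mulrN1.
rewrite -FE2 -FE1 integration_by_substitution_increasing //; first last.
- have cs : continuous (fun x : R => 2 * Num.sqrt (h - x ^+ 2)).
    move=> x; apply: cvgM; first exact: cvg_cst.
    apply: (@continuous_comp R R R (fun x => h - x ^+ 2) Num.sqrt); last exact: sqrt_continuous.
    by apply: cvgB; [exact: cvg_cst|exact: exprn_continuous].
  exact: continuous_subspaceT cs.
- split; first by move=> x _; exact: ex_derive.
  + by apply: cvg_at_right_filter; exact: cF.
  + by apply: cvg_at_left_filter; exact: cF.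
- by apply: cvgP; apply: cvg_at_left_filter; exact: cF'.
- by apply: cvgP; apply: cvg_at_right_filter; exact: cF'.
- by move=> x y xi yi xy; rewrite /F ltr_pM2l // ltr_sin.
- exact: ltW.
pose A (t : R) := r ^+ 2 * (t + sin t * cos t).
have A1 t : is_derive t (1 : R) A (2 * r ^+ 2 * cos t ^+ 2).
  have d1 : is_derive t (1 : R) (fun t : R => r ^+ 2 * (t + sin t * cos t)) (r ^+ 2 *: (1 + (sin t *: (- sin t) + cos t *: cos t))).
    by apply: is_deriveZ.
  apply: (trigger_derive d1); have := sin2cos2 t.
  by rewrite /GRing.scale /= => e; nra.
rewrite (_ : (\int[leb]_(x in _) _)%E = (\int[leb]_(x in `[(- (pi / 2))%R, (pi / 2)%R]) (2 * r ^+ 2 * cos x ^+ 2)%:E)%E); last first.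
  apply: eq_integral => t; rewrite inE /= in_itv /= => ti; congr EFin.
  rewrite dF; change (2 * Num.sqrt (h - (r * sin t) ^+ 2) * (r * cos t) = 2 * r ^+ 2 * cos t ^+ 2).
  rewrite -[h in LHS]r2 exprMn sin2cos2 mulrBr mulr1 opprB addrC subrK.
  rewrite -exprMn sqrtr_sqr ger0_norm; last by rewrite mulr_ge0 ?(ltW r0) // cos_ge0_pihalf.
  by ring.
rewrite (@continuous_FTC2 R (fun x => 2 * r ^+ 2 * cos x ^+ 2) A (- (pi / 2)) (pi / 2) npi) /=.
- by rewrite /A sinN cosN cos_pihalf !mulr0 !addr0 r2; field.
- have cc : continuous (fun x : R => 2 * r ^+ 2 * cos x ^+ 2).
    move=> x; apply: cvgM; first exact: cvg_cst.
    apply: (@continuous_comp R R R cos (fun y => y ^+ 2)); first exact: continuous_cos.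
    exact: exprn_continuous.
  exact: continuous_subspaceT cc.
- have cA : continuous A by move=> t; apply: differentiable_continuous; apply/derivable1_diffP; exact: ex_derive.
  split; first by move=> x _; exact: ex_derive.
  + by apply: cvg_at_right_filter; exact: cA.
  + by apply: cvg_at_left_filter; exact: cA.
- by move=> t _; rewrite derive1E derive_val.
Qed.
End DiskIdentities.

(** * Radial integrals and angular orthogonality *)

Section Angular.
Variable R : realType.
Local Notation coR2 := (@coR2 R).
Implicit Types (G : {poly R}) (h : R) (s : bool) (a b : nat).

Lemma dint_le0 h g : h <= 0 -> dint h g = 0.
Proof.
move=> h0; rewrite /dint (_ : cut _ _ = fun=> 0) ?Rintegral_cst ?mul0r //.
apply/funext => z; rewrite /cut ifF //; apply/negbTE; rewrite -leNgt /disk.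
by have := sqr_ge0 z.1; have := sqr_ge0 z.2; lra.
Qed.

Lemma prim0 G : (prim G).[0] = 0.
Proof. by rewrite horner_coef0 coef_prim. Qed.

(** Subtracting from [G] its mean [c] over [[0, h]] leaves a polynomial whose antiderivative
    vanishes at [0] and [h], hence of integral zero over the disk; the constant [c] is integrated by
    [circle_area]. *)
Lemma dint_radial h G : 0 < h ->
  dint h (fun z => G.[z.1 ^+ 2 + z.2 ^+ 2]) = pi * pint 0 h G.
Proof.
move=> h0; have hn : h != 0 by rewrite gt_eqF.
pose c := pint 0 h G / h; pose P := prim G - c%:P * 'X.
have P0 : root P 0 by rewrite /root !(hornerD, hornerN, hornerM, hornerX) prim0 mulr0 subrr.
have Ph : root P h.
  by rewrite /root !(hornerD, hornerN, hornerM, hornerX, hornerC) /c divfK // /pint prim0 subr0 subrr.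
have := dint_radial_deriv P0 Ph hn.
have hG := PF_horner G (PF_sqnorm R); have h1 := PF_cst coR2 1.
have := dint_lin h 1 (- c) hG h1; rewrite circle_area //.
rewrite (_ : dint h _ = dint h (fun z => P^`().[z.1 ^+ 2 + z.2 ^+ 2])); last first.
  congr dint; apply/funext => z.
  by rewrite /P derivB deriv_mulC derivX deriv_prim !(hornerD, hornerN, hornerM, hornerC); ring.
move=> -> /eqP; rewrite mul1r mulNr subr_eq0 => /eqP ->.
by rewrite /c mulrCA divfK // mulrC.
Qed.

Definition ang h s s' a b G : R :=
  dint h (fun z => Hs s a z.1 z.2 * Hs s' b z.1 z.2 * G.[z.1 ^+ 2 + z.2 ^+ 2]).

Definition HsF s a (z : R * R) : R := Hs s a z.1 z.2.

Lemma PF_HsF s a : PF coR2 (HsF s a)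
  (fun i z => if i then (dHs s a z.1 z.2).2 else (dHs s a z.1 z.2).1).
Proof.
apply: (PF_ext (PF_Hs s a (PF_coord coR2 false) (PF_coord coR2 true))) => // i z.
by case: i => /=; ring.
Qed.

Lemma PF_ang s s' a b G : exists d,
  PF coR2 (fun z => Hs s a z.1 z.2 * Hs s' b z.1 z.2 * G.[z.1 ^+ 2 + z.2 ^+ 2]) d.
Proof.
by eexists; exact: (PFM (PFM (PF_HsF s a) (PF_HsF s' b)) (PF_horner G (PF_sqnorm R))).
Qed.

(** The rotation field annihilates radial functions and exchanges the two harmonics of degree [k] up
    to the factor [k] or [- k]; the integral of the rotational derivative of the whole product is
    zero. *)
Lemma ang_rotation h (s s' : bool) (a b : nat) G :
  (-1) ^+ s * a%:R * ang h (~~ s) s' a b G + (-1) ^+ s' * b%:R * ang h s (~~ s') a b G = 0.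
Proof.
have hp := PFM (PFM (PF_HsF s a) (PF_HsF s' b)) (PF_horner G (PF_sqnorm R)).
have := dint_rotation h hp; rewrite /ang.
have [d1 h1] := PF_ang (~~ s) s' a b G; have [d2 h2] := PF_ang s (~~ s') a b G.
rewrite -(dint_lin h _ _ h1 h2) => <-; congr dint; apply/funext => -[x y] /=.
have rot t k : x * (dHs t k x y).2 - y * (dHs t k x y).1 = (-1) ^+ t * k%:R * Hs (~~ t) k x y.
  by case: t; case: k => [|k]; rewrite /dHs /Hs /=; ring.
move: (rot s a) (rot s' b) => r1 r2; rewrite /HsF /=.
move: (G.[_]) (G^`().[_]) => g g1.
transitivity ((x * (dHs s a x y).2 - y * (dHs s a x y).1) * (Hs s' b x y * g)
  + (x * (dHs s' b x y).2 - y * (dHs s' b x y).1) * (Hs s a x y * g)); last by ring.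
by rewrite r1 r2; ring.
Qed.

Lemma ang_sym h s s' a b G : ang h s s' a b G = ang h s' s b a G.
Proof. by rewrite /ang; congr dint; apply/funext => z; ring. Qed.

Lemma ang_ortho h s s' a b G : (0 < a)%N || (0 < b)%N -> (s, a) <> (s', b) -> ang h s s' a b G = 0.
Proof.
move=> ab0 ne.
have tt := ang_rotation h true true a b G; have ff := ang_rotation h false false a b G.
have tf := ang_rotation h true false a b G; have ft := ang_rotation h false true a b G.
rewrite /= ?expr0 ?expr1 in tt ff tf ft.
have [eab|nab] := eqVneq a b.
  have ns : s != s' by apply/eqP => e; apply: ne; rewrite e eab.
  subst b; have a0 : (0 < a)%N by case/orP: ab0.
  have an : a%:R != 0 :> R by rewrite pnatr_eq0 -lt0n.
  have z : ang h true false a a G = 0.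
    move: ff; rewrite [ang h false true _ _ _]ang_sym => ff; apply: (mulfI an); lra.
  by case: (s) (s') ns => -[] //= _; rewrite // ang_sym.
have dn : (a%:R ^+ 2 - b%:R ^+ 2) != 0 :> R.
  by rewrite subr_eq0 eqrXn2 ?ler0n // eqr_nat.
(* For different degrees two rotation relations form a homogeneous linear system in two angular
   integrals, with determinant [a^2 - b^2] up to sign. *)
have solve (A B u v : R) : A * u - B * v = 0 -> B * u - A * v = 0 -> (A ^+ 2 - B ^+ 2) * u = 0.
  move=> e1 e2; transitivity (A * (A * u - B * v) - B * (B * u - A * v)); first by ring.
  by rewrite e1 e2; ring.
case: (s); case: (s'); apply: (mulfI dn); rewrite mulr0.
- apply: (solve _ _ _ (ang h false false a b G)); lra.
- apply: (solve _ _ _ (- ang h false true a b G)); lra.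
- apply: (solve _ _ _ (- ang h true false a b G)); lra.
- apply: (solve _ _ _ (ang h true true a b G)); lra.
Qed.

Lemma zpow_norm m (x y : R) : (zpow m x y).1 ^+ 2 + (zpow m x y).2 ^+ 2 = (x ^+ 2 + y ^+ 2) ^+ m.
Proof. by elim: m => [|m IH] /=; rewrite ?expr0 ?[_ ^+ m.+1]exprS -?IH; ring. Qed.

(** Rotation gives the cosine and the sine equal integrals, and their squares add up to [rho^(2a)],
    so each has half of a radial integral. For [a = 0] the cosine has all of it, whence the
    Kronecker symbol. *)
Lemma ang_norm h s a G : 0 < h -> s || (0 < a)%N ->
  ang h s s a a G = (1 + (a == 0)%N%:R) * (pi / 2) * pint 0 h ('X^a * G).
Proof.
move=> h0; case: a => [|a] sa.
  rewrite orbF in sa; rewrite sa expr0 mul1r /ang.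
  rewrite (_ : (fun z => _) = (fun z : R * R => G.[z.1 ^+ 2 + z.2 ^+ 2])) ?dint_radial //.
    by rewrite (_ : (0 == 0)%N%:R = 1 :> R) //; field.
  by apply/funext => z; rewrite /Hs /=; ring.
have tf := ang_rotation h true false a.+1 a.+1 G; rewrite /= expr0 expr1 in tf.
have an : a.+1%:R != 0 :> R by rewrite pnatr_eq0.
have e : ang h true true a.+1 a.+1 G = ang h false false a.+1 a.+1 G.
  apply: (mulfI an); lra.
have [d1 h1] := PF_ang true true a.+1 a.+1 G; have [d2 h2] := PF_ang false false a.+1 a.+1 G.
have := dint_lin h 1 1 h1 h2; rewrite -/(ang h true true _ _ _) -/(ang h false false _ _ _).
rewrite (_ : (fun z => _) = (fun z : R * R => ('X^(a.+1) * G).[z.1 ^+ 2 + z.2 ^+ 2])); last first.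
  by apply/funext => z; rewrite hornerM hornerXn -zpow_norm /Hs /=; ring.
rewrite dint_radial // -e => e2.
have -> : ang h s s a.+1 a.+1 G = ang h true true a.+1 a.+1 G by case: (s).
by rewrite /=; lra.
Qed.
End Angular.

(** * Slicing the spheroid into disks *)

Section Ellipsoid.
Variable R : realType.
Notation leb := (@lebesgue_measure R).
Notation T1 := (measurableTypeR R).
Notation R3 := (R * R * R)%type.

(* The library infers sigma-finiteness of a product of measures only for finite measures. *)
Definition leb2 : set (T1 * T1) -> \bar R := (leb \x leb)%E.

HB.instance Definition _ := Measure.on leb2.

Lemma leb2_sigma_finite : sigma_finite setT leb2.
Proof.
exists (fun n => box2 n%:R); last first.
  by move=> n; split; [exact: measurable_box2|exact: box2_fin].
apply/esym/seteqP; split => // -[x y] _.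
exists (Num.truncn (Num.max `|x| `|y|)).+1 => //; split; apply/box1P => /=;
  apply: le_trans (ltW (truncnS_gt (Num.max `|x| `|y|))); by rewrite le_max lexx ?orbT.
Qed.

HB.instance Definition _ := Measure_isSigmaFinite.Build _ _ _ leb2 leb2_sigma_finite.

(** The squared radius of the slice of the spheroid at [x0 = x]. *)
Definition hgt (kap x : R) : R := (1 - kap) * (1 - x ^+ 2).

Definition ell (kap : R) (x : R3) : R := disk (hgt kap (co0 x)) (co1 x, co2 x).

Lemma PF_ell kap : exists d, PF (@coR3 R) (ell kap) d.
Proof.
have h0 := PF_coord (@coR3 R) None; have h1 := PF_coord (@coR3 R) (Some false); have h2 := PF_coord (@coR3 R) (Some true).
have hc (k : R) := PF_cst (@coR3 R) k.
eexists; apply: (PF_ext (PFD (PFM (hc (1 - kap)) (PFD (hc 1) (PFM (hc (-1)) (PFM h0 h0))))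
  (PFM (hc (-1)) (PFD (PFM h1 h1) (PFM h2 h2))))) => [x|i x]; last exact: erefl.
by rewrite /ell /disk /hgt /=; ring.
Qed.

Lemma measurable_coR3 i : measurable_fun setT (@coR3 R i : T1 * T1 * T1 -> R).
Proof.
case: i => [[]|] /=.
- exact: measurable_snd.
- by apply: (measurableT_comp (f := snd)) => //; exact: measurable_fst.
- by apply: (measurableT_comp (f := fst)) => //; exact: measurable_fst.
Qed.

Lemma Omega_ell (mu : R[i]) : admissible mu ->
  Omega mu = [set x | 0 < ell (complex.Re (mu ^+ 2)) x].
Proof.
move=> adm; have [mu2 k1] := admissible_sqr adm; set kap := complex.Re _ in mu2 k1 *.
apply/funext => x; apply/propext; rewrite /Omega /= mu2.
have -> : (co0 x ^+ 2)%:C + (co1 x ^+ 2 + co2 x ^+ 2)%:C / (1 - kap%:C)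
   = (co0 x ^+ 2 + (co1 x ^+ 2 + co2 x ^+ 2) / (1 - kap))%:C.
  by rewrite [RHS]rmorphD [X in _ = _ + X]rmorphM fmorphV rmorphB rmorph1.
have -> : (1 : R[i]) = 1%:C by [].
rewrite ltcR /ell /disk /hgt /= -ltrBrDl ltr_pdivrMr ?subr_gt0 // mulrC.
by [].
Qed.

Lemma slice_PF f df (x0 : R) : PF (@coR3 R) f df -> exists d, PF (@coR2 R) (fun z => f (x0, z.1, z.2)) d.
Proof.
move=> hf; apply: (PF_subst _ hf) => -[[]|].
- by eexists; exact: (PF_coord (@coR2 R) true).
- by eexists; exact: (PF_coord (@coR2 R) false).
- by eexists; exact: (PF_cst (@coR2 R) x0).
Qed.

Lemma ell_bound kap x : kap < 1 -> 0 < ell kap x -> box3 (2 - kap) x.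
Proof.
move=> k1; case: x => [[a b] c]; rewrite /ell /disk /hgt /co0 /co1 /co2 /= => d0.
have sb := sqr_ge0 b; have sc := sqr_ge0 c.
have a1 : a ^+ 2 < 1 by nra.
have k (y : R) : y ^+ 2 <= 1 - kap \/ y ^+ 2 <= 1 -> `|y| <= 2 - kap.
  move=> hy; rewrite -(@ler_pXn2r _ 2) ?nnegrE // ?real_normK ?num_real //; last lra.
  by case: hy => hy; nra.
have sa := sqr_ge0 a.
split; [split|]; apply/box1P => /=; apply: k; [right|left|left]; nra.
Qed.

Lemma ellipsoid_integral kap f df : kap < 1 -> PF (@coR3 R) f df ->
  \int[((leb \x leb) \x leb)%E]_x cut (ell kap) f x
  = \int[leb]_x0 dint (hgt kap x0) (fun z => f (x0, z.1, z.2)).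
Proof.
move=> k1 hf; have [de he] := PF_ell kap.
have [|M hM] := @PF_bounded R _ _ (@coR3 R) (box3 (2 - kap)) f df _ hf.
  by move=> j; exists (2 - kap) => -[[x y] z] [[/box1P bx /box1P by'] /box1P bz]; case: j => [[]|].
have off x : ~ box3 (2 - kap) x -> cut (ell kap) f x = 0.
  by move=> nb; rewrite /cut; case: ifP => // d0; case: nb; exact: ell_bound.
have bM x : box3 (2 - kap) x -> `|cut (ell kap) f x| <= Num.max M 0.
  by move=> bx; rewrite /cut le_max; case: ifP => _; rewrite ?hM // normr0 lexx orbT.
have i3 : ((leb \x leb) \x leb)%E.-integrable setT (EFin \o cut (ell kap) f).
  apply: (integrable_bounded_support (@measurable_box3 R (2 - kap)) (@box3_fin R _) (M := Num.max M 0)) => //.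
  apply: cut_measurable; first exact: (PF_measurable measurable_coR3 he).
  exact: (PF_measurable measurable_coR3 hf).
have sl x0 : exists d, PF (@coR2 R) (fun z => f (x0, z.1, z.2)) d by exact: slice_PF hf.
have cutE x0 y z : cut (ell kap) f (x0, y, z) = cut (disk (hgt kap x0)) (fun z => f (x0, z.1, z.2)) (y, z) by [].
have i1 x : leb.-integrable setT (EFin \o (fun z => cut (ell kap) f (x, z))).
  case: x => x0 y; have [d hd] := sl x0.
  have [_ h2 _] := cut_disk_integrable (hgt kap x0) hd.
  exact: (h2 y).
have [k2 e2] := @Rintegral_fubini R _ _ (T1 * T1)%type T1 leb2 leb (cut (ell kap) f) i3 i1.
rewrite e2.
(* The product measure groups the coordinates as [((x0, x1), x2)]. After [x2] and then [x1] are
   integrated out, these two integrals are reassembled into one over the disk. *)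
have i2 x0 : leb.-integrable setT (EFin \o (fun y => \int[leb]_z cut (ell kap) f (x0, y, z))) /\
   \int[leb]_y (\int[leb]_z cut (ell kap) f (x0, y, z)) = dint (hgt kap x0) (fun z => f (x0, z.1, z.2)).
  have [d hd] := sl x0; have [h1 h2 _] := cut_disk_integrable (hgt kap x0) hd.
  have [j1 j2] := Rintegral_fubini h1 h2; split; first exact: j1.
  by rewrite /dint j2.
have [_ ->] := Rintegral_fubini k2 (fun x0 => (i2 x0).1).
by apply: eq_Rintegral => x0 _; rewrite (i2 x0).2.
Qed.
End Ellipsoid.

(** * The Dirichlet integral *)

Section Green.
Variable R : realType.
Notation leb := (@lebesgue_measure R).
Implicit Types (P : {poly {poly R}}) (G : {poly R}).

Lemma ev2M P P' (x t : R) : ev2 (P * P') x t = ev2 P x t * ev2 P' x t.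
Proof. by rewrite /ev2 !hornerM. Qed.

Lemma ev2D P P' (x t : R) : ev2 (P + P') x t = ev2 P x t + ev2 P' x t.
Proof. by rewrite /ev2 !hornerD. Qed.

Lemma ev2Xn k (x t : R) : ev2 'X^k x t = t ^+ k.
Proof. by rewrite /ev2 hornerXn horner_exp hornerC. Qed.

Lemma ev2X (x t : R) : ev2 'X x t = t.
Proof. by rewrite /ev2 hornerX hornerC. Qed.

Lemma ev2_natr k (x t : R) : ev2 k%:R x t = k%:R.
Proof. by rewrite /ev2 -polyC_natr hornerC -polyC_natr hornerC. Qed.

Definition ev2E := (ev2M, ev2D, ev2Xn, ev2X, ev2_natr).

Definition fix_x (x : R) P : {poly R} := map_poly (horner_eval x) P.

Lemma fix_xE x P t : (fix_x x P).[t] = ev2 P x t.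
Proof.
rewrite /fix_x /ev2 -[t in LHS](hornerC t x) -/(horner_eval x t%:P) horner_map /=.
by [].
Qed.

Lemma pint_ext (a b : R) (p q : {poly R}) : a <= b -> (forall x, p.[x] = q.[x]) ->
  pint a b p = pint a b q.
Proof.
move=> ab e; rewrite -!Rintegral_horner //.
by apply: eq_Rintegral => x _; exact: e.
Qed.

(** The antiderivative in the outer variable [t] that vanishes at [t = 0]; it commutes with
    differentiation in the inner variable [x0]. *)
Definition prim_in P : {poly {poly R}} := \poly_(i < (size P).+1) (P`_i.-1 * (i%:R^-1)%:P).

Lemma coef_prim_in P i : (prim_in P)`_i = if i == 0%N then 0 else P`_i.-1 * (i%:R^-1)%:P.
Proof.
rewrite coef_poly; case: i => [|i]; first by rewrite invr0 mulr0.
by rewrite ltnS /=; case: ltnP => // h; rewrite nth_default // mul0r.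
Qed.

Lemma deriv_prim_in P : (prim_in P)^`() = P.
Proof.
apply/polyP => i; rewrite coef_deriv coef_prim_in /= -[_ *+ i.+1]mulr_natr -mulrA.
by rewrite -polyC_natr -polyCM mulVf ?mulr1 // pnatr_eq0.
Qed.

Lemma prim_in_deriv_in P : prim_in (deriv_in P) = deriv_in (prim_in P).
Proof.
apply/polyP => i; rewrite coef_prim_in !coef_deriv_in coef_prim_in.
by case: eqP => _; rewrite ?deriv0 // derivM derivC mulr0 addr0.
Qed.

Lemma fix_x_prim x P : fix_x x (prim_in P) = prim (fix_x x P).
Proof.
apply/polyP => i; rewrite coef_map coef_prim_in coef_prim coef_map /=.
by case: eqP => _; rewrite /horner_eval ?horner0 // hornerM hornerC.
Qed.

Lemma deriv_horner_in P (h : {poly R}) :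
  (P.[h])^`() = (deriv_in P).[h] + P^`().[h] * h^`().
Proof.
elim/poly_ind: P => [|P c IH].
  by rewrite /deriv_in map_poly0 deriv0 !horner0 deriv0 mul0r addr0.
have -> : deriv_in (P * 'X + c%:P) = deriv_in P * 'X + c^`()%:P.
  apply/polyP => j; rewrite coef_deriv_in !coefD !coefMX coef_deriv_in !coefC.
  by case: j => [|j]; rewrite ?derivD ?deriv0 /= ?coef_deriv_in ?deriv0.
by rewrite derivMXaddC !hornerMXaddC derivD derivM IH !(hornerD, hornerM, hornerX); ring.
Qed.

Lemma horner2_ev P (h : {poly R}) x : P.[h].[x] = ev2 P x h.[x].
Proof.
rewrite /ev2; elim/poly_ind: P => [|P c IH]; first by rewrite !horner0.
by rewrite !hornerMXaddC !hornerD !hornerM IH hornerC.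
Qed.

Definition hgtp (kap : R) : {poly R} := (1 - kap)%:P * (1 - 'X^2).

Lemma hgtpE kap x : (hgtp kap).[x] = hgt kap x.
Proof. by rewrite /hgtp hornerM hornerC hornerD hornerN hornerXn -polyC1 hornerC. Qed.

Lemma deriv_hgtp kap : (hgtp kap)^`() = - (2 * (1 - kap))%:P * 'X.
Proof.
rewrite /hgtp deriv_mulC derivB derivXn -polyC1 derivC /= -mulr_natr polyCM polyC_natr; ring.
Qed.

(** Green's formula for the field [(P, S)] on the region [0 < t < h(x0)]. The hypothesis on [S] says
    that there is no flux through the axis, and at [x0 = 1] and [x0 = -1] the region closes up
    because [h] vanishes. *)
Lemma green kap P (S : {poly {poly R}}) : S.[0] = 0 ->
  pint (-1) 1 (prim_in (deriv_in P + S^`())).[hgtp kap]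
  = pint (-1) 1 (S.[hgtp kap] - P.[hgtp kap] * (hgtp kap)^`()).
Proof.
move=> S0.
have -> : prim_in (deriv_in P + S^`()) = deriv_in (prim_in P) + (S - (S`_0)%:P).
  rewrite -prim_in_deriv_in; apply/polyP => i.
  rewrite coefD !coef_prim_in coefD coefB coefC coef_deriv.
  case: i => [|i] /=; first by rewrite subrr addr0.
  rewrite subr0 mulrDl; congr (_ + _).
  rewrite -[_ *+ i.+1]mulr_natr -mulrA -polyC_natr -polyCM.
  by rewrite mulfV ?pnatr_eq0 // polyC1 mulr1.
have := deriv_horner_in (prim_in P) (hgtp kap); rewrite deriv_prim_in => e.
rewrite -horner_coef0 S0 polyC0 subr0 hornerD.
have -> : (deriv_in (prim_in P)).[hgtp kap] = ((prim_in P).[hgtp kap])^`() - P.[hgtp kap] * (hgtp kap)^`().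
  by rewrite e; ring.
rewrite -addrA [- _ + _]addrC pintD pint_deriv.
have z x : x ^+ 2 = 1 -> (prim_in P).[hgtp kap].[x] = 0.
  by move=> x1; rewrite horner2_ev hgtpE /hgt x1 subrr mulr0 -fix_xE fix_x_prim prim0.
by rewrite !z ?sqrrN ?expr1n // subrr add0r.
Qed.

Section Harmonic.
Variables (n m : nat) (kap : R).
Hypothesis mn : (m <= n)%N.
Let Q := Qb n m kap.

(** Laplace's equation for [rho^m Phi_m Q(x0, t)] with [t = rho^2]; coefficient by coefficient it is
    the recurrence [axcS]. *)
Lemma Qb_pde : deriv_in (deriv_in Q) = - (4%:R * 'X * Q^`()^`() + (4 * m.+1)%:R * Q^`()).
Proof.
apply/eqP; rewrite -addr_eq0 addrA; apply/eqP.
apply/polyP => k; rewrite coef0.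
have cQ i : Q`_i = (axc R m i * (legD R n m).[1])%:P * (legH n m kap)^`(2 * i).
  rewrite coef_poly mul_polyC; case: ltnP => // h.
  by rewrite derivn_poly0 ?scaler0 // (leq_trans h) // leq_pmull.
rewrite !coefD !coef_deriv_in -mulrA !mulr_natl !coefMn coefXM !coef_deriv.
have -> : Q`_k = - (axc R m k.+1 * (4 * k.+1 * (k.+1 + m))%:R * (legD R n m).[1])%:P * (legH n m kap)^`(2 * k).
  by rewrite cQ axcS -polyCN mulNr opprK.
have e2 : (legH n m kap)^`(2 * k.+1) = (legH n m kap)^`(2 * k)^`()^`().
  by rewrite -!derivnS; congr derivn; lia.
rewrite -polyCN !deriv_mulC; case: k e2 => [|k] e2 /=; rewrite !cQ e2;
  move: (_^`()^`())%R (axc R m _) (legD R n m).[1] => D a b;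
  rewrite !polyCN !polyCM !polyC_natr; ring.
Qed.
End Harmonic.

Lemma ev2_Qb_sep n m kap s y : (m <= n)%N ->
  ev2 (Qb n m kap) (s * y) ((1 - s ^+ 2) * (y ^+ 2 - kap)) = (legD R n m).[s] * (legH n m kap).[y].
Proof. by move=> mn; rewrite ev2_Qb axialE. Qed.

(* Differentiating the separated form in [y] at the boundary [y = 1]. *)
Lemma ev2_Qb_conormal n m kap s : (m <= n)%N ->
  s * ev2 (deriv_in (Qb n m kap)) s (hgt kap s) + 2 * (1 - s ^+ 2) * ev2 (Qb n m kap)^`() s (hgt kap s)
  = (legD R n m).[s] * (legH n m kap)^`().[1].
Proof.
move=> mn; pose c (_ : unit) (y : R) := y.
have h1 := PFM (PF_cst c s) (PF_coord c tt).
have h2 := PFM (PF_cst c (1 - s ^+ 2)) (PFD (PFM (PF_coord c tt) (PF_coord c tt)) (PF_cst c (- kap))).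
have [|p hp] := @PF_line R _ _ c id tt _ _ _ (PF_ev2 (Qb n m kap) h1 h2).
  by case=> u; rewrite /c /=; ring.
have e : horner p = horner ((legD R n m).[s]%:P * legH n m kap).
  apply/funext => y; rewrite -(hp y).1 hornerM hornerC -ev2_Qb_sep // /c.
have := (hp 1).2; rewrite derivE e -derivE deriv_mulC hornerM hornerC => <-.
rewrite /c /hgt !mulr1 (_ : (1 - s ^+ 2) * (1 - kap) = (1 - kap) * (1 - s ^+ 2)); last by ring.
by rewrite /=; ring.
Qed.

(** Up to constants, the gradient product integrated over the circle [rho^2 = t], as a density in
    [t]. The truncated exponent [m.-1] is harmless at [m = 0], where its coefficient vanishes. *)
Definition energy_dens n n' m kap : {poly {poly R}} :=
  let Q := Qb n m kap in let Q' := Qb n' m kap in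
  'X^m * (deriv_in Q * deriv_in Q' + (2 * m)%:R * (Q * Q'^`() + Q^`() * Q') + 4%:R * 'X * Q^`() * Q'^`())
  + (2 * m ^ 2)%:R * 'X^(m.-1) * (Q * Q').

Lemma energy_green n n' m kap : (m <= n)%N -> (m <= n')%N -> kap < 1 ->
  pint (-1) 1 (prim_in (energy_dens n n' m kap)).[hgtp kap] =
  2 * (1 - kap) ^+ m * (legH n' m kap).[1]
   * ((1 - kap) * (legH n m kap)^`().[1] + m%:R * (legH n m kap).[1]) * legJ R n n' m.
Proof.
move=> mn mn' k1; set Q := Qb n m kap; set Q' := Qb n' m kap.
(* [(P, S)] is the field [U' grad U] in the variables [(x0, t)]; since [U] is harmonic, its
   divergence is the product of the gradients. *)
pose P : {poly {poly R}} := 'X^m * deriv_in Q * Q'.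
pose S : {poly {poly R}} := 'X^m * (4%:R * 'X * Q^`() + (2 * m)%:R * Q) * Q'.
have [yD yM yC] := is_deriv_inner R.
have -> : energy_dens n n' m kap = deriv_in P + S^`().
  have dX k : deriv_in ('X^k : {poly {poly R}}) = 0.
    by apply/polyP => i; rewrite coef_deriv_in coefXn coef0; case: eqP; rewrite ?deriv0 // -polyC1 derivC.
  have n0 (k : nat) : (k%:R : {poly {poly R}})^`() = 0 by rewrite -polyC_natr derivC.
  rewrite /P /S !yM dX /energy_dens -/Q -/Q' !(derivM, n0, derivXn, derivX, derivD).
  rewrite (Qb_pde kap mn) -/Q -[_ *+ m]mulr_natr.
  case: (m) => [|k]; rewrite ?expr0 /=; first ring.
  by rewrite [_ ^+ k.+1]exprS; ring.
rewrite green; last first.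
  have c0 (k : nat) : (k%:R : {poly {poly R}}).[0] = k%:R by rewrite -polyC_natr hornerC.
  rewrite /S !hornerM hornerXn !hornerD !hornerM hornerX !c0; case: (m) => [|k]; first by ring.
  by rewrite expr0n /= !mul0r.
rewrite /legJ -!pintCM; apply: pint_ext => [|s]; first lra.
rewrite deriv_hgtp hornerD hornerN [(_ * _).[s]]hornerM !horner2_ev !hgtpE.
have E0 := ev2_Qb_sep kap s 1 mn; have E0' := ev2_Qb_sep kap s 1 mn'.
have E1 := ev2_Qb_conormal kap s mn.
have hh : (1 - s ^+ 2) * (1 ^+ 2 - kap) = hgt kap s by rewrite /hgt expr1n mulrC.
rewrite mulr1 hh in E0 E0'.
rewrite /S /P !ev2E E0 E0'.
set Q1 := ev2 _ _ _ in E1 *; set Q2 := ev2 _ _ _ in E1 *.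
rewrite !(hornerM, hornerC, horner_exp, hornerD, hornerN, hornerX).
move: E1; rewrite /hgt !exprMn.
move: (legD R n m).[s] (legD R n' m).[s] (legH n m kap).[1] (legH n' m kap).[1] ((legH n m kap)^`().[1]) => p p' g g' g1 E1.
transitivity ((1 - kap) ^+ m * (1 - s ^+ 2) ^+ m * (p' * g') *
  (2 * (1 - kap) * (s * Q1 + 2 * (1 - s ^+ 2) * Q2) + (2 * m)%:R * (p * g))); first by ring.
by rewrite E1; ring.
Qed.

End Green.

(** * Inner products of the monogenic polynomials *)

Section Energy.
Variable R : realType.
Notation leb := (@lebesgue_measure R).
Implicit Types (P : {poly {poly R}}) (G : {poly R}).

Definition grad_prod (s s' : bool) n n' m m' kap (x : R * R * R) : R :=
  dUpol s n m kap x None * dUpol s' n' m' kap x None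
  + dUpol s n m kap x (Some false) * dUpol s' n' m' kap x (Some false)
  + dUpol s n m kap x (Some true) * dUpol s' n' m' kap x (Some true).

Lemma grad_prodE s s' n n' m m' kap x0 x1 x2 (t := x1 ^+ 2 + x2 ^+ 2) :
  let Q := Qb n m kap in let Q' := Qb n' m' kap in
  grad_prod s s' n n' m m' kap (x0, x1, x2) =
  (Kc R n m * (-1) ^+ m) * (Kc R n' m' * (-1) ^+ m') *
  (Hs s m x1 x2 * Hs s' m' x1 x2 * (ev2 (deriv_in Q * deriv_in Q' +
     (2%:R * (m%:R * (Q * Q'^`()) + m'%:R * (Q^`() * Q')) + 4%:R * 'X * Q^`() * Q'^`())) x0 t)
   + ((dHs s m x1 x2).1 * (dHs s' m' x1 x2).1 + (dHs s m x1 x2).2 * (dHs s' m' x1 x2).2) * ev2 (Q * Q') x0 t).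
Proof.
move=> Q Q'; rewrite /grad_prod /dUpol /co0 /co1 /co2 /= -/t -/Q -/Q' !ev2E.
(* Euler's relation for homogeneous polynomials, which evaluates the cross terms of the two
   gradients. *)
have euler u k : x1 * (dHs u k x1 x2).1 + x2 * (dHs u k x1 x2).2 = k%:R * Hs u k x1 x2.
  by case: u; case: k => [|k]; rewrite /dHs /Hs /=; ring.
move: (euler s m) (euler s' m').
set H := Hs s m _ _; set H' := Hs s' m' _ _; set a := (dHs s m _ _).1; set b := (dHs s m _ _).2.
set a' := (dHs s' m' _ _).1; set b' := (dHs s' m' _ _).2.
move: (ev2 _ _ _) (ev2 _ _ _) (ev2 _ _ _) (ev2 _ _ _) (ev2 _ _ _) (ev2 _ _ _) => q1 q1' q q' q2 q2'.
move: (Kc R n m * _) (Kc R n' m' * _) => c c' e1 e2.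
transitivity (c * c' * (H * H' * (q2' * q2 + 4 * t * q * q1) + (a * a' + b * b') * (q' * q1')
  + 2 * (x1 * a + x2 * b) * H' * (q' * q1) + 2 * (x1 * a' + x2 * b') * H * (q * q1'))).
  by rewrite /t; ring.
by rewrite e1 e2; ring.
Qed.

(** The partial derivatives of a plane harmonic of degree [m] are harmonics of degree [m - 1], so
    angular orthogonality applies to this term as well. *)
Lemma dHs_prod s s' m m' (x y : R) :
  (dHs s m x y).1 * (dHs s' m' x y).1 + (dHs s m x y).2 * (dHs s' m' x y).2
  = (m * m')%:R * (Hs s m.-1 x y * Hs s' m'.-1 x y
      + (if s == s' then 1 else -1) * (Hs (~~ s) m.-1 x y * Hs (~~ s') m'.-1 x y)).
Proof. by case: s; case: s'; rewrite /dHs /Hs /=; ring. Qed.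

Lemma ang_norm_sum h k G : 0 < h ->
  ang h true true k k G + ang h false false k k G = pi * pint 0 h ('X^k * G).
Proof.
move=> h0.
have [d1 h1] := PF_ang true true k k G; have [d2 h2] := PF_ang false false k k G.
have := dint_lin h 1 1 h1 h2; rewrite -/(ang h true true _ _ _) -/(ang h false false _ _ _) !mul1r => <-.
rewrite -dint_radial //; congr dint; apply/funext => z.
by rewrite hornerM hornerXn -zpow_norm /Hs /=; ring.
Qed.

Lemma dint_grad_prod s s' n n' m m' kap h x0 (Q := Qb n m kap) (Q' := Qb n' m' kap)
  (c := (Kc R n m * (-1) ^+ m) * (Kc R n' m' * (-1) ^+ m'))
  (G0 := fix_x x0 (Q * Q'))
  (G1 := fix_x x0 (deriv_in Q * deriv_in Q' +
     (2%:R * (m%:R * (Q * Q'^`()) + m'%:R * (Q^`() * Q')) + 4%:R * 'X * Q^`() * Q'^`()))) :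
  dint h (fun z => grad_prod s s' n n' m m' kap (x0, z.1, z.2)) =
  c * (ang h s s' m m' G1 + (m * m')%:R * (ang h s s' m.-1 m'.-1 G0
    + (if s == s' then 1 else -1) * ang h (~~ s) (~~ s') m.-1 m'.-1 G0)).
Proof.
set sg : R := if _ then _ else _.
have [d1 h1] := PF_ang s s' m m' G1; have [d2 h2] := PF_ang s s' m.-1 m'.-1 G0.
have [d3 h3] := PF_ang (~~ s) (~~ s') m.-1 m'.-1 G0.
have h4 := PFD (PFM (PF_cst (@coR2 R) 1) h2) (PFM (PF_cst (@coR2 R) sg) h3).
rewrite /ang -[X in X + sg * _]mul1r -(dint_lin h 1 sg h2 h3) mulrDr mulrA -(dint_lin h _ _ h1 h4).
congr dint; apply/funext => -[y z]; rewrite grad_prodE /= dHs_prod -/sg -!fix_xE -/G0 -/G1 -/c.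
by ring.
Qed.

Lemma plane_ortho s s' n n' m m' kap h x0 : s || (0 < m)%N -> s' || (0 < m')%N ->
  (s, m) <> (s', m') ->
  dint h (fun z => grad_prod s s' n n' m m' kap (x0, z.1, z.2)) = 0.
Proof.
move=> sm sm' ne; rewrite dint_grad_prod ang_ortho //; last first.
  case: (m) (m') sm sm' ne => [|k] [|k'] //; rewrite !orbF => -> -> //.
rewrite add0r; case: (m) (m') ne => [|k] [|k'] ne; rewrite ?mul0n ?muln0 ?mul0r ?mulr0 //=.
(* For [k = k'] the degree may be [0], outside the reach of [ang_ortho]; but then [s] and [s']
   differ, and the two terms cancel by symmetry. *)
have [ekk|nkk] := eqVneq k k'; last first.
  have pos : (0 < k)%N || (0 < k')%N by move: nkk; case: (k) => [|?] //; case: (k').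
  by rewrite !ang_ortho ?mulr0 ?addr0 ?mulr0 // => -[] _ /eqP; rewrite (negPf nkk).
have ns : s != s' by apply/eqP => e; apply: ne; rewrite e ekk.
rewrite (negPf ns) ekk mulN1r (_ : ~~ s = s') 1?(_ : ~~ s' = s); try by move: ns; case: (s); case: (s').
by rewrite ang_sym subrr !mulr0.
Qed.

Lemma plane_norm s n n' m kap h x0 : 0 < h -> s || (0 < m)%N ->
  dint h (fun z => grad_prod s s n n' m m kap (x0, z.1, z.2)) =
  Kc R n m * Kc R n' m * (1 + (m == 0)%N%:R) * (pi / 2) * pint 0 h (fix_x x0 (energy_dens n n' m kap)).
Proof.
move=> h0 sm; rewrite dint_grad_prod eqxx mul1r ang_norm //.
set G0 := fix_x _ (_ * _); set G1 := fix_x _ (_ + _).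
have -> : ang h s s m.-1 m.-1 G0 + ang h (~~ s) (~~ s) m.-1 m.-1 G0 = pi * pint 0 h ('X^(m.-1) * G0).
  by rewrite -ang_norm_sum //; case: (s) => //=; rewrite addrC.
have -> : fix_x x0 (energy_dens n n' m kap) = 'X^m * G1 + (2 * m ^ 2)%:R * ('X^(m.-1) * G0).
  rewrite /energy_dens /G0 /G1 /fix_x !(rmorphD, rmorphM, rmorph_nat) /= !map_polyXn map_polyX.
  by ring.
rewrite pintD pintnM mulrACA -expr2 sqrr_sign mulr1.
by case: (m) => [|k] /=; [field|rewrite addr0; field].
Qed.

Lemma PF_grad_prod s s' n n' m m' kap : exists d, PF (@coR3 R) (grad_prod s s' n n' m m' kap) d.
Proof.
have h i := PF_partial i (PF_Upol s n m kap); have h' i := PF_partial i (PF_Upol s' n' m' kap).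
have [d0 h0] := h None; have [d1 h1] := h (Some false); have [d2 h2] := h (Some true).
have [d0' h0'] := h' None; have [d1' h1'] := h' (Some false); have [d2' h2'] := h' (Some true).
by eexists; exact: (PFD (PFD (PFM h0 h0') (PFM h1 h1')) (PFM h2 h2')).
Qed.

Lemma inner_slices (mu : R[i]) s s' n n' m m' (kap := complex.Re (mu ^+ 2)) :
  admissible mu -> (m <= n.+1)%N -> (m' <= n'.+1)%N ->
  inner mu (X s n m mu) (X s' n' m' mu) =
  \int[leb]_x0 dint (hgt kap x0) (fun z => grad_prod s s' n.+1 n'.+1 m m' kap (x0, z.1, z.2)).
Proof.
move=> adm mn mn'; have [d hd] := PF_grad_prod s s' n.+1 n'.+1 m m' kap.
have [_ k1] := admissible_sqr adm.
rewrite -(ellipsoid_integral k1 hd) /inner Rintegral_mkcond; apply: eq_Rintegral => x _.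
have eO : (x \in Omega mu) = (0 < ell kap x) by rewrite Omega_ell //; apply/idP/idP; rewrite inE.
rewrite /patch eO /cut; case: ifP => // _.
by rewrite (X_dUpol s x mn adm) (X_dUpol s' x mn' adm) -/kap /grad_prod {1 2}/co0 {1 2}/co1 {1 2}/co2 /=; ring.
Qed.

Lemma inner_X_ortho (mu : R[i]) s s' n n' m m' : admissible mu ->
  basis_index s n m -> basis_index s' n' m' -> (s, m) <> (s', m') ->
  inner mu (X s n m mu) (X s' n' m' mu) = 0.
Proof.
move=> adm /andP[sm mn] /andP[sm' mn'] ne; rewrite inner_slices //.
rewrite (_ : (fun x0 => _) = fun=> 0) ?Rintegral_cst ?mul0r //.
by apply/funext => x0; exact: plane_ortho.
Qed.

Lemma inner_X_energy (mu : R[i]) s n n' m (kap := complex.Re (mu ^+ 2)) : admissible mu ->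
  basis_index s n m -> basis_index s n' m ->
  inner mu (X s n m mu) (X s n' m mu) =
  Kc R n.+1 m * Kc R n'.+1 m * (1 + (m == 0)%N%:R) * pi * (1 - kap) ^+ m * (legH n'.+1 m kap).[1]
   * ((1 - kap) * (legH n.+1 m kap)^`().[1] + m%:R * (legH n.+1 m kap).[1]) * legJ R n.+1 n'.+1 m.
Proof.
move=> adm /andP[sm mn] /andP[_ mn']; rewrite inner_slices // -/kap.
have [_ k1] := admissible_sqr adm; rewrite -/kap in k1.
set e := energy_dens n.+1 n'.+1 m kap.
set C := Kc R n.+1 m * Kc R n'.+1 m * (1 + (m == 0)%N%:R) * (pi / 2).
(* The slice is empty unless [|x0| < 1]; there its integral is a polynomial in [x0], to which
   [energy_green] applies. *)
rewrite (_ : (fun x0 => _) = (fun x0 => (C%:P * (prim_in e).[hgtp kap]).[x0]) \_ `](-1), 1[%classic); last first.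
  apply/funext => x0; rewrite /patch mem_setE in_itv /= -ltr_norml.
  have -> : (`|x0| < 1) = (0 < hgt kap x0).
    rewrite /hgt pmulr_rgt0 ?subr_gt0 // -(@ltr_pXn2r _ 2 _ `|x0|) ?nnegrE //.
    by rewrite real_normK ?num_real // expr1n.
  case: ltP => h0; last by rewrite dint_le0.
  rewrite plane_norm // -/C -/e /pint prim0 subr0 hornerM hornerC horner2_ev -fix_xE fix_x_prim hgtpE.
  by [].
rewrite -Rintegral_mkcond Rintegral_horner; last lra.
by rewrite pintCM /e energy_green // /C; field.
Qed.
End Energy.

(** * The norm formula *)

Section LineIntegral.
Variable R : realType.
Notation leb := (@lebesgue_measure R).
Notation C := R[i].
Implicit Types (p : {poly C}).

(** The line from [1] to [T] may pass through [0], at one parameter [s0]; there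
    [z * sqrtc (1 - z^-2)] evaluates to [0] and its square is not [z^2 - 1]. *)
Lemma Rintegral_except (f : R -> R) (p : {poly R}) s0 : (forall s, s != s0 -> f s = p.[s]) ->
  \int[leb]_(s in `[0, 1]) f s = pint 0 1 p.
Proof.
move=> fp; rewrite -Rintegral_horner //.
have mD : measurable (`[0, 1]%classic `\ s0 : set (measurableTypeR R)) by exact: measurableD.
have mp : measurable_fun setT (EFin \o horner p : measurableTypeR R -> \bar R).
  by apply/measurable_EFinP; exact: horner_measurable.
pose D : set (measurableTypeR R) := `[0, 1]%classic `\ s0.
have eD : {in D, (EFin \o horner p) =1 (EFin \o f)}.
  by move=> s; rewrite inE => -[_ /= /eqP ns]; rewrite /= fp.
have mp' : measurable_fun D (EFin \o horner p) by exact: measurable_funTS.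
have mf : measurable_fun D (EFin \o f) by exact: eq_measurable_fun eD mp'.
rewrite /Rintegral -(@integral_itv_bndoo _ 0 1 _ true false); last exact: measurable_funTS.
rewrite -(integral_setD1 mD mf) -(integral_setD1 mD mp'); congr fine.
by apply: eq_integral => s hs; rewrite -eD.
Qed.

Definition Re_poly p : {poly R} := \poly_(i < size p) complex.Re p`_i.
Definition Im_poly p : {poly R} := \poly_(i < size p) complex.Im p`_i.

Lemma Re_polyE p (s : R) : complex.Re p.[s%:C] = (Re_poly p).[s].
Proof.
rewrite horner_poly horner_coef; elim/big_rec2: _ => // i y x _ <-.
rewrite -rmorphXn; case: p`_i => a b; case: x => c d /=; rewrite mulr0 subr0 //.
Qed.

Lemma Im_polyE p (s : R) : complex.Im p.[s%:C] = (Im_poly p).[s].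
Proof.
rewrite horner_poly horner_coef; elim/big_rec2: _ => // i y x _ <-.
rewrite -rmorphXn; case: p`_i => a b; case: x => c d /=; rewrite mulr0 add0r //.
Qed.

Lemma Re_poly_deriv p : Re_poly p^`() = (Re_poly p)^`()%R.
Proof.
have cE q i : (Re_poly q)`_i = complex.Re q`_i.
  by rewrite coef_poly; case: ltnP => // h; rewrite nth_default.
apply/polyP => i; rewrite cE !coef_deriv cE.
move: (i.+1) (p`_i.+1) => k z; elim: k => [//|k IH]; rewrite !mulrSr -IH.
by case: (_ *+ k); case: (z).
Qed.

Lemma Im_poly_deriv p : Im_poly p^`() = (Im_poly p)^`()%R.
Proof.
have cE q i : (Im_poly q)`_i = complex.Im q`_i.
  by rewrite coef_poly; case: ltnP => // h; rewrite nth_default.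
apply/polyP => i; rewrite cE !coef_deriv cE.
move: (i.+1) (p`_i.+1) => k z; elim: k => [//|k IH]; rewrite !mulrSr -IH.
by case: (_ *+ k); case: (z).
Qed.

Lemma line_integral_poly (f : C -> C) p (T : C) : (forall z, z != 0 -> f z = p.[z]) ->
  line_integral f 1 T = pint 1 T p.
Proof.
move=> fp.
have [s0 hs0] : exists s0 : R, forall s, s != s0 -> 1 + s%:C * (T - 1) != 0.
  have [[s0 e0]|ns] := pselect (exists s0 : R, 1 + s0%:C * (T - 1) = 0); last first.
    by exists 0 => s _; apply/eqP => e; apply: ns; exists s.
  exists s0 => s; apply: contra => /eqP e.
  have : (s%:C - s0%:C) * (T - 1) = 0 by rewrite mulrBl -[X in X - _](addKr 1) e -[X in _ - X](addKr 1) e0 subrr.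
  move=> /eqP; rewrite mulf_eq0 subr_eq0 => /orP[/eqP /complexI -> //|/eqP t1].
  by move: e0; rewrite t1 mulr0 addr0 => /eqP; rewrite oner_eq0.
(* An antiderivative along the segment. Its real and imaginary parts at real parameters are real
   polynomials, integrated separately. *)
pose Phi : {poly C} := prim p \Po (1%:P + (T - 1)%:P * 'X).
have dPhi s : s != s0 -> f (1 + s%:C * (T - 1)) * (T - 1) = Phi^`().[s%:C].
  move=> ns; rewrite fp ?hs0 // /Phi deriv_comp deriv_prim derivD derivM !derivC derivX.
  by rewrite !(horner_comp, hornerM, hornerD, hornerC, hornerX) mul0r !add0r mulr1 [(T - 1) * _]mulrC.
rewrite /line_integral.
rewrite (@Rintegral_except _ (Re_poly Phi^`()) s0); last by move=> s ns; rewrite dPhi // Re_polyE.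
rewrite (@Rintegral_except _ (Im_poly Phi^`()) s0); last by move=> s ns; rewrite dPhi // Im_polyE.
rewrite Re_poly_deriv Im_poly_deriv !pint_deriv -!Re_polyE -!Im_polyE.
have P1 : Phi.[1%:C] = (prim p).[T].
  by rewrite /Phi horner_comp !(hornerM, hornerD, hornerC, hornerX) rmorph1 mulr1 addrC subrK.
have P0 : Phi.[0%:C] = (prim p).[1].
  by rewrite /Phi horner_comp !(hornerM, hornerD, hornerC, hornerX) rmorph0 mulr0 addr0.
by rewrite P1 P0 /pint; case: (_.[T]) => a b; case: (_.[1]).
Qed.

(** Both factors carry the same power of the square root, so their product is a polynomial. *)
Lemma legendreI_nat (nu : C) n k : nu != 0 ->
  legendreI nu n (Posz k) = pint 1 nu^-1 (('X^2 - 1) ^+ k * (legD C n k * legD C n.+2 k)).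
Proof.
move=> nu0; rewrite /legendreI; apply: line_integral_poly => z z0.
rewrite /legendrePz_off /legendreP_off mulrACA -exprMn.
have -> : z * sqrtc (1 - z ^- 2) * (z * sqrtc (1 - z ^- 2)) = z ^+ 2 - 1.
  rewrite mulrACA -expr2 -expr2 sqr_sqrtc mulrBr mulr1 mulfV // expf_neq0 //.
by rewrite !hornerM horner_exp hornerD hornerN hornerXn -polyC1 hornerC.
Qed.

Lemma legendreI_neg (nu : C) n : nu != 0 ->
  legendreI nu n (Negz 0) = (n - 1)`!%:R / (n + 1)`!%:R * ((n.+2 - 1)`!%:R / (n.+2 + 1)`!%:R) * legendreI nu n 1.
Proof.
move=> nu0; rewrite (legendreI_nat n 1 nu0) -pintCM /legendreI; apply: line_integral_poly => z z0.
rewrite /legendrePz_off /legendreP_off mulrACA.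
rewrite [X in _ * X]mulrACA -exprMn.
have -> : z * sqrtc (1 - z ^- 2) * (z * sqrtc (1 - z ^- 2)) = z ^+ 2 - 1.
  rewrite mulrACA -expr2 -expr2 sqr_sqrtc mulrBr mulr1 mulfV // expf_neq0 //.
by rewrite !hornerM hornerC horner_exp hornerD hornerN hornerXn -polyC1 hornerC.
Qed.
End LineIntegral.

(** * The bracket of integrals as a squared norm *)

Section NormFormula.
Variable R : realType.
Notation C := R[i].
Implicit Types (nu kap : C).

(* The squared norm of [X s n m mu] as a function of [kap = mu^2]. *)
Definition energy (F : numFieldType) (pi0 : F) (n m : nat) (kap : F) : F :=
  ((n.+1 - m)`!%:R / (dfact (2 * n).+1)%:R) ^+ 2 * (1 + (m == 0)%N%:R) * pi0 * (1 - kap) ^+ m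
  * (legH n.+1 m kap).[1]
  * ((1 - kap) * (legH n.+1 m kap)^`().[1] + m%:R * (legH n.+1 m kap).[1])
  * (2 * (n.+1 + m)`!%:R / ((2 * n.+1).+1%:R * (n.+1 - m)`!%:R)).

Lemma energy_nonzero (pi0 : C) n m nu (T := nu^-1) : (m <= n.+1)%N -> nu != 0 ->
  energy pi0 n m (nu ^+ 2) =
  ((n.+1 - m)`!%:R / (dfact (2 * n).+1)%:R) ^+ 2 * (1 + (m == 0)%N%:R) * pi0 * nu ^+ (2 * n + 3)
  * (T ^+ 2 - 1) ^+ m * (legD C n.+1 m).[T]
  * ((T ^+ 2 - 1) * (legD C n.+1 m.+1).[T] + m%:R * T * (legD C n.+1 m).[T])
  * (2 * (n.+1 + m)`!%:R / ((2 * n.+1).+1%:R * (n.+1 - m)`!%:R)).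
Proof.
move=> mn nu0; rewrite /energy.
have nuT : nu * T = 1 by rewrite mulfV.
set d := (n.+1 - m)%N.
have e : legH n.+1 m (nu ^+ 2) = (nu ^+ d)%:P * (legD C n.+1 m \Po (T *: 'X)).
  by rewrite /legH homogE // ?size_legD //; exact: legD_has_parity.
have e1 : (legH n.+1 m (nu ^+ 2)).[1] = nu ^+ d * (legD C n.+1 m).[T].
  by rewrite e hornerM hornerC horner_comp hornerZ hornerX mulr1.
have e2 : (legH n.+1 m (nu ^+ 2))^`().[1] = nu ^+ d * (T * (legD C n.+1 m.+1).[T]).
  rewrite e deriv_mulC deriv_comp derivZ derivX hornerM hornerC hornerM horner_comp.
  by rewrite !hornerZ hornerX mulr1 -polyC1 hornerC mulr1 [_ * T]mulrC legD_S.
rewrite e1 e2.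
(* [nu^(2m)] comes from [(1 - nu^2)^m], each [legH] gives [nu^d], and the single [nu] is what
   remains of [nu^2 T] in the conormal derivative. *)
have -> : nu ^+ (2 * n + 3) = nu * (nu ^+ 2) ^+ m * nu ^+ d * nu ^+ d.
  rewrite -exprM -exprS -!exprD; congr (_ ^+ _); rewrite /d; lia.
have -> : 1 - nu ^+ 2 = nu ^+ 2 * (T ^+ 2 - 1).
  by rewrite mulrBr mulr1 -exprMn nuT expr1n.
rewrite (exprMn m (nu ^+ 2)).
have -> : nu ^+ 2 * (T ^+ 2 - 1) * (nu ^+ d * (T * (legD C n.+1 m.+1).[T])) =
   nu * nu ^+ d * ((T ^+ 2 - 1) * (legD C n.+1 m.+1).[T]).
  by rewrite -[RHS]mul1r -nuT; ring.
have -> : m%:R * (nu ^+ d * (legD C n.+1 m).[T]) = m%:R * (nu * T) * (nu ^+ d * (legD C n.+1 m).[T]).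
  by rewrite nuT mulr1.
ring.
Qed.

Let I (nu : C) n k := legendreI nu n (Posz k).

Lemma legendreI_W nu n k : nu != 0 ->
  (4 * n + 6)%:R * I nu n k = (nu^-1 ^+ 2 - 1) ^+ k.+1 * (legW C n k).[nu^-1].
Proof. by move=> nu0; rewrite /I legendreI_nat // legI_wronskian. Qed.

Lemma eval_legW0 n (T : C) (e := T ^+ 2 - 1) :
  e * (legW C n 1).[T] + (n.+1 * n.+2)%:R * (legW C n 0).[T]
  = (4 * n + 6)%:R * (legD C n.+1 0).[T] * (legD C n.+1 1).[T].
Proof.
have c k : (k%:R : {poly C}).[T] = k%:R by rewrite -polyC_natr hornerC.
have gen (k l : nat) (w1 w0 a b : {poly C}) : ('X^2 - 1) * w1 + k%:R * w0 = l%:R * a * b ->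
    (T ^+ 2 - 1) * w1.[T] + k%:R * w0.[T] = l%:R * a.[T] * b.[T].
  move=> /(congr1 (horner^~ T)).
  by rewrite hornerD !hornerM !c hornerD hornerN hornerXn -[1 in X in X -> _]polyC1 hornerC.
exact: gen (legW0_sum C n).
Qed.

Lemma eval_legWS n j (N := n.+1) (T : C) (e := T ^+ 2 - 1) :
  (N + j)%:R * (N + j).+1%:R * (N%:R - j%:R) * (N.+1%:R - j%:R) * (legW C n j).[T]
  + e ^+ 2 * (legW C n j.+2).[T]
  + 2%:R * (N%:R - j%:R) * (N + j).+1%:R * (e * (legW C n j.+1).[T])
  = (8 * n + 12)%:R * (legD C N j.+1).[T] * (e * (legD C N j.+2).[T] + j.+1%:R * T * (legD C N j.+1).[T]).
Proof.
have c k : (k%:R : {poly C}).[T] = k%:R by rewrite -polyC_natr hornerC.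
have gen (a b k l u v : nat) (w0 w1 w2 p q : {poly C}) :
    a%:R * b%:R * (k%:R - u%:R) * (l%:R - u%:R) * w0 + ('X^2 - 1) ^+ 2 * w2
      + 2%:R * (k%:R - u%:R) * b%:R * (('X^2 - 1) * w1)
      = v%:R * p * (('X^2 - 1) * q + u.+1%:R * 'X * p) ->
    a%:R * b%:R * (k%:R - u%:R) * (l%:R - u%:R) * w0.[T] + (T ^+ 2 - 1) ^+ 2 * w2.[T]
      + 2%:R * (k%:R - u%:R) * b%:R * ((T ^+ 2 - 1) * w1.[T])
      = v%:R * p.[T] * ((T ^+ 2 - 1) * q.[T] + u.+1%:R * T * p.[T]).
  have e0 : ('X^2 - 1 : {poly C}).[T] = T ^+ 2 - 1 by rewrite hornerD hornerN hornerXn -polyC1 hornerC.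
  move=> /(congr1 (horner^~ T)); move: e0; move: ('X^2 - 1) (T ^+ 2 - 1) => E0 E1 e0.
  by rewrite !(c, e0, hornerX, horner_exp, hornerM, hornerN, hornerD).
exact: gen (legWS_sum C n j).
Qed.

Lemma fact_neq0 k : k`!%:R != 0 :> C.
Proof. by rewrite pnatr_eq0 -lt0n fact_gt0. Qed.

Lemma norm_formula_energy n m nu : (m <= n.+1)%N -> nu != 0 ->
  norm_formula n m nu = energy (pi : R)%:C n m (nu ^+ 2).
Proof.
move=> mn nu0; rewrite energy_nonzero //; set T := nu^-1.
have c0 : (4 * n + 6)%:R != 0 :> C by rewrite pnatr_eq0 addnS.
have d0 : (dfact (2 * n).+1)%:R != 0 :> C by rewrite pnatr_eq0 -lt0n dfact_gt0.
have fE : (dfact (2 * n + 3))%:R = (2 * n + 3)%:R * (dfact (2 * n).+1)%:R :> C.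
  by rewrite addn3 -natrM.
case: m mn => [|j] mn.
  have k1 : I nu n 1 + (n.+1 * n.+2)%:R * I nu n 0 = (T ^+ 2 - 1) * (legD C n.+1 0).[T] * (legD C n.+1 1).[T].
    apply: (mulfI c0); rewrite mulrDr [_ * (_%:R * I _ _ _)]mulrCA !legendreI_W // -/T.
    transitivity ((T ^+ 2 - 1) * ((4 * n + 6)%:R * (legD C n.+1 0).[T] * (legD C n.+1 1).[T])); last by ring.
    by rewrite -eval_legW0; ring.
  (* At [n = 0] the left side has coefficient [0], and the right side vanishes because
     [P_0^1 = 0]. *)
  have k2 : n%:R * (n + 1)%:R * (n + 3)`!%:R * legendreI nu n (Negz 0) = (n + 1)`!%:R * I nu n 1.
    case: n mn c0 d0 fE k1 => [|n] mn c0 d0 fE k1.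
      rewrite !mul0r; apply/esym/eqP; rewrite mulf_eq0; apply/orP; right.
      apply/eqP/(mulfI c0); rewrite legendreI_W // mulr0 /legW legD_gt // mul0r.
      by rewrite legD_S legD_gt // deriv0 mul0r subr0 horner0 mulr0.
    rewrite legendreI_neg // /I !subn1 !addn1 /= addn3.
    have f1 := fact_neq0 n.+2; have f2 := fact_neq0 n.+4; have f3 := fact_neq0 n.
    rewrite (_ : n.+2`!%:R = n.+2%:R * (n.+1%:R * n`!%:R)) in f1 *; last by rewrite -!natrM.
    have a1 : n.+2%:R != 0 :> C by rewrite pnatr_eq0.
    have a2 : n.+1%:R != 0 :> C by rewrite pnatr_eq0.
    move: (n.+2%:R : C) (n.+1%:R : C) (n`!%:R : C) (n.+4`!%:R : C) (legendreI nu n.+1 1) a1 a2 f1 f2 f3 => a b f g J a1 a2 f1 f2 f3.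
    by field; rewrite f2 f3 a1 a2.
  have p1 : (n + 1)%:R = n%:R + 1 :> C by rewrite natrD.
  have h3 : (n + 3)`!%:R = (n%:R + 3) * (n%:R + 2) * (n%:R + 1) * n`!%:R :> C.
    by rewrite addn3 !factS !natrM -!natr1; ring.
  have h2 : (n + 2)`!%:R = (n%:R + 2) * (n%:R + 1) * n`!%:R :> C.
    by rewrite addn2 !factS !natrM -!natr1; ring.
  have h1 : (n + 1)`!%:R = (n%:R + 1) * n`!%:R :> C.
    by rewrite addn1 !factS !natrM -!natr1; ring.
  have q1 : n%:R + 1 != 0 :> C by rewrite natr1 pnatr_eq0.
  have q2 : n%:R + 2 != 0 :> C by rewrite -natrD addn2 pnatr_eq0.
  have q3 : 2 * n%:R + 3 != 0 :> C by rewrite -natrM -natrD addn3 pnatr_eq0.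
  have f3 := fact_neq0 n.
  transitivity ((pi : R)%:C * nu ^+ (2 * n + 3) /
    (n.+2%:R * (n + 2)%:R * (dfact (2 * n).+1)%:R * (dfact (2 * n + 3))%:R)
    * (n.+2%:R * (n + 2)`!%:R * (n%:R * (n + 1)%:R * (n + 3)`!%:R * legendreI nu n (Negz 0))
     + 2 * (n + 2)%:R * (n + 1)`!%:R * (n + 2)`!%:R * I nu n 1
     + n.+2%:R * (n + 1)`!%:R * (n + 2)`!%:R
     * (I nu n 1 + 2 * (n + 2)%:R * (n + 1)%:R * (1 + 1) * I nu n 0))).
    rewrite /norm_formula /I -[0%:Z + 1]/(Posz 1) -[0%:Z - 1]/(Negz 0) -[(1 : int)]/(Posz 1).
    rewrite !addn0 !subn0 !addn1 eqxx mulr1; congr (_ * _).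
    move: (legendreI _ _ _) (legendreI _ _ _) (legendreI _ _ _) (n + 3)`!%:R (n + 2)`!%:R (n.+1)`!%:R => J1 J2 J3 f1 f2 f4.
    by move: n.+2%:R n.+1%:R => a b; rewrite -[true%:R]/(1 : C); ring.
  (* The contributions of [I[n, 1]] now add up to four times a common factor, so the bracket is a
     multiple of the sum evaluated in [k1]. *)
  rewrite k2 fE.
  have {k1}-> : I nu n 1 = (T ^+ 2 - 1) * (legD C n.+1 0).[T] * (legD C n.+1 1).[T]
        - (n%:R + 1) * (n%:R + 2) * I nu n 0.
    by rewrite -k1 natrM -!natr1; ring.
  rewrite !subn0 addn0 -[n.+2]addn2 -[n.+1]addn1 h1 h2 p1 expr0 eqxx -[(2 * (n + 1)).+1]addn1 !(natrM, natrD).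
  move: q1 q2 q3 f3 d0.
  move: (legD C _ _).[T] (legD C _ _).[T] (I nu n 0) (nu ^+ _) (pi : R)%:C (n%:R : C) (n`!%:R : C) ((dfact (2 * n).+1)%:R : C) => a b J v p N f d q1 q2 q3 f3 d0.
  rewrite -[true%:R]/(1 : C); have q4 : 2 * (N + 1) + 1 != 0 by rewrite (_ : _ + 1 = 2 * N + 3) //; ring.
  by field; rewrite f3 q1 q4 d0.
(* With [m = j + 1], [K] is [n + 1 - m]; taking [K!] out of every factorial of the bracket leaves
   the coefficients of [legWS_sum]. *)
set K := (n - j)%N.
set e := T ^+ 2 - 1; set p := (legD C n.+1 j.+1).[T]; set q := (legD C n.+1 j.+2).[T].
have k : (n + j.+1)%:R * (n + j.+1 + 1)%:R * K.+1%:R * K.+2%:R * I nu n j + I nu n j.+2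
    + 2%:R * K.+1%:R * (n + j.+1 + 1)%:R * I nu n j.+1 = 2 * e ^+ j.+1 * p * (e * q + j.+1%:R * T * p).
  have := eval_legWS n j T; rewrite -/e -/p -/q.
  have -> : n.+1%:R - j%:R = K.+1%:R :> C by rewrite -natrB; [congr _%:R|]; lia.
  have -> : n.+2%:R - j%:R = K.+2%:R :> C by rewrite -natrB; [congr _%:R|]; lia.
  rewrite addSnnS addn1 => h; apply: (mulfI c0).
  have h0 := legendreI_W n j nu0; have h1 := legendreI_W n j.+1 nu0; have h2 := legendreI_W n j.+2 nu0.
  rewrite -/T -/e in h0 h1 h2.
  transitivity (e ^+ j.+1 * ((4 * n + 6)%:R * 2 * p * (e * q + j.+1%:R * T * p))); last by ring.
  have c2 : (8 * n + 12)%:R = (4 * n + 6)%:R * 2 :> C by rewrite -natrM; congr _%:R; lia.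
  rewrite -c2 -h.
  rewrite [e ^+ j.+3]exprSr [e ^+ j.+2]exprSr in h1 h2.
  move: (n + j.+1)%:R (n + j.+1).+1%:R K.+1%:R K.+2%:R => a b c d.
  transitivity (a * b * c * d * ((4 * n + 6)%:R * I nu n j) + (4 * n + 6)%:R * I nu n j.+2
    + 2%:R * c * b * ((4 * n + 6)%:R * I nu n j.+1)); first by ring.
  by rewrite h0 h1 h2; ring.
have f1 : (n + j.+1 + 2)`!%:R = (n + j.+1 + 2)%:R * (n.+1 + j.+1)`!%:R :> C.
  by rewrite addn2 factS natrM addSn.
have f2 : (n + 3 - j.+1)`!%:R = K.+2%:R * K.+1%:R * K`!%:R :> C.
  have -> : (n + 3 - j.+1)%N = K.+2 by rewrite /K; lia.
  by rewrite !factS !natrM mulrA.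
have g1 : (n + 1 - j.+1)%N = K by rewrite /K; lia.
have g2 : (n + 2 - j.+1)%N = K.+1 by rewrite /K; lia.
have g3 : (n.+1 - j.+1)%N = K by rewrite /K; lia.
transitivity ((pi : R)%:C * nu ^+ (2 * n + 3) /
    (n.+2%:R * (n + j.+1 + 2)%:R * (dfact (2 * n).+1)%:R * (dfact (2 * n + 3))%:R)
    * (n.+2%:R * (n + j.+1 + 2)`!%:R * K`!%:R *
      ((n + j.+1)%:R * (n + j.+1 + 1)%:R * K.+1%:R * K.+2%:R * I nu n j + I nu n j.+2
    + 2%:R * K.+1%:R * (n + j.+1 + 1)%:R * I nu n j.+1))).
  rewrite /norm_formula /I -[j.+1%:Z + 1]/(Posz (j.+1 + 1)) [(j.+1 + 1)%N]addn1 subzSS subr0.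
  rewrite f2 g1 g2 [(2 * n + 1)%N]addn1; have -> : (j.+1 == 0%N)%:R = 0 :> C by [].
  congr (_ * _).
  move: (legendreI _ _ _) (legendreI _ _ _) (legendreI _ _ _) (legendreI _ _ _) ((n + j.+1 + 2)`!%:R) (n + 1)`!%:R (n + 2)`!%:R K`!%:R  => J1 J2 J3 J4 f4 f5 f6 f7.
  move: n.+2%:R (n + j.+1)%:R (n + j.+1 + 1)%:R K.+1%:R K.+2%:R => a b c x y.
  by ring.
rewrite k f1 g3 fE.
have q1 : n.+2%:R != 0 :> C by rewrite pnatr_eq0.
have q2 : (n + j.+1 + 2)%:R != 0 :> C by rewrite addn2 pnatr_eq0.
have q3 : (2 * n + 3)%:R != 0 :> C by rewrite addn3 pnatr_eq0.
have -> : (2 * n.+1).+1 = (2 * n + 3)%N by lia.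
have q4 := fact_neq0 K.
move: (dfact _)%:R (K`!%:R) n.+2%:R (n + j.+1 + 2)%:R (2 * n + 3)%:R (n.+1 + j.+1)`!%:R d0 q1 q2 q3 q4 (e ^+ j.+1) (nu ^+ _) (pi : R)%:C (j.+1%:R * T * p) => D k1 a b c f d0 q1 q2 q3 q4 ej v pi0 s.
have -> : (j.+1 == 0%N)%:R = 0 :> C by [].
by field; rewrite q1 d0 q2 q3 q4.
Qed.
End NormFormula.

Section EnergyPolynomial.

Lemma map_legH (F G : numFieldType) (f : {rmorphism F -> G}) n m kap :
  map_poly f (legH n m kap) = legH n m (f kap).
Proof.
apply/polyP => i; rewrite coef_map !coef_poly; case: ltnP => _ /=; last by rewrite rmorph0.
rewrite rmorphM rmorphXn -coef_map /legD /leg -derivn_map map_polyZ -derivn_map rmorphXn rmorphB /=.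
by rewrite map_polyXn rmorph1 fmorphV rmorph_nat.
Qed.

Lemma rmorph_energy (F G : numFieldType) (f : {rmorphism F -> G}) pi0 n m kap :
  f (energy pi0 n m kap) = energy (f pi0) n m (f kap).
Proof.
have gen (a b c k l u : nat) (x y z w : F) :
    f ((a%:R / b%:R) ^+ 2 * (1 + c%:R) * x * (1 - y) ^+ m * z * ((1 - y) * w + l%:R * z)
       * (2 * u%:R / (k%:R * a%:R)))
    = (a%:R / b%:R) ^+ 2 * (1 + c%:R) * f x * (1 - f y) ^+ m * f z
      * ((1 - f y) * f w + l%:R * f z) * (2 * u%:R / (k%:R * a%:R)).
  by rewrite !(rmorph_nat, rmorph1, rmorphXn, rmorphM, rmorphB, rmorphD, fmorphV).
have h1 p : (map_poly f p).[1] = f p.[1] by rewrite -[1 in LHS](rmorph1 f) horner_map.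
rewrite /energy -!map_legH deriv_map !h1; exact: gen.
Qed.

Lemma energy_horner (F : numFieldType) (pi0 : F) n m :
  exists q : {poly F}, forall kap, energy pi0 n m kap = q.[kap].
Proof.
pose d := (n.+1 - m)%N; pose p := legD F n.+1 m.
pose q0 : {poly F} := \sum_(i < d.+1) p`_i *: 'X^((d - i)./2).
pose q1 : {poly F} := \sum_(i < d.+1) (p`_i *+ i) *: 'X^((d - i)./2).
have q0E kap : (legH n.+1 m kap).[1] = q0.[kap].
  rewrite horner_poly horner_sum; apply: eq_bigr => i _.
  by rewrite expr1n mulr1 hornerZ hornerXn.
have q1E kap : (legH n.+1 m kap)^`().[1] = q1.[kap].
  rewrite /legH /homog poly_def raddf_sum !horner_sum; apply: eq_bigr => i _.
  by rewrite /= derivZ derivXn !hornerZ hornerMn !hornerXn expr1n mulrnAl mulrnAr mulr1.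
exists ((((n.+1 - m)`!%:R / (dfact (2 * n).+1)%:R) ^+ 2 * (1 + (m == 0)%N%:R) * pi0)%:P
  * (1%:P - 'X) ^+ m * q0 * ((1%:P - 'X) * q1 + m%:R%:P * q0)
  * (2 * (n.+1 + m)`!%:R / ((2 * n.+1).+1%:R * (n.+1 - m)`!%:R))%:P) => kap.
by rewrite /energy q0E q1E !(hornerM, hornerD, hornerN, horner_exp, hornerC, hornerX).
Qed.

End EnergyPolynomial.

Section Main.
Variable R : realType.
Notation C := R[i].

Lemma continuous_hornerC (q : {poly C}) : continuous (fun z : C^o => q.[z] : C^o).
Proof.
elim/poly_ind: q => [|q c ih].
  have -> : (fun z : C^o => (0 : {poly C}).[z] : C^o) = fun=> 0 by apply: funext => z; rewrite horner0.
  exact: (@cst_continuous C^o C^o 0).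
have -> : (fun z : C^o => (q * 'X + c%:P).[z] : C^o) = fun z => q.[z] * z + c.
  by apply: funext => z; rewrite hornerMXaddC.
move=> z; have FF := @nbhs_filter C^o z; rewrite /continuous_at.
apply: (@cvgD _ _ _ _ FF); last exact: (@cst_continuous C^o C^o c).
by apply: (@cvgM _ _ _ FF); [exact: ih | exact: cvg_id].
Qed.

Lemma normX_energy (mu : C) s n m : admissible mu -> basis_index s n m ->
  ((norm mu (X s n m mu)) ^+ 2)%:C = energy (pi : R)%:C n m (mu ^+ 2).
Proof.
move=> hmu hb; have [ek k1] := admissible_sqr hmu; rewrite [in RHS]ek.
rewrite /norm sqr_sqrtr; last first.
  by apply: Rintegral_ge0 => x _; rewrite !addr_ge0 // -expr2 sqr_ge0.
rewrite inner_X_energy // legJ_norm; last by case/andP: hb.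
rewrite -[(pi : R)%:C]/(real_complex R pi) -[_%:C in RHS]/(real_complex R _).
rewrite -rmorph_energy; congr (_%:C).
rewrite /energy /Kc.
by rewrite (_ : (2 * n.+1).-1 = (2 * n).+1) // mulnS.
Qed.

(** On the punctured neighbourhood, which contains all small nonzero complex [nu], the formula
    equals [energy] at [nu^2]; this is a polynomial in [nu], hence continuous at [0]. *)
Lemma norm_formula_cvg0 n m : (m <= n.+1)%N ->
  norm_formula n m nu @[nu --> (0 : C^o)^'] --> (energy (pi : R)%:C n m 0 : C^o).
Proof.
move=> mn; have [q qE] := energy_horner (pi : R)%:C n m.
have h : (q \Po 'X^2).[nu] @[nu --> (0 : C^o)^'] --> (energy (pi : R)%:C n m 0 : C^o).
  rewrite qE -[X in q.[X]](expr0n C 2) -[X in q.[X]]hornerXn -horner_comp.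
  apply: cvg_trans (@continuous_hornerC (q \Po 'X^2) 0); apply: cvg_app; exact: nbhs_dnbhs.
apply: cvg_trans h; apply: near_eq_cvg; near=> nu.
rewrite norm_formula_energy //; last by near: nu; exact: (@nbhs_dnbhs_neq C^o 0).
by rewrite qE horner_comp hornerXn.
Unshelve. all: by end_near.
Qed.

End Main.

Theorem theorem3p2 (R : realType) (mu : R[i]) (hmu : admissible mu) :
  (forall (s s' : bool) (n n' m m' : nat),
      basis_index s n m -> basis_index s' n' m' ->
      (s, n, m) <> (s', n', m') ->
      inner mu (X s n m mu) (X s' n' m' mu) = 0) /\
  (forall (s : bool) (n m : nat), basis_index s n m ->
      (mu <> 0 ->
        ((norm mu (X s n m mu)) ^+ 2)%:C = norm_formula n m mu) /\
      (mu = 0 ->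
        norm_formula n m nu @[nu --> (0 : R[i]^o)^']
          --> (((norm mu (X s n m mu)) ^+ 2)%:C : R[i]^o))).
Proof.
split=> [s s' n n' m m' hb hb' ne|s n m hb]; last first.
  rewrite normX_energy //; have /andP[_ mn] := hb.
  split=> [/eqP mu0|->]; first by rewrite norm_formula_energy.
  by rewrite expr0n; exact: norm_formula_cvg0.
have [e|/eqP ne'] := eqVneq (s, m) (s', m'); last exact: inner_X_ortho.
case: e ne hb' => <- <- ne hb'; rewrite inner_X_energy // legJ_ortho ?mulr0 //.
by apply/eqP => -[nn]; apply: ne; rewrite nn.
Qed.
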